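(* Let $\mathcal{V}\models ZFC$ be a pure universe, and let $\mathcal{Q}:=\langle\mathbb{Q},\leq\rangle$ and $\mathcal{R}:=\langle\mathbb{R},\leq\rangle$ (in $\mathcal V$). Then $$\langle PM(\mathcal{R}),\underline{\mathcal{R}}\rangle\equiv\langle PM(\mathcal{Q}),\underline{\mathcal{Q}}\rangle,$$ i.e. for every formula $\varphi(x)$ in the language $\{\in,\mathbb{A}\}$ of set theory with atoms, $PM(\mathcal{R})\models\varphi(\underline{\mathcal{R}})$ iff $PM(\mathcal{Q})\models\varphi(\underline{\mathcal{Q}})$.
   Context: $ZFA$ is set theory with atoms in the language $\{\in,\mathbb{A}\}$ ($\mathbb{A}$ a unary predicate): the axioms of $ZF$ with extensionality restricted to non-atoms (''sets''), plus: atoms have no elements, and the atoms form a set, also denoted $\mathbb{A}$. In a model of $ZFA$, every $\pi\in Sym(\mathbb{A})$ extends to the universe by $\pi(x)=\{\pi(y):y\in x\}$ for sets $x$. For $G\leqslant Sym(\mathbb{A})$, $G_x=\{\pi\in G:\pi(x)=x\}$. $\mathcal{F}^G_{fin}$ is the set of subgroups $H\leqslant G$ with $G_{\mathbf a}\leqslant H$ for some finite tuple $\mathbf{a}\in\mathbb{A}^{<\omega}$. $PM(\mathcal{M},G,\mathcal{F})$ is the class of $x\in\mathcal{M}$ such that $G_y\in\mathcal{F}$ for all $y\in TC(\{x\})$ ($TC$ = transitive closure), computed in $\mathcal{M}$. Definition of $PM(\mathcal{A}^* )$ and $\underline{\mathcal{A}^*}$ for a structure $\mathcal{A}^*\in\mathcal{V}$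 with underlying set $x$. Define $\mathcal{V}^*(x)=\bigcup_\alpha\mathcal{V}^*(x)_\alpha$ by $\mathcal{V}^*(x)_0=x\times\{1\}$, $\mathcal{V}^*(x)_{\alpha+1}=(\mathcal{P}(\mathcal{V}^*(x)_\alpha)\times\{0\})\cup\mathcal{V}^*(x)_\alpha$, unions at limits. Its membership relation is $w\mathrel{\dot\in}y\iff y=\langle z,0\rangle$ for some $z$ with $w\in z$, and its atoms are the elements of the form $\langle z,1\rangle$. With these relations it is a model of $ZFA$ whose pure universe (sets hereditarily containing no atoms) is isomorphic to $\mathcal{V}$ via $F(y)=\langle\{F(z):z\in y\},0\rangle$. $\underline{\mathcal{A}^*}\in\mathcal{V}^*(x)$ is the structure on the set of atoms of $\mathcal{V}^*(x)$ obtained by transporting $F(\mathcal{A}^* )$ along the bijection $F(a)\mapsto\langle a,1\rangle$, $a\in x$; and $PM(\mathcal{A}^* ):=PM(\mathcal{V}^*(x),Aut(\underline{\mathcal{A}^*}),\mathcal{F}^{Aut(\underline{\mathcal{A}^*})}_{fin})$, computed in $\mathcal{V}^*(x)$. *)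

(* Defs.v *)
Set Implicit Arguments.
Unset Strict Implicit.
Unset Printing Implicit Defensive.

(** * Structures and formulas in the language {∈, 𝔸} *)

Record structure : Type := Structure {
  carrier :> Type;
  mem : carrier -> carrier -> Prop;
  atom : carrier -> Prop
}.

Notation "x ∈ y" := (mem x y) (at level 70, no associativity).

(* Formulas with free variables in [X]; [option X] adds the bound variable
   [None].  The other connectives and [∃] are the classical abbreviations. *)
Inductive formula (X : Type) : Type :=
| f_mem (x y : X)
| f_atom (x : X)
| f_eq (x y : X)
| f_bot
| f_imp (p q : formula X)
| f_all (p : formula (option X)).

Definition env_cons (T X : Type) (a : T) (e : X -> T) (i : option X) : T :=
  match i with None => a | Some j => e j end.

Fixpoint sat (M : structure) (X : Type) (e : X -> M) (p : formula X) : Prop :=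
  match p with
  | f_mem x y => e x ∈ e y
  | f_atom x => atom (e x)
  | f_eq x y => e x = e y
  | f_bot _ => False
  | f_imp p q => sat e p -> sat e q
  | f_all p => forall a : M, sat (env_cons a e) p
  end.

Definition substructure (M : structure) (D : M -> Prop) : structure :=
  {| carrier := {x : M | D x};
     mem := fun x y => proj1_sig x ∈ proj1_sig y;
     atom := fun x => atom (proj1_sig x) |}.

(** * Set-theoretic notions, computed in a structure *)

Section Vocabulary.
Variable M : structure.
Implicit Types x y z f g n p t G H K : M.

Definition is_set x : Prop := ~ atom x.
Definition subset x y : Prop := is_set x /\ is_set y /\ forall z, z ∈ x -> z ∈ y.
Definition is_empty x : Prop := is_set x /\ forall z, ~ z ∈ x.
Definition is_upair p x y : Prop :=
  is_set p /\ forall z, z ∈ p <-> z = x \/ z = y.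
(* [p = ⟨x, y⟩ = {{x}, {x, y}}] *)
Definition is_pair p x y : Prop :=
  exists s d, is_upair s x x /\ is_upair d x y /\ is_upair p s d.
(* [y = x ∪ {x}] *)
Definition is_succ x y : Prop :=
  is_set y /\ forall z, z ∈ y <-> z ∈ x \/ z = x.
Definition is_zero x : Prop := is_empty x.
Definition is_one x : Prop := exists o, is_zero o /\ is_succ o x.

Definition transitive t : Prop :=
  is_set t /\ forall y z, z ∈ y -> y ∈ t -> z ∈ t.
(* [y ∈ TC({x})] *)
Definition in_TC_singleton x y : Prop :=
  forall t, transitive t -> x ∈ t -> y ∈ t.

Definition inductive_set x : Prop :=
  is_set x /\ (exists o, is_empty o /\ o ∈ x) /\
  (forall y, y ∈ x -> exists y', is_succ y y' /\ y' ∈ x).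
Definition is_nat n : Prop := forall x, inductive_set x -> n ∈ x.

(* [⟨x, y⟩ ∈ f] *)
Definition app f x y : Prop := exists p, is_pair p x y /\ p ∈ f.
Definition is_relation f : Prop :=
  is_set f /\ forall p, p ∈ f -> exists x y, is_pair p x y.
Definition is_function f : Prop :=
  is_relation f /\ forall x y y', app f x y -> app f x y' -> y = y'.

(* The class function [R] defined by ∈-recursion from the clause
   [R x = y <-> step x (R restricted to x) y]: [R x = y] when some set function
   with transitively closed domain obeys the clause and sends [x] to [y]. *)
Definition by_recursion (step : M -> M -> M -> Prop) x y : Prop :=
  exists f, is_function f /\
    (forall u v, app f u v ->
       (forall z, z ∈ u -> exists w, app f z w) /\ step u f v) /\
    app f x y.

(** ** Permutations, and their action on the universe *)

Definition is_permutation x g : Prop :=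
  is_function g /\
  (forall u, u ∈ x <-> exists v, app g u v) /\
  (forall v, v ∈ x <-> exists u, app g u v) /\
  (forall u u' v, app g u v -> app g u' v -> u = u').

Definition is_composition g f h : Prop :=
  is_set h /\
  forall p, p ∈ h <-> exists x y z, app f x y /\ app g y z /\ is_pair p x z.
Definition is_inverse f h : Prop :=
  is_set h /\ forall p, p ∈ h <-> exists x y, app f x y /\ is_pair p y x.

(* [y = g(x)], where [g] permutes the atoms *)
Definition act g : M -> M -> Prop :=
  by_recursion (fun u f v =>
    (atom u /\ app g u v) \/
    (is_set u /\ is_set v /\
     forall w, w ∈ v <-> exists z, z ∈ u /\ app f z w)).

(* [H = G_x] *)
Definition is_stabilizer G x H : Prop :=
  is_set H /\ forall g, g ∈ H <-> g ∈ G /\ act g x x.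

Definition subgroup H G : Prop :=
  subset H G /\ (exists g, g ∈ H) /\
  (forall f g h, f ∈ H -> g ∈ H -> is_composition g f h -> h ∈ H) /\
  (forall f h, f ∈ H -> is_inverse f h -> h ∈ H).

(* a finite sequence of atoms *)
Definition atom_tuple t : Prop :=
  exists n, is_nat n /\ is_function t /\
    (forall i, i ∈ n <-> exists a, app t i a) /\
    (forall i a, app t i a -> atom a).

Definition F_fin G H : Prop :=
  subgroup H G /\
  exists t K, atom_tuple t /\ is_stabilizer G t K /\ subset K H.

(* membership in the class [PM(M, G, F)] *)
Definition in_PM G (F : M -> Prop) x : Prop :=
  forall y, in_TC_singleton x y -> exists H, is_stabilizer G y H /\ F H.

(** ** Automorphisms of a binary relational structure [u = ⟨S, T⟩] *)

Definition is_automorphism u g : Prop :=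
  exists S T, is_pair u S T /\ is_permutation S g /\
    forall a b a' b', app g a a' -> app g b b' -> (app T a b <-> app T a' b').

Definition is_Aut u G : Prop :=
  is_set G /\ forall g, g ∈ G <-> is_automorphism u g.

End Vocabulary.

(** * Models of ZFC *)

(* A structure for {∈} is one for {∈, 𝔸} in which [𝔸] is empty; the schemas may
   then mention [𝔸], since [𝔸(x)] is equivalent to [⊥]. *)
Record ZFC (V : structure) : Prop := {
  zfc_no_atoms : forall x : V, ~ atom x;
  zfc_extensionality :
    forall x y : V, (forall z, z ∈ x <-> z ∈ y) -> x = y;
  zfc_foundation :
    forall x : V, (exists y, y ∈ x) ->
      exists y, y ∈ x /\ forall z, z ∈ y -> ~ z ∈ x;
  zfc_pairing : forall x y : V, exists p, is_upair p x y;
  zfc_union :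
    forall x : V, exists u, forall z, z ∈ u <-> exists y, y ∈ x /\ z ∈ y;
  zfc_powerset : forall x : V, exists p, forall y, y ∈ p <-> subset y x;
  zfc_infinity : exists x : V, inductive_set x;
  zfc_separation :
    forall (phi : formula (option nat)) (e : nat -> V) (x : V),
      exists y, forall z, z ∈ y <-> z ∈ x /\ sat (env_cons z e) phi;
  zfc_replacement :
    forall (phi : formula (option (option nat))) (e : nat -> V) (x : V),
      (forall z w w', z ∈ x -> sat (env_cons w (env_cons z e)) phi ->
         sat (env_cons w' (env_cons z e)) phi -> w = w') ->
      exists y, forall w, w ∈ y <->
        exists z, z ∈ x /\ sat (env_cons w (env_cons z e)) phi;
  zfc_choice :
    forall x : V, (forall y, y ∈ x -> exists z, z ∈ y) ->
      (forall y y' z, y ∈ x -> y' ∈ x -> z ∈ y -> z ∈ y' -> y = y') ->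
      exists c, forall y, y ∈ x -> exists! z, z ∈ y /\ z ∈ c
}.

(** * The ordered sets of rationals and reals of a pure universe *)

Section Numbers.
Variable V : structure.
Implicit Types m n k p q t c X L : V.

(* [b] is the [n]-th iterate of the class function [S] at [a]. *)
Definition is_iterate (S : V -> V -> Prop) a n b : Prop :=
  exists f, is_function f /\
    (exists o, is_zero o /\ app f o a) /\
    (forall i, i ∈ n -> exists i' u u',
       is_succ i i' /\ app f i u /\ app f i' u' /\ S u u') /\
    app f n b.

Definition nat_add m n k : Prop := is_iterate (@is_succ V) m n k.
Definition nat_mul m n k : Prop :=
  exists o, is_zero o /\ is_iterate (fun u v => nat_add u m v) o n k.
Definition nat_le m n : Prop := m ∈ n \/ m = n.

(* [t = ⟨⟨a, b⟩, c⟩] is a name of the rational number [(a - b) / c]. *)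
Definition is_fraction t a b c : Prop :=
  is_nat a /\ is_nat b /\ is_nat c /\ ~ is_zero c /\
  exists p, is_pair p a b /\ is_pair t p c.

(* [(a - b) / c <= (a' - b') / c'], i.e. [a c' + b' c <= a' c + b c'] *)
Definition fraction_le t t' : Prop :=
  exists a b c a' b' c', is_fraction t a b c /\ is_fraction t' a' b' c' /\
  exists m1 m2 n1 n2 s s',
    nat_mul a c' m1 /\ nat_mul b' c m2 /\ nat_add m1 m2 s /\
    nat_mul a' c n1 /\ nat_mul b c' n2 /\ nat_add n1 n2 s' /\
    nat_le s s'.

(* Rational numbers are the classes of fractions with the same value. *)
Definition is_rational q : Prop :=
  exists t, (exists a b c, is_fraction t a b c) /\
    forall s, s ∈ q <-> fraction_le s t /\ fraction_le t s.
Definition rational_le q q' : Prop :=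
  exists t t', t ∈ q /\ t' ∈ q' /\ fraction_le t t'.

(* Real numbers are the Dedekind cuts of the rationals, ordered by inclusion. *)
Definition is_real c : Prop :=
  (forall q, q ∈ c -> is_rational q) /\
  (exists q, q ∈ c) /\
  (exists q, is_rational q /\ ~ q ∈ c) /\
  (forall q q', q ∈ c -> is_rational q' -> rational_le q' q -> q' ∈ c) /\
  (forall q, q ∈ c -> exists q', q' ∈ c /\ rational_le q q' /\ q <> q').

(* [⟨X, L⟩ = ⟨ℚ, ≤⟩] *)
Definition is_rational_order X L : Prop :=
  (forall q, q ∈ X <-> is_rational q) /\
  (forall p, p ∈ L <-> exists q q',
     is_rational q /\ is_rational q' /\ rational_le q q' /\ is_pair p q q').

(* [⟨X, L⟩ = ⟨ℝ, ≤⟩] *)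
Definition is_real_order X L : Prop :=
  (forall c, c ∈ X <-> is_real c) /\
  (forall p, p ∈ L <-> exists c c',
     is_real c /\ is_real c' /\ subset c c' /\ is_pair p c c').

End Numbers.

(** * The universe [V*(X)] with the elements of [X] as atoms *)

Section AtomicUniverse.
Variable V : structure.
Implicit Types X L : V.

Definition is_ordinal (a : V) : Prop :=
  transitive a /\ forall b, b ∈ a -> transitive b.

(* [y = ⟨z, 0⟩] and [y = ⟨z, 1⟩] *)
Definition tagged0 (y z : V) : Prop := exists o, is_zero o /\ is_pair y z o.
Definition tagged1 (y z : V) : Prop := exists i, is_one i /\ is_pair y z i.

(* [v = V*(X)_a], for an ordinal [a] *)
Definition is_level X : V -> V -> Prop :=
  by_recursion (fun a f v =>
    (is_empty a /\ forall p, p ∈ v <-> exists x, x ∈ X /\ tagged1 p x) \/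
    (exists b w, is_succ b a /\ app f b w /\
       forall p, p ∈ v <-> (exists z, subset z w /\ tagged0 p z) \/ p ∈ w) \/
    (~ is_empty a /\ ~ (exists b, is_succ b a) /\
       forall p, p ∈ v <-> exists b w, b ∈ a /\ app f b w /\ p ∈ w)).

Definition in_Vstar X (y : V) : Prop :=
  exists a v, is_ordinal a /\ is_level X a v /\ y ∈ v.

Definition Vstar X : structure :=
  {| carrier := {y : V | in_Vstar X y};
     mem := fun w y : {y : V | in_Vstar X y} =>
       exists z, tagged0 (proj1_sig y) z /\ proj1_sig w ∈ z;
     atom := fun y : {y : V | in_Vstar X y} =>
       exists z, tagged1 (proj1_sig y) z |}.

(* [v = F(y) = ⟨{F(z) : z ∈ y}, 0⟩] *)
Definition pure_embedding : V -> V -> Prop :=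
  by_recursion (fun y f v => exists s, tagged0 v s /\
    forall w, w ∈ s <-> exists z, z ∈ y /\ app f z w).

(* the bijection [F(x) ↦ ⟨x, 1⟩], for [x ∈ X] *)
Definition to_atom X (d a : Vstar X) : Prop :=
  exists x, x ∈ X /\ pure_embedding x (proj1_sig d) /\ tagged1 (proj1_sig a) x.

(* [u] is the copy on the atoms of [V*(X)] of the structure [A = ⟨X, L⟩]: the
   transport of [F(A) = ⟨D, R⟩] along the above bijection. *)
Definition is_underline X L (u : Vstar X) : Prop :=
  exists (A : V) (FA D R S T : Vstar X),
    is_pair A X L /\ pure_embedding A (proj1_sig FA) /\ is_pair FA D R /\
    is_pair u S T /\
    (is_set S /\ forall a, a ∈ S <-> atom a) /\
    (is_set T /\ forall p, p ∈ T <-> exists d d' a a',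
       app R d d' /\ to_atom d a /\ to_atom d' a' /\ is_pair p a a').

(* the permutation model [PM(A)] of the structure [A = ⟨X, L⟩] *)
Definition PM X L : structure :=
  substructure (fun x : Vstar X => exists u G : Vstar X,
    is_underline L u /\ is_Aut u G /\ in_PM G (F_fin G) x).

End AtomicUniverse.

(* Main.v *)
Require Import Defs.
From Stdlib Require Import Classical ClassicalEpsilon FunctionalExtensionality.
From Stdlib Require Import ProofIrrelevance Arith Ring.
From Corelib Require Import ssreflect ssrfun.
Set Implicit Arguments.
Unset Strict Implicit.
Unset Printing Implicit Defensive.
Set Bullet Behavior "None".

(** An automorphism-equivariant back-and-forth.  Let [A1], [A2] be two of the
    ordered sets.  For a finite partial isomorphism [p] of [A1] into [A2], call
    [x ∈ PM(A1)] and [y ∈ PM(A2)] similar over [p] if [dom p] supports [x],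
    [ran p] supports [y], and either [x], [y] are atoms with [p(x) = y], or they
    are sets and, for every finite [q ⊇ p], the elements of [x] supported by
    [dom q] and those of [y] supported by [ran q] correspond under similarity
    over [q].  By ∈-induction similarity over a fixed [p] is a partial bijection,
    it is equivariant, and it is defined at every [x] supported by [dom p]: the
    partner of [x] is collected from the partners of its elements.  Homogeneity
    of the two orders shows that this set has the right elements.  Since every
    [x] is supported by a finite extension of [p], similarity is a
    back-and-forth system between [PM(A1)] and [PM(A2)], and it relates the two
    structures of atoms over the empty [p].

    Homogeneity is Cantor's back-and-forth argument carried out inside [V] along
    an increasing sequence of finite sets of rationals (the fractions with small
    numerator and denominator), followed for the reals by Dedekind completion. *)

(** [V] is an arbitrary model of first-order ZFC, possibly ill-founded and with nonstandard natural
    numbers, so no recursion or induction of Rocq runs along its sets. Every set formed and every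
    ∈-induction must come from a formula with parameters in [V]. This is why definability is checked
    throughout, why finiteness, recursion and choice are taken inside [V], and why similarity must
    itself be definable. Only formulas are treated by external induction.

    The main obstacle is incompatibility of extensions: an element of [x] may receive its partner
    over some [r ⊇ p] that has no common extension with the [q ⊇ p] at hand. The remedy is always
    the same: enlarge [r], then move it by an automorphism that fixes [dom p]. Such an automorphism
    fixes [x], hence permutes the elements of [x], and it can be chosen so that the moved [r]
    contains [q]. This amalgamation yields the transfer of supports between similar elements, the
    restriction of similarity to smaller [p], and the existence of partners. *)

Fixpoint rename (X Y : Type) (r : X -> Y) (p : formula X) : formula Y :=
  match p with
  | f_mem x y => f_mem (r x) (r y)
  | f_atom x => f_atom (r x)
  | f_eq x y => f_eq (r x) (r y)
  | f_bot _ => f_bot Y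
  | f_imp p q => f_imp (rename r p) (rename r q)
  | f_all p => f_all (rename (option_map r) p)
  end.

Lemma sat_ext (M : structure) (X : Type) (p : formula X) :
  forall e e' : X -> M, (forall i, e i = e' i) -> sat e p <-> sat e' p.
Proof. by move=> e e' /functional_extensionality ->. Qed.

Lemma sat_rename (M : structure) (X Y : Type) (r : X -> Y) (p : formula X) :
  forall e : Y -> M, sat e (rename r p) <-> sat (fun i => e (r i)) p.
Proof.
elim: p Y r => //= [{}X p IHp q IHq|{}X p IH] Y r e.
- by rewrite IHp IHq.
- have H a : sat (env_cons a e) (rename (option_map r) p) <->
             sat (env_cons a (fun i => e (r i))) p.
    by rewrite IH; apply: sat_ext => -[].
  by split=> H1 a; apply/H.
Qed.

Section Universe.
Context (V : structure) (VZ : ZFC V).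

(** * Definability *)

(* The schemas of ZFC speak about formulas with parameters in [V].  [Def P] says
   that [P] is given by such a formula.  Here [P] is a predicate on a type [E] of
   tuples whose components belong to [V] or to types coded in [V], such as
   [Vstar X]; [coord] lists the codes of the components. *)
Class Env (E : Type) := { idx : Type; coord : idx -> E -> V }.

(** Each field serves one need: [sort_def] lets a quantifier over [S] be relativized to a formula
    about codes, [inj_inj] turns equality in [S] into equality of codes, and [dflt] is the fallback
    value of [iota]. *)
Class Sort (S : Type) := {
  inj : S -> V;
  inj_inj : forall x y, inj x = inj y -> x = y;
  dflt : S;
  sort_def : exists (f : formula (option nat)) (c : nat -> V),
    forall a, (exists s, inj s = a) <-> sat (env_cons a c) f }.

#[global] Hint Mode Sort ! : typeclass_instances.

Instance Env_unit : Env unit :=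
  {| idx := Empty_set; coord := fun i _ => match i with end |}.

Instance Env_pair (E S : Type) (HE : Env E) (HS : Sort S) : Env (E * S) :=
  {| idx := option (@idx E HE);
     coord := fun i x => match i with
                         | None => inj (snd x)
                         | Some j => coord j (fst x)
                         end |}.

Definition valuation (E : Type) (HE : Env E) (x : E) (c : nat -> V)
  (i : idx + nat) : V :=
  match i with inl j => coord j x | inr n => c n end.

Definition Def (E : Type) (HE : Env E) (P : E -> Prop) : Prop :=
  exists (f : formula (idx + nat)) (c : nat -> V),
    forall x, P x <-> sat (valuation x c) f.
Arguments Def {E HE} P.

Lemma Def_ext (E : Type) (HE : Env E) (P P' : E -> Prop) :
  (forall x, P x <-> P' x) -> Def P -> Def P'.
Proof. by move=> H [f [c Hf]]; exists f, c => x; rewrite -H. Qed.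

Definition v0 : V := proj1_sig (constructive_indefinite_description _ (zfc_infinity VZ)).

(** Two formulas come with two sequences of parameters; interleaving them gives one sequence for
    their combination, the variables being renamed to even and odd positions. *)
Definition merge (c1 c2 : nat -> V) (n : nat) : V :=
  if Nat.even n then c1 (Nat.div2 n) else c2 (Nat.div2 n).

Lemma merge_even c1 c2 n : merge c1 c2 (2 * n) = c1 n.
Proof. by rewrite /merge Nat.even_even Nat.div2_double. Qed.

Lemma merge_odd c1 c2 n : merge c1 c2 (Datatypes.S (2 * n)) = c2 n.
Proof. by rewrite /merge -Nat.add_1_r Nat.even_odd Nat.add_1_r Nat.div2_succ_double. Qed.

Lemma Def_bot (E : Type) (HE : Env E) : Def (fun _ : E => False).
Proof. by exists (f_bot _), (fun _ => v0). Qed.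

Lemma Def_imp (E : Type) (HE : Env E) (P Q : E -> Prop) :
  Def P -> Def Q -> Def (fun x => P x -> Q x).
Proof.
move=> [f [c Hf]] [g [d Hg]].
pose r (k : nat -> nat) (i : @idx E HE + nat) : @idx E HE + nat := match i with inl j => inl j | inr n => inr (k n) end.
exists (f_imp (rename (r (fun n => 2 * n)) f) (rename (r (fun n => Datatypes.S (2 * n))) g)), (merge c d) => x /=.
rewrite Hf Hg !sat_rename.
have E1 : (fun i => valuation x (merge c d) (r (fun n => 2 * n) i)) = valuation x c.
  by apply: functional_extensionality => -[] //= n; rewrite -(merge_even c d).
have E2 : (fun i => valuation x (merge c d) (r (fun n => Datatypes.S (2 * n)) i)) = valuation x d.
  by apply: functional_extensionality => -[] //= n; rewrite -(merge_odd c d).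
by rewrite E1 E2.
Qed.

(** A quantifier over [S] becomes a quantifier over [V] relativized to the formula [g] that defines
    the codes of [S]. The renaming [r1] puts the parameters of [g] at odd positions and [r2] those
    of [f] at even ones. *)
Lemma Def_all (E S : Type) (HE : Env E) (HS : Sort S) (P : E -> S -> Prop) :
  Def (fun y : E * S => P (fst y) (snd y)) -> Def (fun x => forall s, P x s).
Proof.
move=> [f [c Hf]].
have [g [d Hg]] := sort_def (S := S).
pose r1 (i : option nat) : option (@idx E HE + nat) :=
  match i with None => None | Some n => Some (inr (Datatypes.S (2 * n))) end.
pose r2 (i : option (@idx E HE) + nat) : option (@idx E HE + nat) :=
  match i with inl None => None | inl (Some j) => Some (inl j) | inr n => Some (inr (2 * n)) end.
exists (f_all (f_imp (rename r1 g) (rename r2 f))), (merge c d) => x /=.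
have E1 a : (fun i => env_cons a (valuation x (merge c d)) (r1 i)) = env_cons a d.
  by apply: functional_extensionality => -[] //= n; rewrite -(merge_odd c d).
have E2 (s : S) : (fun i => env_cons (inj s) (valuation x (merge c d)) (r2 i)) = @valuation (E * S) (Env_pair HE HS) (x, s) c.
  by apply: functional_extensionality => -[[]|] //= n; rewrite -(merge_even c d).
split.
- move=> H a; rewrite !sat_rename E1 -Hg => -[s <-]; rewrite E2; apply/(Hf (x, s)); exact: H.
- move=> H s; have /= := H (@inj S HS s); rewrite !sat_rename E1 -Hg E2 => H'; apply/(Hf (x, s)).
  by apply: H'; exists s.
Qed.

Lemma Def_reindex (E E' : Type) (HE : Env E) (HE' : Env E') (P : E -> Prop)
  (f : E' -> E) (r : @idx E HE -> @idx E' HE') :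
  (forall i x, coord i (f x) = coord (r i) x) -> Def P -> Def (fun x => P (f x)).
Proof.
move=> Hr [g [c Hg]].
exists (rename (fun i => match i with inl j => inl (r j) | inr n => inr n end) g), c => x.
rewrite Hg sat_rename; apply: sat_ext => -[i|n] //=; exact: Hr.
Qed.

Lemma Def_not (E : Type) (HE : Env E) (P : E -> Prop) :
  Def P -> Def (fun x => ~ P x).
Proof. by move=> H; apply: Def_imp => //; exact: Def_bot. Qed.

Lemma Def_true (E : Type) (HE : Env E) : Def (fun _ : E => True).
Proof. by apply: (Def_ext (P := fun _ => ~ False)); [tauto|apply/Def_not/Def_bot]. Qed.

Lemma Def_and (E : Type) (HE : Env E) (P Q : E -> Prop) :
  Def P -> Def Q -> Def (fun x => P x /\ Q x).
Proof.
move=> HP HQ; apply: (Def_ext (P := fun x => ~ (P x -> ~ Q x))).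
  by move=> x; tauto.
by apply: Def_not; apply: Def_imp => //; apply: Def_not.
Qed.

Lemma Def_or (E : Type) (HE : Env E) (P Q : E -> Prop) :
  Def P -> Def Q -> Def (fun x => P x \/ Q x).
Proof.
move=> HP HQ; apply: (Def_ext (P := fun x => ~ P x -> Q x)).
  by move=> x; split; case: (classic (P x)); tauto.
by apply: Def_imp => //; apply: Def_not.
Qed.

Lemma Def_iff (E : Type) (HE : Env E) (P Q : E -> Prop) :
  Def P -> Def Q -> Def (fun x => P x <-> Q x).
Proof. by move=> HP HQ; apply: Def_and; apply: Def_imp. Qed.

Lemma Def_ex (E S : Type) (HE : Env E) (HS : Sort S) (P : E -> S -> Prop) :
  Def (fun y : E * S => P (fst y) (snd y)) -> Def (fun x => exists s, P x s).
Proof.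
move=> HP; apply: (Def_ext (P := fun x => ~ forall s, ~ P x s)).
  move=> x; split=> [|[s Hs] H]; last exact: (H s).
  by move/not_all_ex_not => [s /NNPP Hs]; exists s.
by apply/Def_not/Def_all/Def_not.
Qed.

Instance Sort_V : Sort V.
Proof.
refine {| inj := fun x => x; dflt := v0 |} => //.
exists (f_imp (f_bot _) (f_bot _)), (fun _ => v0) => a; by split=> [_ []|_]; exists a.
Defined.

(** The language has no function symbols, so a term counts as definable when the graph of its code
    is. *)
Definition DefT (E S : Type) (HE : Env E) (HS : Sort S) (t : E -> S) : Prop :=
  Def (fun y : E * V => snd y = inj (t (fst y))).
Arguments DefT {E S HE HS} t.

Lemma DefT_coord (E S : Type) (HE : Env E) (HS : Sort S) (t : E -> S) (i : @idx E HE) :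
  (forall x, inj (t x) = coord i x) -> DefT t.
Proof.
move=> H; exists (f_eq (inl None) (inl (Some i))), (fun _ => v0) => -[x a] /=.
by rewrite H.
Qed.

Lemma DefT_const (E S : Type) (HE : Env E) (HS : Sort S) (s : S) :
  DefT (fun _ : E => s).
Proof.
by exists (f_eq (inl None) (inr 0)), (fun _ => inj s) => -[x a].
Qed.

Lemma Def_weak (E S : Type) (HE : Env E) (HS : Sort S) (P : E -> Prop) :
  Def P -> Def (fun y : E * S => P (fst y)).
Proof. exact: (@Def_reindex E (E * S) HE _ P fst Some). Qed.

Lemma DefT_weak (E S S' : Type) (HE : Env E) (HS : Sort S) (HS' : Sort S') (t : E -> S) :
  DefT t -> DefT (fun y : E * S' => t (fst y)).
Proof.
move=> H.
apply: (@Def_reindex (E * V) (E * S' * V) _ _ _ (fun y => (fst (fst y), snd y))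
  (fun i => match i with None => None | Some j => Some (Some j) end) _ H).
by case.
Qed.

Lemma Def_eq (E S : Type) (HE : Env E) (HS : Sort S) (t s : E -> S) :
  DefT t -> DefT s -> Def (fun x => t x = s x).
Proof.
move=> Ht Hs; apply: (Def_ext (P := fun x => exists a : V, a = inj (t x) /\ a = inj (s x))).
  move=> x; split=> [[a [-> H]]|->]; [exact: (inj_inj H)|by exists (inj (s x))].
exact: (Def_ex (Def_and Ht Hs)).
Qed.

Lemma DefT_snd (E S : Type) (HE : Env E) (HS : Sort S) : DefT (fun y : E * S => snd y).
Proof. by apply: (@DefT_coord _ _ _ _ _ (None : @idx (E * S) (Env_pair HE HS))). Qed.

Lemma DefT_inj (E S : Type) (HE : Env E) (HS : Sort S) (t : E -> S) :
  DefT t -> DefT (fun x => inj (t x)).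
Proof. by []. Qed.

Lemma Def_subst (E S : Type) (HE : Env E) (HS : Sort S) (P : E * S -> Prop) (t : E -> S) :
  Def P -> DefT t -> Def (fun x => P (x, t x)).
Proof.
move=> HP Ht; apply: (Def_ext (P := fun x => exists s, s = t x /\ P (x, s))).
  by move=> x; split=> [[s [-> //]]|H]; exists (t x).
apply: (Def_ex (P := fun x s => s = t x /\ P (x, s))); apply: Def_and.
  apply: Def_eq; [exact: DefT_snd|exact: DefT_weak].
by apply: Def_ext HP => -[].
Qed.

Section Symbols.
Context {S1 S2 S3 S : Type}
  {H1 : Sort S1} {H2 : Sort S2} {H3 : Sort S3} {HS : Sort S}.

(** Definability of a symbol is recorded in a type class, so that instance search finds it wherever
    the symbol is applied to definable terms. *)
Class Def1 (R : S1 -> Prop) := def1 : Def (fun y : unit * S1 => R (snd y)).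
Class Def2 (R : S1 -> S2 -> Prop) := def2 : Def (fun y : unit * S1 * S2 => R (snd (fst y)) (snd y)).
Class Def3 (R : S1 -> S2 -> S3 -> Prop) := def3 :
  Def (fun y : unit * S1 * S2 * S3 => R (snd (fst (fst y))) (snd (fst y)) (snd y)).
Class DefF1 (F : S1 -> S) := deff1 : DefT (fun y : unit * S1 => F (snd y)).
Class DefF2 (F : S1 -> S2 -> S) := deff2 : DefT (fun y : unit * S1 * S2 => F (snd (fst y)) (snd y)).
End Symbols.

Section Application.
Context {E : Type} {HE : Env E} {S1 S2 S3 S : Type}
  {H1 : Sort S1} {H2 : Sort S2} {H3 : Sort S3} {HS : Sort S}.
Context {t1 : E -> S1} {t2 : E -> S2} {t3 : E -> S3}.

Lemma Def1_app (R : S1 -> Prop) {HR : Def1 R} : DefT t1 -> Def (fun x => R (t1 x)).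
Proof.
move=> T1; have HR' : Def (fun y : E * S1 => R (snd y)).
  apply: (@Def_reindex _ (E * S1) _ _ _ (fun y => (tt, snd y))
    (fun i => match i with None => None | Some j => match j with end end) _ HR).
  by case.
exact: (Def_subst HR' T1).
Qed.

Lemma Def2_app (R : S1 -> S2 -> Prop) {HR : Def2 R} :
  DefT t1 -> DefT t2 -> Def (fun x => R (t1 x) (t2 x)).
Proof.
move=> T1 T2; have HR' : Def (fun y : E * S1 * S2 => R (snd (fst y)) (snd y)).
  apply: (@Def_reindex _ (E * S1 * S2) _ _ _ (fun y => (tt, snd (fst y), snd y))
    (fun i => match i with None => None | Some None => Some None
     | Some (Some j) => match j with end end) _ HR).
  by case=> [[]|].
exact: (Def_subst (Def_subst HR' (DefT_weak _ T2)) T1).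
Qed.

Lemma Def3_app (R : S1 -> S2 -> S3 -> Prop) {HR : Def3 R} :
  DefT t1 -> DefT t2 -> DefT t3 -> Def (fun x => R (t1 x) (t2 x) (t3 x)).
Proof.
move=> T1 T2 T3; have HR' : Def (fun y : E * S1 * S2 * S3 => R (snd (fst (fst y))) (snd (fst y)) (snd y)).
  apply: (@Def_reindex _ (E * S1 * S2 * S3) _ _ _ (fun y => (tt, snd (fst (fst y)), snd (fst y), snd y))
    (fun i => match i with None => None | Some None => Some None | Some (Some None) => Some (Some None)
     | Some (Some (Some j)) => match j with end end) _ HR).
  by case=> [[[]|]|].
exact: (Def_subst (Def_subst (Def_subst HR' (DefT_weak _ (DefT_weak _ T3))) (DefT_weak _ T2)) T1).
Qed.

End Application.

Section FunctionApplication.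
Context {E : Type} {HE : Env E} {S1 S2 S3 S : Type}
  {H1 : Sort S1} {H2 : Sort S2} {H3 : Sort S3} {HS : Sort S}.
Context {t1 : E -> S1} {t2 : E -> S2} {t3 : E -> S3}.

Lemma DefF1_app (F : S1 -> S) {HF : DefF1 F} : DefT t1 -> DefT (fun x => F (t1 x)).
Proof.
move=> T1.
have HR : Def2 (fun s (a : V) => a = inj (F s)) by exact: HF.
exact: (@Def2_app (E * V) _ S1 V _ _ _ _ _ HR (DefT_weak _ T1) (DefT_snd _ _)).
Qed.

Lemma DefF2_app (F : S1 -> S2 -> S) {HF : DefF2 F} :
  DefT t1 -> DefT t2 -> DefT (fun x => F (t1 x) (t2 x)).
Proof.
move=> T1 T2.
have HR : Def3 (fun s1 s2 (a : V) => a = inj (F s1 s2)) by exact: HF.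
exact: (@Def3_app (E * V) _ S1 S2 V _ _ _ _ _ _ _ HR (DefT_weak _ T1) (DefT_weak _ T2) (DefT_snd _ _)).
Qed.

End FunctionApplication.

(* Outside the unique-existence case [iota] has a fixed value, so that it
   stays definable. *)
Definition iota (S : Type) (HS : Sort S) (P : S -> Prop) : S :=
  epsilon (inhabits dflt) (fun y => (P y /\ forall z, P z -> z = y) \/
    (~ (exists y, P y /\ forall z, P z -> z = y) /\ y = dflt)).
Arguments iota {S HS} P.

Lemma iota_total (S : Type) {HS : Sort S} (P : S -> Prop) :
  (P (iota P) /\ forall z, P z -> z = iota P) \/
  (~ (exists y, P y /\ forall z, P z -> z = y) /\ iota P = dflt).
Proof.
apply: (@epsilon_spec S (inhabits dflt) (fun y => (P y /\ forall z, P z -> z = y) \/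
    (~ (exists y, P y /\ forall z, P z -> z = y) /\ y = dflt))).
case: (classic (exists y, P y /\ forall z, P z -> z = y)) => [[y Hy]|H].
- by exists y; left.
- by exists dflt; right.
Qed.

Lemma iota_eq (S : Type) {HS : Sort S} (P : S -> Prop) (y : S) :
  P y -> (forall z, P z -> z = y) -> iota P = y.
Proof.
move=> Hy Hu; case: (iota_total P) => [[H _]|[[]]]; [exact: Hu|by exists y].
Qed.

Lemma iota_spec (S : Type) {HS : Sort S} (P : S -> Prop) :
  (exists y, P y) -> (forall y z, P y -> P z -> z = y) -> P (iota P).
Proof. by move=> [y Hy] Hu; rewrite (iota_eq Hy) // => z; apply: Hu. Qed.

Lemma DefT_eq (E S : Type) (HE : Env E) (HS : Sort S) (t : E -> S) :
  Def (fun y : E * S => snd y = t (fst y)) -> DefT t.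
Proof.
move=> H.
apply: (Def_ext (P := fun y : E * V => exists s, snd y = inj s /\ s = t (fst y))).
  by move=> [x a] /=; split=> [[s [-> ->]]|H'] //; exists (t x).
apply: Def_ex; apply: Def_and.
  by apply: Def_eq; [exact: (DefT_weak _ (DefT_snd _ _))|apply: DefT_inj; exact: DefT_snd].
apply: (@Def_reindex (E * S) (E * V * S) _ _ _ (fun y => (fst (fst y), snd y))
  (fun i => match i with None => None | Some j => Some (Some j) end) _ H).
by case.
Qed.

Lemma DefT_iota (E S : Type) (HE : Env E) (HS : Sort S) (P : E -> S -> Prop) :
  Def (fun y : E * S => P (fst y) (snd y)) -> DefT (fun x => iota (P x)).
Proof.
move=> HP; apply: DefT_eq.
pose U (x : E) (y : S) := P x y /\ forall z, P x z -> z = y.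
have HP2 (F : Type) (HF : Env F) (f : F -> E) (r : @idx E HE -> @idx F HF) :
   (forall i x, coord i (f x) = coord (r i) x) -> Def (fun y : F * S => P (f (fst y)) (snd y)).
  move=> Hr.
  apply: (@Def_reindex (E * S) (F * S) _ _ _ (fun y => (f (fst y), snd y))
    (fun i => match i with None => None | Some j => Some (r j) end) _ HP).
  case=> //= i x; exact: Hr.
have HU : Def (fun y : E * S => U (fst y) (snd y)).
  apply: Def_and => //.
  apply: Def_all; apply: Def_imp.
    exact: (HP2 (E * S)%type (Env_pair HE HS) (fun y => fst y) Some).
  by apply: Def_eq; [exact: DefT_snd|apply: DefT_weak; exact: DefT_snd].
apply: (Def_ext (P := fun y : E * S => U (fst y) (snd y) \/ (~ (exists s, U (fst y) s) /\ snd y = dflt))).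
  move=> [x y] /=; split=> [|->]; last exact: iota_total.
  case=> [[H1 H2]|[H1 ->]]; first by rewrite (iota_eq H1).
  by case: (iota_total (P x)) => [[H2 H3]|[_ ->//]]; case: H1; exists (iota (P x)).
apply: Def_or => //; apply: Def_and.
  apply: Def_not; apply: (@Def_weak E S _ _ (fun x => exists s, U x s)).
  exact: Def_ex.
by apply: Def_eq; [exact: DefT_snd|exact: DefT_const].
Qed.

Ltac dfn_variable n i := match n with Datatypes.S ?m => match goal with
  |- @DefT ?E ?S ?HE ?HS ?t => first
    [ by refine (@DefT_coord E S HE HS t i _) | dfn_variable m uconstr:(Some i) ] end end.

(** A hook, redefined each time a new variable-binding term former such as [setof] or [graph]
    becomes available; [dfn] otherwise decomposes a goal by its outermost symbol. *)
Ltac dfn_more := fail.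
Ltac dfn_step := match goal with
  | |- _ => dfn_more
  | |- DefT (fun _ => ?c) => apply: DefT_const
  | |- DefT _ => dfn_variable 12 uconstr:(None)
  | |- DefT (fun x => inj (@?t x)) => apply: (DefT_inj (t := t))
  | |- DefT (fun x => iota (@?P x)) => apply: (DefT_iota (P := P))
  | |- DefT (fun x => ?F (@?a x) (@?b x)) => let H := constr:(_ : DefF2 F) in apply: (DefF2_app (HF := H) (t1 := a) (t2 := b))
  | |- DefT (fun x => ?F (@?a x)) => let H := constr:(_ : DefF1 F) in apply: (DefF1_app (HF := H) (t1 := a))
  | |- Def (fun _ => False) => apply: Def_bot
  | |- Def (fun _ => True) => apply: Def_true
  | |- Def (fun x => ~ @?P x) => apply: (Def_not (P := P))
  | |- Def (fun x => @?P x /\ @?Q x) => apply: (Def_and (P := P) (Q := Q))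
  | |- Def (fun x => @?P x \/ @?Q x) => apply: (Def_or (P := P) (Q := Q))
  | |- Def (fun x => @?P x <-> @?Q x) => apply: (Def_iff (P := P) (Q := Q))
  | |- Def (fun x => @?P x -> @?Q x) => apply: (Def_imp (P := P) (Q := Q))
  | |- Def (fun x => forall s, @?P x s) => apply: (Def_all (P := P))
  | |- Def (fun x => exists s, @?P x s) => apply: (Def_ex (P := P))
  | |- Def (fun x => @?a x = @?b x) => apply: (Def_eq (t := a) (s := b))
  | |- Def (fun x => ?R (@?a x) (@?b x) (@?c x)) => let H := constr:(_ : Def3 R) in apply: (Def3_app (HR := H) (t1 := a) (t2 := b) (t3 := c))
  | |- Def (fun x => ?R (@?a x) (@?b x)) => let H := constr:(_ : Def2 R) in apply: (Def2_app (HR := H) (t1 := a) (t2 := b))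
  | |- Def (fun x => ?R (@?a x)) => let H := constr:(_ : Def1 R) in apply: (Def1_app (HR := H) (t1 := a))
  end; cbv beta.
Ltac dfn := rewrite /Def1 /Def2 /Def3 /DefF1 /DefF2; repeat dfn_step.

Instance Def2_memV : Def2 (@mem V).
Proof. by exists (f_mem (inl (Some None)) (inl None)), (fun _ => v0) => -[[x a] b]. Qed.
Instance Def1_atomV : Def1 (@atom V).
Proof. by exists (f_atom (inl None)), (fun _ => v0) => -[x a]. Qed.

(** * Sets in ZFC and ZFA universes *)

Lemma V_set (x : V) : is_set x.
Proof. exact: (zfc_no_atoms VZ). Qed.

Lemma Def1_formula (P : V -> Prop) : Def1 P ->
  exists (f : formula (option nat)) (c : nat -> V), forall a, P a <-> sat (env_cons a c) f.
Proof.
move=> [f [c Hf]].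
pose r (i : @idx (unit * V) _ + nat) : option nat :=
  match i with inl None => None | inl (Some j) => match j with end | inr n => Some n end.
exists (rename r f), c => w; rewrite sat_rename.
have := Hf (tt, w) => /= ->.
have -> // : (fun i => env_cons w c (r i)) = @valuation (unit * V) _ (tt, w) c.
by apply: functional_extensionality => -[[[]|]|].
Qed.

Lemma V_sep (P : V -> Prop) (a : V) :
  Def1 P -> exists y, forall w, w ∈ y <-> w ∈ a /\ P w.
Proof.
move=> /Def1_formula [f [c Hf]]; have [y Hy] := zfc_separation VZ f c a.
by exists y => w; rewrite Hy Hf.
Qed.

Lemma V_repl (R : V -> V -> Prop) (a : V) :
  Def2 R -> (forall z w w', z ∈ a -> R z w -> R z w' -> w = w') ->
  exists y, forall w, w ∈ y <-> exists z, z ∈ a /\ R z w.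
Proof.
move=> [f [c Hf]] HR.
pose r (i : @idx (unit * V * V) _ + nat) : option (option nat) :=
  match i with inl None => None | inl (Some None) => Some None
  | inl (Some (Some j)) => match j with end | inr n => Some (Some n) end.
have H z w : R z w <-> sat (env_cons w (env_cons z c)) (rename r f).
  rewrite sat_rename; have := Hf (tt, z, w) => /= ->.
  have -> // : (fun i => env_cons w (env_cons z c) (r i)) = @valuation (unit * V * V) _ (tt, z, w) c.
  by apply: functional_extensionality => -[[[[]|]|]|].
have [|y Hy] := zfc_replacement VZ (phi := rename r f) (e := c) (x := a).
  by move=> z w w' Hz /H H1 /H; exact: HR Hz H1.
by exists y => w; rewrite Hy; split=> -[z [Hz Hr]]; exists z; split=> //; apply/H.
Qed.

(** Separation needs an ambient set. The bound is a set of codes, so that the notion makes sense for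
    every coded type; a predicate that is both definable and bounded is the extension of a set. *)
Definition Bdd (S : Type) {HS : Sort S} (P : S -> Prop) : Prop :=
  exists a : V, forall s, P s -> inj s ∈ a.

Section Bounded.
Context {S T : Type} {HS : Sort S} {HT : Sort T}.

Lemma Bdd_sub (P Q : S -> Prop) : Bdd Q -> (forall s, P s -> Q s) -> Bdd P.
Proof. by move=> [a Ha] H; exists a => s /H /Ha. Qed.

Lemma Bdd_or (P Q : S -> Prop) : Bdd P -> Bdd Q -> Bdd (fun s => P s \/ Q s).
Proof.
move=> [a Ha] [b Hb].
have [p [_ Hp]] := zfc_pairing VZ a b; have [u Hu] := zfc_union VZ p.
by exists u => s [/Ha|/Hb] H; apply/Hu; [exists a|exists b]; rewrite Hp; auto.
Qed.

Lemma Bdd_uniq (P : S -> Prop) : (forall s t, P s -> P t -> s = t) -> Bdd P.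
Proof.
move=> H; case: (classic (exists s, P s)) => [[s Hs]|H']; last first.
  by exists v0 => s Hs; case: H'; exists s.
have [p [_ Hp]] := zfc_pairing VZ (inj s) (inj s).
by exists p => t Ht; rewrite (H _ _ Ht Hs) Hp; left.
Qed.

Lemma Bdd_one (c : S) : Bdd (fun s => s = c).
Proof. by apply: Bdd_uniq => s t -> ->. Qed.

(** Replacement requires a functional relation, but bounds for [Q s] are not unique. Hence [R] sends
    [s] to the exact set of codes of the solutions of [Q s], and the union of these sets is the
    bound. *)
Lemma Bdd_bigU (P : S -> Prop) (Q : S -> T -> Prop) :
  Bdd P -> Def1 P -> Def2 Q -> (forall s, P s -> Bdd (Q s)) ->
  Bdd (fun t => exists s, P s /\ Q s t).
Proof.
move=> [a Ha] DP DQ HQ.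
pose (R := fun z w : V => exists s, inj s = z /\ P s /\ forall b : V, b ∈ w <-> exists t, inj t = b /\ Q s t).
have DR : Def2 R by rewrite /R; dfn.
have [|y Hy] := V_repl (a := a) DR.
  move=> z w w' _ [s [<- [Hs H1]]] [s' [Es [Hs' H2]]].
  rewrite (inj_inj Es) in H2.
  by apply: (zfc_extensionality VZ) => b; rewrite H1 H2.
have [u Hu] := zfc_union VZ y.
exists u => t [s [Hs Ht]].
have [b Hb] := HQ s Hs.
have [w Hw] : exists w, forall c : V, c ∈ w <-> c ∈ b /\ exists t, inj t = c /\ Q s t.
  by apply: V_sep; dfn.
apply/Hu; exists w; split.
  apply/Hy; exists (inj s); split; first exact: Ha.
  exists s; split=> //; split=> // c; rewrite Hw; split=> [[]//|[t' [<- Ht']]].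
  by split; [exact: Hb|exists t'].
by apply/Hw; split; [exact: Hb|exists t].
Qed.

End Bounded.

Lemma Bdd_ex (S T : Type) {HS : Sort S} {HT : Sort T} (P : S -> Prop) (Q : S -> T -> Prop) :
  Bdd P -> Def1 P -> Def2 Q -> (forall s, P s -> forall t t', Q s t -> Q s t' -> t = t') ->
  Bdd (fun t => exists s, P s /\ Q s t).
Proof. move=> HP DP DQ H; apply: (Bdd_bigU HP DP DQ) => s Hs; apply: Bdd_uniq; exact: H. Qed.

Lemma Bdd_powV (a : V) : Bdd (fun y => subset y a).
Proof. by have [p Hp] := zfc_powerset VZ a; exists p => s /Hp. Qed.

Lemma Bdd_image2 (S T U : Type) {HS : Sort S} {HT : Sort T} {HU : Sort U}
  (P : S -> Prop) (Q : T -> Prop) (F : S -> T -> U) :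
  Bdd P -> Def1 P -> Bdd Q -> Def1 Q -> DefF2 F ->
  Bdd (fun u => exists s t, P s /\ Q t /\ u = F s t).
Proof.
move=> BP DP BQ DQ DF.
apply: (Bdd_sub (Q := fun u => exists s, P s /\ exists t, Q t /\ u = F s t)).
  apply: (Bdd_bigU BP DP); first by dfn.
  move=> s Hs; apply: (Bdd_ex BQ DQ); first by dfn.
  by move=> t _ u u' -> ->.
by move=> u [s [t [H1 [H2 ->]]]]; exists s; split=> //; exists t.
Qed.

Lemma Bdd_image1 (S T : Type) {HS : Sort S} {HT : Sort T}
  (P : S -> Prop) (F : S -> T) :
  Bdd P -> Def1 P -> DefF1 F -> Bdd (fun u => exists s, P s /\ u = F s).
Proof.
move=> BP DP DF; apply: (Bdd_ex BP DP); first by dfn.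
by move=> s _ u u' -> ->.
Qed.

(* A model of ZFA coded in [V].  Its schemas hold for all predicates definable in
   [V], and not just for those definable in [M]. *)
Class PreUniverse (M : structure) := {
  u_sort :: Sort M;
  u_mem :: Def2 (@mem M);
  u_atom :: Def1 (@atom M);
  u_ext : forall x y : M, is_set x -> is_set y -> (forall z, z ∈ x <-> z ∈ y) -> x = y;
  u_atom_empty : forall x z : M, atom x -> ~ z ∈ x;
  u_bdd : forall x : M, Bdd (fun z => z ∈ x);
  u_mk : forall P : M -> Prop, Def1 P -> Bdd P ->
    exists y, is_set y /\ forall w, w ∈ y <-> P w }.

(** ∈-induction is kept apart from the other axioms because deriving it for [V] already uses pairs,
    successors and natural numbers, which are built from a [PreUniverse] alone. *)
Class Universe (M : structure) := {
  u_pre :: PreUniverse M;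
  u_ind : forall P : M -> Prop, Def1 P ->
    (forall x, (forall y, y ∈ x -> P y) -> P x) -> forall x, P x }.

Instance PreUniverse_V : PreUniverse V.
Proof.
refine {| u_sort := Sort_V |} => //.
- by move=> x y _ _; exact: (zfc_extensionality VZ).
- by move=> x z /(zfc_no_atoms VZ).
- by move=> x; exists x.
- move=> P DP [a Ha]; have [y Hy] := V_sep a DP; exists y; split; first exact: V_set.
  by move=> w; rewrite Hy; split=> [[]|Hw] //; split=> //; exact: Ha.
Defined.

(* [apply:] can leave open the universe instance on which a definability goal
   depends. *)
Ltac resolve_instances := repeat match goal with
  | |- context [@u_sort ?M ?i] => is_evar i; let h := constr:(_ : PreUniverse M) in unify i h
  | |- context [@u_pre ?M ?i] => is_evar i; let h := constr:(_ : Universe M) in unify i h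
  end.
Ltac dfn ::= resolve_instances;
  rewrite /Def1 /Def2 /Def3 /DefF1 /DefF2; repeat dfn_step.

Section PreUniverse.
Context {M : structure} {UM : PreUniverse M}.
Implicit Types x y z p : M.

(** As [iota] is total, this is a total operation: it may occur in definable terms before its
    argument is known to be bounded. *)
Definition setof (P : M -> Prop) : M :=
  iota (fun y => is_set y /\ forall w, w ∈ y <-> P w).

Lemma setof_spec (P : M -> Prop) : Def1 P -> Bdd P ->
  is_set (setof P) /\ forall w, w ∈ setof P <-> P w.
Proof.
move=> DP BP; apply: (iota_spec (P := fun y => is_set y /\ forall w, w ∈ y <-> P w)).
  exact: u_mk.
by move=> y z [Sy Hy] [Sz Hz]; apply: u_ext => // w; rewrite Hy Hz.
Qed.

Lemma in_setof (P : M -> Prop) : Def1 P -> Bdd P -> forall w, w ∈ setof P <-> P w.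
Proof. by move=> DP BP; apply: (proj2 (setof_spec DP BP)). Qed.

Lemma setof_set (P : M -> Prop) : Def1 P -> Bdd P -> is_set (setof P).
Proof. by move=> DP BP; apply: (proj1 (setof_spec DP BP)). Qed.

Lemma setof_eq (P : M -> Prop) y : is_set y -> (forall w, w ∈ y <-> P w) -> setof P = y.
Proof.
move=> Sy Hy; apply: iota_eq => //= z [Sz Hz].
by apply: u_ext => // w; rewrite Hy Hz.
Qed.

#[global] Instance Def1_is_set : Def1 (@is_set M).
Proof. rewrite /is_set; dfn. Qed.

Lemma DefT_setof (E : Type) {HE : Env E} (P : E -> M -> Prop) :
  Def (fun y : E * M => P (fst y) (snd y)) -> DefT (fun e : E => setof (P e)).
Proof.
move=> HP; rewrite /setof; apply: DefT_iota; dfn.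
refine (@Def_reindex _ _ _ _ _ (fun y : E * M * M => (fst (fst y), snd y))
  (fun i => match i with None => None | Some j => Some (Some j) end) _ HP).
by case.
Qed.
End PreUniverse.

Ltac dfn_more ::= match goal with
  | |- DefT (fun x => setof (@?P x)) => apply: (DefT_setof (P := P)) end.

Section Pairs.
Context {M : structure} {UM : PreUniverse M}.
Implicit Types x y z p : M.

Definition upr x y : M := setof (fun z => z = x \/ z = y).
Definition pr x y : M := upr (upr x x) (upr x y).
Definition emp : M := setof (fun _ => False).
Definition suc x : M := setof (fun z => z ∈ x \/ z = x).

#[global] Instance DefF2_upr : DefF2 upr.
Proof. rewrite /upr; dfn. Qed.
#[global] Instance DefF2_pr : DefF2 pr.
Proof. rewrite /pr; dfn. Qed.
#[global] Instance DefF1_suc : DefF1 suc.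
Proof. rewrite /suc; dfn. Qed.

Lemma upr_spec x y : is_set (upr x y) /\ forall z, z ∈ upr x y <-> z = x \/ z = y.
Proof. by apply: setof_spec; [dfn|apply: Bdd_or; exact: Bdd_one]. Qed.

Lemma in_upr x y z : z ∈ upr x y <-> z = x \/ z = y.
Proof. exact: (proj2 (upr_spec x y)). Qed.

Lemma is_upairE p x y : is_upair p x y <-> p = upr x y.
Proof.
split=> [[Sp Hp]|->]; last exact: upr_spec.
by symmetry; apply: setof_eq.
Qed.

Lemma is_pairE p x y : is_pair p x y <-> p = pr x y.
Proof.
split=> [[s [d [/is_upairE -> [/is_upairE -> /is_upairE ->]]]] //|->].
by exists (upr x x), (upr x y); split; [|split]; apply/is_upairE.
Qed.

Lemma upr_inj x y z : upr x y = upr x z -> y = z.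
Proof.
move=> H; have : y ∈ upr x z by rewrite -H in_upr; auto.
have : z ∈ upr x y by rewrite H in_upr; auto.
by rewrite !in_upr => -[->|->] // [->|->].
Qed.

Lemma pr_inj x y x' y' : pr x y = pr x' y' -> x = x' /\ y = y'.
Proof.
move=> H; have Ex : x = x'.
  have : upr x' x' ∈ pr x y by rewrite H in_upr; auto.
  rewrite in_upr => -[] H1; have : x ∈ upr x' x' by [rewrite H1 in_upr; auto].
    by rewrite in_upr => -[].
  by rewrite in_upr => -[].
split=> //; subst x'; exact: (upr_inj (upr_inj H)).
Qed.

Lemma emp_spec : is_set emp /\ forall z, z ∈ emp <-> False.
Proof. by apply: setof_spec; [dfn|apply: Bdd_uniq]. Qed.

Lemma in_emp z : ~ z ∈ emp.
Proof. by rewrite (proj2 emp_spec). Qed.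

Lemma is_emptyE x : is_empty x <-> x = emp.
Proof.
split=> [[Sx Hx]|->]; last by split=> [|z]; [exact: (proj1 emp_spec)|exact: in_emp].
by symmetry; apply: setof_eq => // w; split=> // /Hx.
Qed.

Lemma suc_spec x : is_set (suc x) /\ forall z, z ∈ suc x <-> z ∈ x \/ z = x.
Proof. by apply: setof_spec; [dfn|apply: Bdd_or; [exact: u_bdd|exact: Bdd_one]]. Qed.

Lemma in_suc x z : z ∈ suc x <-> z ∈ x \/ z = x.
Proof. exact: (proj2 (suc_spec x)). Qed.

Lemma is_succE x y : is_succ x y <-> y = suc x.
Proof.
split=> [[Sy Hy]|->]; last exact: suc_spec.
by symmetry; apply: setof_eq.
Qed.

Lemma is_zeroE x : is_zero x <-> x = emp.
Proof. exact: is_emptyE. Qed.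

Lemma is_oneE x : is_one x <-> x = suc emp.
Proof.
split=> [[o [/is_zeroE -> /is_succE]] //|->].
by exists emp; split; [exact/is_zeroE|exact/is_succE].
Qed.

Lemma suc_neq_emp x : suc x <> emp.
Proof. move=> H; apply: (@in_emp x); rewrite -H in_suc; auto. Qed.

Lemma appE f x y : app f x y <-> pr x y ∈ f.
Proof. by split=> [[p [/is_pairE -> //]]|H]; exists (pr x y); split=> //; apply/is_pairE. Qed.

(** A subset of [P] in [M] is determined by the set of codes of its elements, which is a subset of
    the bound [a]. So the power set of [a] in [V], followed by replacement, bounds all such
    subsets. *)
Lemma Bdd_pow (P : M -> Prop) : Def1 P -> Bdd P ->
  Bdd (fun y => is_set y /\ forall z, z ∈ y -> P z).
Proof.
move=> DP [a Ha].
apply: (Bdd_sub (Q := fun y => exists b : V, subset b a /\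
   (is_set y /\ forall w, w ∈ y <-> inj w ∈ b))).
  apply: (Bdd_ex (Bdd_powV a)); [by rewrite /subset; dfn|by dfn|].
  by move=> b _ y y' [S1 H1] [S2 H2]; apply: u_ext => // w; rewrite H1 H2.
move=> y [Sy Hy].
have [b Hb] : exists b : V, forall c, c ∈ b <-> c ∈ a /\ exists w, inj w = c /\ w ∈ y.
  by apply: V_sep; dfn.
exists b; split; first by split; [exact: V_set|split; [exact: V_set|move=> c /Hb []]].
split=> // w; rewrite Hb; split=> [Hw|[_ [w' [Ew Hw]]]]; last by rewrite -(inj_inj Ew).
by split; [exact/Ha/Hy|exists w].
Qed.

Lemma Bdd_pr (P Q : M -> Prop) : Def1 P -> Def1 Q -> Bdd P -> Bdd Q ->
  Bdd (fun p => exists x y, P x /\ Q y /\ p = pr x y).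
Proof. by move=> *; apply: Bdd_image2. Qed.

#[global] Instance Def3_is_pair : Def3 (@is_pair M).
Proof. by rewrite /is_pair /is_upair; dfn. Qed.
#[global] Instance Def3_pair_app : Def3 (@app M).
Proof. by rewrite /app; dfn. Qed.
#[global] Instance Def1_is_function : Def1 (@is_function M).
Proof. by rewrite /is_function /is_relation; dfn. Qed.
#[global] Instance Def2_is_succ : Def2 (@is_succ M).
Proof. by rewrite /is_succ; dfn. Qed.
#[global] Instance Def1_is_empty : Def1 (@is_empty M).
Proof. by rewrite /is_empty; dfn. Qed.
#[global] Instance Def2_subset : Def2 (@subset M).
Proof. by rewrite /subset; dfn. Qed.
#[global] Instance Def1_transitive : Def1 (@transitive M).
Proof. by rewrite /transitive; dfn. Qed.
#[global] Instance Def2_in_TC : Def2 (@in_TC_singleton M).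
Proof. by rewrite /in_TC_singleton; dfn. Qed.
#[global] Instance Def1_inductive_set : Def1 (@inductive_set M).
Proof. by rewrite /inductive_set; dfn. Qed.
#[global] Instance Def1_is_nat : Def1 (@is_nat M).
Proof. by rewrite /is_nat; dfn. Qed.
End Pairs.

Ltac unpr := repeat match goal with
  | H : pr _ _ = pr _ _ |- _ => move: (pr_inj H) => {H} [? ?] end; subst.

Lemma is_nat_emp (M : structure) {UM : PreUniverse M} : is_nat (emp : M).
Proof. by move=> x [_ [[o [/is_emptyE -> //]] _]]. Qed.

Lemma is_nat_suc (M : structure) {UM : PreUniverse M} (n : M) : is_nat n -> is_nat (suc n).
Proof.
move=> Hn x Hx; have Hnx := Hn x Hx.
by case: Hx => _ [_ /(_ n Hnx) [y [/is_succE -> //]]].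
Qed.

(** A natural number lies in every inductive set, and separation from the set given by the axiom of
    infinity makes [P] into one. Induction is thus confined to definable [P], as [V] may have
    nonstandard numbers. *)
Lemma nat_ind (P : V -> Prop) : Def1 P -> P emp ->
  (forall n, is_nat n -> P n -> P (suc n)) -> forall n, is_nat n -> P n.
Proof.
move=> DP P0 PS n Hn; have [w Hw] := zfc_infinity VZ.
have [y Hy] : exists y : V, forall m, m ∈ y <-> m ∈ w /\ (is_nat m /\ P m).
  by apply: V_sep; dfn.
suff : n ∈ y by rewrite Hy; tauto.
apply: Hn; split; first exact: V_set.
case: (Hw) => _ [[o [Ho How]] HSw]; split.
  exists o; split=> //; rewrite Hy; split=> //.
  by move/is_emptyE: Ho => ->; split=> //; exact: is_nat_emp.
move=> m /Hy [Hm [Nm Pm]]; have [m' [/is_succE -> Hm']] := HSw m Hm.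
exists (suc m); split; first exact/is_succE.
by rewrite Hy; split=> //; split; [exact: is_nat_suc|exact: PS].
Qed.

Lemma Bdd_nat : Bdd (fun n : V => is_nat n).
Proof. by have [w Hw] := zfc_infinity VZ; exists w => n; apply. Qed.

Lemma V_asym (x y : V) : x ∈ y -> ~ y ∈ x.
Proof.
move=> Hxy Hyx; have [|z [/in_upr Hz H]] := zfc_foundation VZ (x := upr x y).
  by exists x; apply/in_upr; left.
by case: Hz => Ez; subst z; [apply: (H y) => //|apply: (H x) => //]; apply/in_upr; auto.
Qed.

Lemma V_suc_inj (x y : V) : suc x = suc y -> x = y.
Proof.
move=> H; have : x ∈ suc y by rewrite -H in_suc; auto.
have : y ∈ suc x by rewrite H in_suc; auto.
by rewrite !in_suc => -[H1|-> //] [H2|-> //]; case: (V_asym H1).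
Qed.

(* The [n]-th elements of descending ∈-chains from [x]: transitive closures are
   needed to get ∈-induction from foundation, so they cannot use it. *)
Definition reach (x n y : V) : Prop := exists F : V,
  (forall i u, pr i u ∈ F -> (i = emp /\ u = x) \/
     exists j v, i = suc j /\ pr j v ∈ F /\ u ∈ v) /\ pr n y ∈ F.

Instance Def3_reach : Def3 reach.
Proof. by rewrite /reach; dfn. Qed.

Lemma reach_suc x n y z : reach x n y -> z ∈ y -> reach x (suc n) z.
Proof.
move=> [F [HF Hy]] Hz.
have HE p : p ∈ setof (fun p => p ∈ F \/ p = pr (suc n) z) <-> p ∈ F \/ p = pr (suc n) z.
  by apply: in_setof; [dfn|apply: Bdd_or; [exact: u_bdd|exact: Bdd_one]].
exists (setof (fun p => p ∈ F \/ p = pr (suc n) z)); split; last by rewrite HE; right.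
move=> i u /HE [/HF [H|[j [v [-> [H1 H2]]]]]|E]; first by left.
  by right; exists j, v; rewrite HE; auto.
by unpr; right; exists n, y; rewrite HE; auto.
Qed.

(** The elements reached from [x] in [n] steps are bounded, by induction on [n]: one more step
    passes to elements of elements already bounded. Uniting over the natural numbers of [V] gives
    the transitive set. *)
Lemma transitive_superset (x : V) : exists t, transitive t /\ x ∈ t.
Proof.
have HB n : is_nat n -> Bdd (fun y => reach x n y).
  move: n; apply: nat_ind; first by rewrite /Bdd; dfn.
    apply: (Bdd_sub (Q := fun y => y = x)); first exact: Bdd_one.
    by move=> y [F [HF /HF [[]//|[j [v [/esym /suc_neq_emp]]]]]].
  move=> n Hn IH.
  apply: (Bdd_sub (Q := fun z => exists y, reach x n y /\ z ∈ y)).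
    by apply: (Bdd_bigU IH); [dfn|dfn|move=> y _; exact: u_bdd].
  move=> y [F [HF /HF [[/suc_neq_emp //]|[j [v [/V_suc_inj <- [H1 H2]]]]]]].
  by exists v; split=> //; exists F.
have HE y : y ∈ setof (fun y => exists n, is_nat n /\ reach x n y) <->
    exists n, is_nat n /\ reach x n y.
  by apply: in_setof; [dfn|apply: (Bdd_bigU Bdd_nat); by [dfn|]].
exists (setof (fun y => exists n, is_nat n /\ reach x n y)); split.
  split; first exact: V_set.
  move=> y z Hz /HE [n [Hn Hr]]; rewrite HE; exists (suc n).
  by split; [exact: is_nat_suc|exact: reach_suc Hr Hz].
rewrite HE; exists emp; split; first exact: is_nat_emp.
exists (upr (pr emp x) (pr emp x)); split; last by apply/in_upr; left.
by move=> i u /in_upr [] E; unpr; left.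
Qed.

Instance Universe_V : Universe V.
Proof.
refine {| u_pre := PreUniverse_V |} => P DP HP x; apply: NNPP => Hx.
have [t [[_ Ht] Hxt]] := transitive_superset x.
have [y Hy] : exists y : V, forall z, z ∈ y <-> z ∈ t /\ ~ P z by apply: V_sep; dfn.
have [|z [/Hy [Hz HPz] Hm]] := zfc_foundation VZ (x := y); first by exists x; apply/Hy.
apply: HPz; apply: HP => w Hw; apply: NNPP => HPw.
by apply: (Hm w Hw); apply/Hy; split=> //; exact: Ht Hw Hz.
Defined.

Lemma V_ind (P : V -> Prop) : Def1 P ->
  (forall x, (forall y, y ∈ x -> P y) -> P x) -> forall x, P x.
Proof. exact: u_ind. Qed.

Lemma V_mk (P : V -> Prop) : Def1 P -> Bdd P -> exists y, forall w, w ∈ y <-> P w.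
Proof. by move=> DP [a Ha]; have [y [_ Hy]] := @u_mk V PreUniverse_V P DP (ex_intro _ a Ha); exists y. Qed.

Lemma V_bdd (x : V) : Bdd (fun z => z ∈ x).
Proof. by exists x. Qed.

Section Closure.
Context {M : structure} {UM : Universe M}.
Implicit Types x y z t : M.

Lemma in_TC_refl x : in_TC_singleton x x.
Proof. by []. Qed.

Lemma in_TC_mem x y z : in_TC_singleton x y -> z ∈ y -> in_TC_singleton x z.
Proof. by move=> Hy Hz t Tt Hx; case: (Tt) => _; apply; [exact: Hz|exact: Hy]. Qed.

Lemma in_TC_step x y z : z ∈ x -> in_TC_singleton z y -> in_TC_singleton x y.
Proof. by move=> Hz Hy t Tt Hx; apply: (Hy t Tt); case: Tt => _; apply; eauto. Qed.

(** Both claims go through one ∈-induction. Boundedness for the elements of [x] makes [Q] a set;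
    this set is transitive and contains [x], hence is the closure itself, which is the unfolding at
    [x]. *)
Lemma TC_exists x : Bdd (in_TC_singleton x) /\
  forall y, in_TC_singleton x y <-> y = x \/ exists z, z ∈ x /\ in_TC_singleton z y.
Proof.
move: x; apply: u_ind; first by rewrite /Bdd; dfn.
move=> x IH.
pose (Q := fun y => y = x \/ exists z, z ∈ x /\ in_TC_singleton z y).
have DQ : Def1 Q by rewrite /Q; dfn.
have BQ : Bdd Q.
  apply: Bdd_or; first exact: Bdd_one.
  by apply: (Bdd_bigU (u_bdd x)); [dfn|dfn|move=> z /IH []].
have HE := in_setof DQ BQ.
have Tt : transitive (setof Q).
  split; first exact: setof_set.
  move=> y z Hz /HE [E|[w [Hw Hy]]]; rewrite HE; right.
    by subst y; exists z; split=> //; exact: in_TC_refl.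
  by exists w; split=> //; exact: in_TC_mem Hy Hz.
have H y : in_TC_singleton x y <-> Q y.
  split=> [Hy|[->|[z [Hz Hy]]]].
  - by rewrite -HE; apply: Hy => //; rewrite HE; left.
  - exact: in_TC_refl.
  - exact: in_TC_step Hz Hy.
by split=> //; apply: (Bdd_sub BQ) => y /H.
Qed.

Lemma Bdd_TC x : Bdd (in_TC_singleton x).
Proof. exact: (proj1 (TC_exists x)). Qed.

Lemma in_TC_unfold x y :
  in_TC_singleton x y <-> y = x \/ exists z, z ∈ x /\ in_TC_singleton z y.
Proof. exact: (proj2 (TC_exists x)). Qed.

Lemma mem_asym x y : x ∈ y -> ~ y ∈ x.
Proof.
move: x y; suff H : forall x y, x ∈ y -> ~ y ∈ x by [].
apply: u_ind; first by dfn.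
by move=> x IH y Hxy Hyx; apply: (IH y Hyx x Hyx).
Qed.

Lemma mem_irrefl x : ~ x ∈ x.
Proof. by move=> H; apply: (mem_asym H). Qed.

Lemma suc_inj x y : suc x = suc y -> x = y.
Proof.
move=> H; have : x ∈ suc y by rewrite -H in_suc; auto.
have : y ∈ suc x by rewrite H in_suc; auto.
by rewrite !in_suc => -[H1|-> //] [H2|-> //]; case: (mem_asym H1).
Qed.

Lemma relation_mem f p : is_relation f -> p ∈ f -> exists x y, p = pr x y.
Proof. by move=> [_ Hf] /Hf [x [y /is_pairE ->]]; exists x, y. Qed.

Definition graph (R : M -> M -> Prop) : M :=
  setof (fun p => exists x y, R x y /\ p = pr x y).

Lemma graph_spec (R : M -> M -> Prop) (P Q : M -> Prop) : Def2 R -> Def1 P -> Def1 Q ->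
  Bdd P -> Bdd Q -> (forall x y, R x y -> P x /\ Q y) ->
  is_relation (graph R) /\ forall x y, app (graph R) x y <-> R x y.
Proof.
move=> DR DP DQ BP BQ HR.
have [S HE] : is_set (graph R) /\ forall p, p ∈ graph R <-> exists x y, R x y /\ p = pr x y.
  apply: setof_spec; first by dfn.
  apply: (Bdd_sub (Bdd_pr DP DQ BP BQ)) => p [x [y [/HR [Hx Hy] ->]]].
  by exists x, y.
split=> [|x y]; last first.
  rewrite appE HE; split=> [[x' [y' [H E]]]|H]; last by exists x, y.
  by unpr.
split=> // p /HE [x [y [_ ->]]]; exists x, y; exact/is_pairE.
Qed.

Lemma DefT_graph (E : Type) {HE : Env E} (R : E -> M -> M -> Prop) :
  Def (fun y : E * M * M => R (fst (fst y)) (snd (fst y)) (snd y)) ->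
  DefT (fun e : E => graph (R e)).
Proof.
move=> HR; rewrite /graph; dfn.
refine (@Def_reindex _ _ _ _ _ (fun y : E * M * M * M => (fst (fst (fst y)), snd (fst y), snd y))
  (fun i => match i with None => None | Some None => Some None
   | Some (Some j) => Some (Some (Some j)) end) _ HR).
by case=> [[]|].
Qed.
End Closure.

Ltac dfn_more ::= match goal with
  | |- DefT (fun x => setof (@?P x)) => apply: (DefT_setof (P := P))
  | |- DefT (fun x => graph (@?P x)) => apply: (DefT_graph (R := P)) end.

(** * Recursion along membership *)

Section Recursion.
Context {M : structure} {UM : Universe M}.
Implicit Types u v x y z f g : M.
Context (step : M -> M -> M -> Prop) {Dstep : Def3 step}.
Hypothesis step_total : forall u f, is_function f ->
  (forall z, z ∈ u -> exists w, app f z w) -> exists v, step u f v.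
(** [by_recursion] passes a whole function to the clause, not its restriction to [u]; this
    hypothesis says that only the values at elements of [u] influence the result. *)
Hypothesis step_unique : forall u f g v v', is_function f -> is_function g ->
  (forall z, z ∈ u -> exists w, app f z w /\ app g z w) ->
  step u f v -> step u g v' -> v = v'.

Instance Def2_by_recursion : Def2 (by_recursion step).
Proof. by rewrite /by_recursion; dfn. Qed.

Lemma recursion_unique x y y' :
  by_recursion step x y -> by_recursion step x y' -> y = y'.
Proof.
move: x y y'.
apply: u_ind.
  by dfn.
move=> x IH y y' [f [Ff [Hf Hy]]] [g [Fg [Hg Hy']]].
have [Cf Sf] := Hf _ _ Hy; have [Cg Sg] := Hg _ _ Hy'.
apply: step_unique Sf Sg => // z Hz.
have [w Hw] := Cf _ Hz; have [w' Hw'] := Cg _ Hz.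
have E : w = w' by apply: (IH z Hz); [exists f|exists g].
by exists w; split=> //; rewrite E.
Qed.

Lemma recursion_inv x y : by_recursion step x y ->
  exists f, is_function f /\ (forall z, z ∈ x -> exists w, app f z w) /\
    (forall z w, app f z w -> by_recursion step z w) /\ step x f y.
Proof.
move=> [f [Ff [Hf Hy]]]; have [Cf Sf] := Hf _ _ Hy.
exists f; split=> //; split=> //; split=> // z w Hw; by exists f.
Qed.

Lemma recursion_total x : exists y, by_recursion step x y.
Proof.
suff H : forall x y, in_TC_singleton x y -> exists v, by_recursion step y v.
  by apply: (H x); exact: in_TC_refl.
apply: u_ind.
  by dfn.
move=> {}x IH y /in_TC_unfold [->|[z [/IH]]]; last by apply.
(* Arguing by contradiction keeps [x] out of [D]: everything in [D] has a value by the induction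
   hypothesis, while [x] has none. A pair for [x] can therefore be added to the graph on [D] without
   a clash. *)
apply: NNPP => Hno.
pose (D := fun u => exists z, z ∈ x /\ in_TC_singleton z u).
have DD : Def1 D by rewrite /D; dfn.
have BD : Bdd D.
  by apply: (Bdd_bigU (u_bdd x)); [dfn|dfn|move=> z _; exact: Bdd_TC].
pose (I := fun v => exists u, D u /\ by_recursion step u v).
have DI : Def1 I by rewrite /I; dfn.
have BI : Bdd I.
  by apply: (Bdd_ex BD DD); move=> u _ v v'; exact: recursion_unique.
have Dx : ~ D x by move=> [z [Hz /(IH z Hz)]].
have D0 : Def2 (fun u v => D u /\ by_recursion step u v) by dfn.
have [|Rf Hf] := graph_spec D0 DD DI BD BI.
  by move=> u v [H1 H2]; split=> //; exists u.
set f := graph _ in Rf Hf.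
have Ff : is_function f.
  by split=> // u v v' /Hf [_ H1] /Hf [_ H2]; exact: recursion_unique H1 H2.
have Df z : z ∈ x -> D z by move=> Hz; exists z; split=> //; exact: in_TC_refl.
have [|v Hv] := step_total (u := x) Ff.
  move=> z Hz; have [w Hw] := IH z Hz z (in_TC_refl (x := z)).
  by exists w; apply/Hf; split=> //; exact: Df.
have D1 : Def2 (fun u w => (D u /\ by_recursion step u w) \/ (u = x /\ w = v)) by dfn.
have D2 : Def1 (fun u => D u \/ u = x) by dfn.
have D3 : Def1 (fun w => I w \/ w = v) by dfn.
have [|Rg Hg] := graph_spec D1 D2 D3 (Bdd_or BD (Bdd_one x)) (Bdd_or BI (Bdd_one v)).
  by move=> u w [[H1 H2]|[-> ->]]; auto; split; left=> //; exists u.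
set g := graph _ in Rg Hg.
have Fg : is_function g.
  split=> // u w w' /Hg [[H1 H2]|[E1 ->]] /Hg [[H3 H4]|[E2 ->]] //.
  - exact: recursion_unique H2 H4.
  - by subst u.
  - by subst u.
apply: Hno; exists v, g; split=> //; split; last by apply/Hg; right.
have Hsub z w : app f z w -> app g z w by move=> /Hf H; apply/Hg; left.
(* A value computed from any table that agrees with [g] on the elements of [u] is also the value
   computed from [g]: totality gives some value from [g], and uniqueness identifies the two. *)
have Hstep u f' w : is_function f' ->
   (forall z, z ∈ u -> exists w, app f' z w /\ app g z w) -> step u f' w -> step u g w.
  move=> Ff' Hag Hs.
  have [|w' Hw'] := step_total (u := u) Fg; first by move=> z /Hag [w0 [_ H0]]; exists w0.
  by rewrite (step_unique Ff' Fg Hag Hs Hw').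
move=> u w /Hg [[[z0 [Hz0 Hu]] Hr]|[-> ->]].
- have [f' [Ff' [Cf' [Rf' Sf']]]] := recursion_inv Hr.
  have Hag z : z ∈ u -> exists w, app f' z w /\ app g z w.
    move=> Hz; have [w' Hw'] := Cf' z Hz; exists w'; split=> //; apply/Hg; left.
    by split; [exists z0; split=> //; exact: in_TC_mem Hu Hz|exact: Rf'].
  split; last exact: Hstep Ff' Hag Sf'.
  by move=> z /Hag [w' [_ ?]]; exists w'.
- have Hag z : z ∈ x -> exists w, app f z w /\ app g z w.
    move=> Hz; have [w' Hw'] := IH z Hz z (in_TC_refl (x := z)); exists w'.
    have H : app f z w' by apply/Hf; split=> //; exact: Df.
    by split=> //; exact: Hsub.
  split; last exact: Hstep Ff Hag Hv.
  by move=> z /Hag [w' [_ ?]]; exists w'.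
Qed.
End Recursion.

Lemma V_ext (x y : V) : (forall z, z ∈ x <-> z ∈ y) -> x = y.
Proof. exact: (zfc_extensionality VZ). Qed.

Lemma subsetV (x y : V) : subset x y <-> forall z, z ∈ x -> z ∈ y.
Proof. by split=> [[_ [_ //]]|H]; split; [exact: V_set|split; [exact: V_set|]]. Qed.

Lemma transitiveV (t : V) : transitive t <-> forall y z, z ∈ y -> y ∈ t -> z ∈ t.
Proof. by split=> [[_ //]|H]; split; [exact: V_set|]. Qed.

Instance Def1_is_ordinal : Def1 (@is_ordinal V).
Proof. by rewrite /is_ordinal; dfn. Qed.

(** * The universe with atoms *)

Lemma ordinal_mem (a b : V) : is_ordinal a -> b ∈ a -> is_ordinal b.
Proof.
move=> [/transitiveV Ta Ha] Hb; split; first exact: Ha.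
by move=> c Hc; apply: Ha; exact: Ta Hc Hb.
Qed.

Lemma ordinal_trans (a b c : V) : is_ordinal a -> c ∈ b -> b ∈ a -> c ∈ a.
Proof. by move=> [/transitiveV Ta _]; exact: Ta. Qed.

Lemma ordinal_trichotomy (a b : V) : is_ordinal a -> is_ordinal b ->
  a ∈ b \/ a = b \/ b ∈ a.
Proof.
move: a b.
apply: V_ind.
  by dfn.
move=> a IHa.
apply: V_ind.
  by dfn.
move=> b IHb Oa Ob.
case: (classic (exists c, c ∈ a /\ ~ c ∈ b)) => [[c [Hca Hcb]]|H1].
  have [//|[<-|Hbc]] := IHa c Hca b (ordinal_mem Oa Hca) Ob; auto.
  by right; right; exact: ordinal_trans Oa Hbc Hca.
case: (classic (exists c, c ∈ b /\ ~ c ∈ a)) => [[c [Hcb Hca]]|H2].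
  have [Hac|[->|//]] := IHb c Hcb Oa (ordinal_mem Ob Hcb); auto.
  by left; exact: ordinal_trans Ob Hac Hcb.
right; left; apply: V_ext => z; split=> Hz; apply: NNPP => H.
  by apply: H1; exists z.
by apply: H2; exists z.
Qed.

Lemma ordinal_suc (a : V) : is_ordinal a -> is_ordinal (suc a).
Proof.
move=> Oa; split.
  apply/transitiveV => y z Hz /in_suc [Hy|E]; apply/in_suc; left.
    exact: ordinal_trans Oa Hz Hy.
  by rewrite -E.
by move=> b /in_suc [Hb|->]; case: Oa => // _; apply.
Qed.

Lemma ordinal_emp : is_ordinal (emp : V).
Proof. by split=> [|b /in_emp //]; apply/transitiveV => y z _ /in_emp. Qed.

Lemma nat_ordinal (n : V) : is_nat n -> is_ordinal n.
Proof.
move: n; apply: nat_ind; [exact: ordinal_emp|].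
by move=> n _; exact: ordinal_suc.
Qed.

Lemma tagged0E (y z : V) : tagged0 y z <-> y = pr z emp.
Proof.
split=> [[o [/is_zeroE -> /is_pairE //]]|->].
by exists emp; split; [exact/is_zeroE|exact/is_pairE].
Qed.

Lemma tagged1E (y z : V) : tagged1 y z <-> y = pr z (suc emp).
Proof.
split=> [[o [/is_oneE -> /is_pairE //]]|->].
by exists (suc emp); split; [exact/is_oneE|exact/is_pairE].
Qed.

Instance Def2_tagged0 : Def2 (@tagged0 V).
Proof. by rewrite /tagged0 /is_zero; dfn. Qed.
Instance Def2_tagged1 : Def2 (@tagged1 V).
Proof. by rewrite /tagged1 /is_one /is_zero; dfn. Qed.

(** * The cumulative hierarchy over a set of atoms *)

Section Level.
Variable X : V.

Definition level_step (a f v : V) : Prop :=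
  (is_empty a /\ forall p, p ∈ v <-> exists x, x ∈ X /\ tagged1 p x) \/
  (exists b w, is_succ b a /\ app f b w /\
     forall p, p ∈ v <-> (exists z, subset z w /\ tagged0 p z) \/ p ∈ w) \/
  (~ is_empty a /\ ~ (exists b, is_succ b a) /\
     forall p, p ∈ v <-> exists b w, b ∈ a /\ app f b w /\ p ∈ w).

Instance Def3_level_step : Def3 level_step.
Proof. by rewrite /level_step; dfn. Qed.

Lemma level_step_total (u f : V) : is_function f ->
  (forall z, z ∈ u -> exists w, app f z w) -> exists v, level_step u f v.
Proof.
move=> [_ Ff] Hf.
case: (classic (is_empty u)) => [E|NE].
  have D : Def1 (fun p : V => exists x, x ∈ X /\ tagged1 p x) by dfn.
  have [|v Hv] := V_mk D; last by exists v; left.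
  apply: (Bdd_ex (V_bdd X)); [by dfn|by dfn|].
  by move=> x _ t t' /tagged1E -> /tagged1E ->.
case: (classic (exists b, is_succ b u)) => [[b Hb]|NS].
  have [|w Hw] := Hf b; first by apply/(proj2 Hb); right.
  have D : Def1 (fun p : V => (exists z, subset z w /\ tagged0 p z) \/ p ∈ w) by dfn.
  have [|v Hv] := V_mk D; last by exists v; right; left; exists b, w.
  apply: Bdd_or; last exact: V_bdd.
  apply: (Bdd_ex (Bdd_powV w)); [by dfn|by dfn|].
  by move=> x _ t t' /tagged0E -> /tagged0E ->.
have D : Def1 (fun p : V => exists b w, b ∈ u /\ app f b w /\ p ∈ w) by dfn.
have [|v Hv] := V_mk D; last by exists v; right; right.
apply: (Bdd_sub (Q := fun p => exists b, b ∈ u /\ exists w, app f b w /\ p ∈ w)).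
  apply: (Bdd_bigU (V_bdd u)); [by dfn|by dfn|move=> b Hb].
  apply: (Bdd_bigU (P := fun w => app f b w)); [|by dfn|by dfn|move=> w _; exact: V_bdd].
  by apply: Bdd_uniq; exact: Ff.
by move=> p [b [w [H1 [H2 H3]]]]; exists b; split=> //; exists w.
Qed.

Lemma level_step_unique (u f g v v' : V) : is_function f -> is_function g ->
  (forall z, z ∈ u -> exists w, app f z w /\ app g z w) ->
  level_step u f v -> level_step u g v' -> v = v'.
Proof.
move=> [_ Ff] [_ Fg] Hfg.
case=> [[/is_emptyE E Hv]|[[b [w [/is_succE E [Hw Hv]]]]|[NE [NS Hv]]]].
- case=> [[_ Hv']|[[b [w [/is_succE E' _]]]|[/is_emptyE //]]].
    by apply: V_ext => p; rewrite Hv Hv'.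
  by case: (@suc_neq_emp V _ b); rewrite -E'.
- case=> [[/is_emptyE E' _]|[[b' [w' [/is_succE E' [Hw' Hv']]]]|[_ [[]]]]].
  + by case: (@suc_neq_emp V _ b); rewrite -E.
  + have Eb : b = b' by apply: suc_inj; rewrite -E.
    subst b'; have [|w0 [H1 H2]] := Hfg b; first by rewrite E in_suc; right.
    have Ew : w = w' by rewrite (Ff _ _ _ Hw H1) (Fg _ _ _ Hw' H2).
    by subst w'; apply: V_ext => p; rewrite Hv Hv'.
  + by exists b; apply/is_succE.
- case=> [[/NE []]|[[b [w [Hs _]]]|[_ [_ Hv']]]]; first by case: NS; exists b.
  apply: V_ext => p; rewrite Hv Hv'.
  split=> -[b [w [Hb [Hw Hp]]]]; have [w0 [H1 H2]] := Hfg b Hb; exists b, w0.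
    by split=> //; split=> //; rewrite -(Ff _ _ _ Hw H1).
  by split=> //; split=> //; rewrite -(Fg _ _ _ Hw H2).
Qed.

Definition level (a : V) : V := iota (is_level X a).

Instance Def2_is_level : Def2 (is_level X).
Proof. exact: Def2_by_recursion. Qed.

Lemma is_levelE a v : is_level X a v <-> v = level a.
Proof.
have U x y y' : is_level X x y -> is_level X x y' -> y = y'.
  exact: (recursion_unique level_step_unique).
have T : exists v, is_level X a v.
  exact: (recursion_total level_step_total level_step_unique).
split=> [Hv|->]; last by refine (iota_spec T _) => y z Hy Hz; exact: U Hz Hy.
by symmetry; refine (iota_eq Hv _) => z Hz; exact: U Hz Hv.
Qed.

Instance DefF1_level : DefF1 level.
Proof. by rewrite /level; dfn. Qed.

Lemma level_inv a : exists f, (forall z, z ∈ a -> app f z (level z)) /\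
  (forall z w, app f z w -> w = level z) /\ level_step a f (level a).
Proof.
have [|f [Ff [Cf [Rf Sf]]]] := @recursion_inv V level_step a (level a).
  exact/is_levelE.
exists f; split; last by split=> // z w /Rf /is_levelE.
by move=> z /Cf [w Hw]; have -> : level z = w by symmetry; apply/is_levelE/Rf.
Qed.

Lemma level_emp p : p ∈ level emp <-> exists x, x ∈ X /\ p = pr x (suc emp).
Proof.
have [f [_ [_ [[_ Hv]|[[b [w [/is_succE E _]]]|[/is_emptyE //]]]]]] := level_inv emp.
  rewrite Hv; by split=> -[x [Hx /tagged1E H]]; exists x.
by case: (suc_neq_emp (esym E)).
Qed.

Lemma level_suc b p : p ∈ level (suc b) <->
  (exists z, subset z (level b) /\ p = pr z emp) \/ p ∈ level b.
Proof.
have [f [_ [Hf [[/is_emptyE E _]|[[b' [w [/is_succE E [/Hf -> Hv]]]]|[_ [[]]]]]]]] := level_inv (suc b).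
- by case: (suc_neq_emp E).
- have {}E := V_suc_inj E; subst b'; rewrite Hv.
  by split=> -[[z [Hz /tagged0E H]]|H]; auto; left; exists z.
- by exists b; apply/is_succE.
Qed.

Lemma level_limit a p : a <> emp -> ~ (exists b, a = suc b) ->
  p ∈ level a <-> exists b, b ∈ a /\ p ∈ level b.
Proof.
move=> NE NS.
have [f [Cf [Hf [[/is_emptyE //]|[[b' [w [/is_succE E _]]]|[_ [_ Hv]]]]]]] := level_inv a.
  by case: NS; exists b'.
rewrite Hv; split=> [[b [w [Hb [/Hf -> Hp]]]]|[b [Hb Hp]]]; first by exists b.
by exists b, (level b); split=> //; split=> //; exact: Cf.
Qed.

Lemma level_mono a b p : b ∈ a -> p ∈ level b -> p ∈ level a.
Proof.
move: a b p.
apply: V_ind; first by dfn.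
move=> a IH b p Hb Hp.
case: (classic (a = emp)) => [E|NE]; first by subst a; case: (in_emp Hb).
case: (classic (exists b, a = suc b)) => [[c E]|NS]; last first.
  by apply/(level_limit _ NE NS); exists b.
subst a; apply/level_suc; right; move: Hb => /in_suc [Hb|<- //].
by apply: (IH c) Hb Hp; apply/in_suc; right.
Qed.

Instance Def1_in_Vstar : Def1 (in_Vstar X).
Proof. by rewrite /in_Vstar; dfn. Qed.

Lemma in_VstarE y : in_Vstar X y <-> exists a, is_ordinal a /\ y ∈ level a.
Proof.
split=> [[a [v [Oa [/is_levelE -> Hy]]]]|[a [Oa Hy]]]; exists a => //.
by exists (level a); split=> //; split=> //; apply/is_levelE.
Qed.

Lemma in_Vstar_atom x : x ∈ X -> in_Vstar X (pr x (suc emp)).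
Proof.
move=> Hx; apply/in_VstarE; exists emp; split; first exact: ordinal_emp.
by apply/level_emp; exists x.
Qed.

Lemma in_Vstar_inv y : in_Vstar X y -> (exists x, x ∈ X /\ y = pr x (suc emp)) \/
  exists z, y = pr z emp /\ forall w, w ∈ z -> in_Vstar X w.
Proof.
move=> /in_VstarE [a [Oa Hy]]; move: a Oa Hy.
apply: V_ind; first by dfn.
move=> a IH Oa Hy.
case: (classic (a = emp)) => [E|NE]; first by subst a; move/level_emp: Hy; left.
case: (classic (exists b, a = suc b)) => [[c E]|NS]; last first.
  move/(level_limit _ NE NS): Hy => [b [Hb Hy]].
  by apply: (IH b) => //; exact: ordinal_mem Oa Hb.
have Hc : c ∈ a by rewrite E; apply/in_suc; right.
subst a; move/level_suc: Hy => [[z [/subsetV Hz ->]]|Hy]; last first.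
  by apply: (IH c) => //; exact: ordinal_mem Oa Hc.
right; exists z; split=> // w Hw; apply/in_VstarE; exists c.
by split; [exact: ordinal_mem Oa Hc|exact: Hz].
Qed.

(* The levels of the elements of [z] are bounded by the union of the least ones. *)
Lemma in_Vstar_set z : (forall w, w ∈ z -> in_Vstar X w) -> in_Vstar X (pr z emp).
Proof.
move=> Hz.
pose (R := fun w a => is_ordinal a /\ w ∈ level a /\ forall b, b ∈ a -> ~ w ∈ level b).
have DR : Def2 R by rewrite /R; dfn.
have Rex w : in_Vstar X w -> exists a, R w a.
  move=> /in_VstarE [a [Oa Hw]]; move: a Oa Hw.
  apply: V_ind; first by dfn.
  move=> a IH Oa Hw.
  case: (classic (exists b, b ∈ a /\ w ∈ level b)) => [[b [Hb Hwb]]|H].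
    exact: (IH b Hb (ordinal_mem Oa Hb) Hwb).
  exists a; split=> //; split=> // b Hb Hwb; by apply: H; exists b.
have Runiq w a b : R w a -> R w b -> a = b.
  move=> [Oa [H1 H2]] [Ob [H3 H4]].
  have [H|[//|H]] := ordinal_trichotomy Oa Ob; [by case: (H4 a H)|by case: (H2 b H)].
(* The successors of the least levels are united, so that each least level is an element of [s], as
   [level_mono] demands. Then [z] is a subset of level [s] and its tagged copy appears one level
   later. *)
have BS : Bdd (fun b => exists a, (exists w, w ∈ z /\ R w a) /\ b ∈ suc a).
  apply: (Bdd_bigU (P := fun a => exists w, w ∈ z /\ R w a)); [|by dfn|by dfn|move=> a _; exact: V_bdd].
  by apply: (Bdd_ex (V_bdd z)); [dfn|move=> w _ t t'; exact: Runiq].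
have [|s HE] := V_mk _ BS; first by dfn.
have Os : is_ordinal s.
  split.
    apply/transitiveV => y y' Hy /HE [a [[w [Hw Ha]] Hya]]; apply/HE; exists a.
    split; first by exists w.
    by apply: ordinal_trans Hy Hya; apply: ordinal_suc; case: Ha.
  move=> b /HE [a [[w [Hw Ha]] Hb]].
  have Osa : is_ordinal (suc a) by apply: ordinal_suc; case: Ha.
  by case: (ordinal_mem Osa Hb).
apply/in_VstarE; exists (suc s); split; first exact: ordinal_suc.
apply/level_suc; left; exists z; split=> //; apply/subsetV => w Hw.
have [a Ha] := Rex w (Hz w Hw).
apply: (@level_mono s a); last by case: Ha => _ [].
by apply/HE; exists a; split; [exists w|apply/in_suc; right].
Qed.

Lemma tag_neq (x y : V) : pr x emp <> pr y (suc emp).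
Proof. by move=> /pr_inj [_ /esym /suc_neq_emp]. Qed.

Instance Sort_Vstar : Sort (Vstar X).
Proof.
refine {| inj := fun y : Vstar X => proj1_sig y;
  dflt := exist _ (pr emp emp) (in_Vstar_set (fun w Hw => match in_emp Hw with end)) : Vstar X |}.
- by move=> [x Hx] [y Hy] /= E; subst y; rewrite (proof_irrelevance _ Hx Hy).
- have [f [c Hf]] := Def1_formula Def1_in_Vstar.
  exists f, c => a; rewrite -Hf; split=> [[[y Hy] /= <- //]|Ha].
  by exists (exist _ a Ha).
Defined.

Instance DefF1_proj1 : DefF1 (fun y : Vstar X => @proj1_sig V (in_Vstar X) y).
Proof. exact: (@DefT_inj _ _ _ _ (fun y : unit * Vstar X => snd y) (DefT_snd _ _)). Qed.

Lemma Vstar_mem (w y : Vstar X) : w ∈ y <-> exists z, proj1_sig y = pr z emp /\ proj1_sig w ∈ z.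
Proof. by split=> -[z [/tagged0E H1 H2]]; exists z. Qed.

Lemma Vstar_atom (y : Vstar X) : atom y <-> exists z, proj1_sig y = pr z (suc emp).
Proof. by split=> -[z /tagged1E H]; exists z. Qed.

Lemma Vstar_is_set (y : Vstar X) : is_set y <->
  exists z, proj1_sig y = pr z emp /\ forall w, w ∈ z -> in_Vstar X w.
Proof.
split=> [Sy|[z [E _]] /Vstar_atom [x Hx]]; last by apply: (@tag_neq z x); rewrite -E.
case: (in_Vstar_inv (proj2_sig y)) => // -[x [_ Hx]].
by case: Sy; apply/Vstar_atom; exists x.
Qed.

Lemma Vstar_mem_tag (w y : Vstar X) z : proj1_sig y = pr z emp -> w ∈ y <-> proj1_sig w ∈ z.
Proof.
move=> E; rewrite Vstar_mem; split=> [[z' []]|]; last by exists z.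
by rewrite E => /pr_inj [-> _].
Qed.

Instance PreUniverse_Vstar : PreUniverse (Vstar X).
Proof.
refine {| u_sort := Sort_Vstar |}.
- rewrite /mem /=; by dfn.
- rewrite /atom /=; by dfn.
- move=> x y /Vstar_is_set [a [Ea Ha]] /Vstar_is_set [b [Eb Hb]] H.
  apply: inj_inj => /=; rewrite Ea Eb; congr pr; apply: V_ext => z.
  split=> Hz; [have Iz := Ha z Hz|have Iz := Hb z Hz];
    have := H (exist _ z Iz); rewrite (Vstar_mem_tag _ Ea) (Vstar_mem_tag _ Eb) /=; tauto.
- move=> x z /Vstar_atom [a Ea] /Vstar_mem [b [Eb _]].
  by apply: (@tag_neq b a); rewrite -Eb.
- move=> x; case: (classic (is_set x)) => [/Vstar_is_set [a [Ea Ha]]|Nx].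
    by exists a => w /(Vstar_mem_tag _ Ea).
  exists v0 => w /Vstar_mem [b [Eb _]]; case: Nx => /Vstar_atom [a Ea].
  by apply: (@tag_neq b a); rewrite -Eb.
- move=> P DP [a Ha].
  have [b Hb] : exists b : V, forall c, c ∈ b <-> c ∈ a /\ exists w : Vstar X, inj w = c /\ P w.
    by apply: V_sep; dfn.
  have Ib w : w ∈ b -> in_Vstar X w by move=> /Hb [_ [[w' Hw'] [/= <- _]]].
  exists (exist _ (pr b emp) (in_Vstar_set Ib)); split; first by apply/Vstar_is_set; exists b.
  move=> w; rewrite (@Vstar_mem_tag _ _ b) //= Hb; split.
    by move=> [_ [w' [E Hw']]]; rewrite -(@inj_inj _ Sort_Vstar w' w E).
  by move=> Hw; split; [exact: Ha|exists w].
Defined.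

Instance Universe_Vstar : Universe (Vstar X).
Proof.
refine {| u_pre := PreUniverse_Vstar |} => P DP HP x.
pose (Q := fun a => forall m : Vstar X, inj m = a -> P m).
have DQ : Def1 Q by rewrite /Q; dfn.
(* An element [w] of the coded set [pr z emp] lies three steps of membership below it, through [z]
   and the singleton of [z]. The induction therefore carries the claim for two further generations
   of elements. *)
suff H : forall a, Q a /\ forall b, b ∈ a -> Q b /\ forall c, c ∈ b -> Q c.
  by case: (H (inj x)) => H1 _; exact: H1.
apply: V_ind; first by dfn.
move=> a IH; split; last by move=> b /IH [H1 H2]; split=> // c /H2 [].
move=> m Em; apply: HP => w /Vstar_mem [z [Ez Hw]].
have [_ H] : Q (upr z z) /\ forall b, b ∈ upr z z -> Q b /\ forall c, c ∈ b -> Q c.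
  apply: IH; rewrite -Em /= Ez; apply/in_upr; auto.
have [_ H'] : Q z /\ forall c, c ∈ z -> Q c by apply: H; apply/in_upr; auto.
by apply: (H' _ Hw).
Defined.
End Level.
#[global] Existing Instance Def3_level_step.
#[global] Existing Instance Def2_is_level.
#[global] Existing Instance DefF1_level.
#[global] Existing Instance Def1_in_Vstar.
#[global] Existing Instance Sort_Vstar.
#[global] Existing Instance PreUniverse_Vstar.
#[global] Existing Instance Universe_Vstar.

(** * Permutations of the atoms, automorphism groups and stabilizers *)

Section Action.
Context {M : structure} {UM : Universe M}.
Implicit Types a b c u v w x y z f g h k t p H K : M.

#[global] Instance Def2_is_permutation : Def2 (@is_permutation M).
Proof. by rewrite /is_permutation; dfn. Qed.
#[global] Instance Def3_act : Def3 (@act M).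
Proof. by rewrite /act /by_recursion; dfn. Qed.
#[global] Instance Def2_is_automorphism : Def2 (@is_automorphism M).
Proof. by rewrite /is_automorphism; dfn. Qed.
#[global] Instance Def3_is_stabilizer : Def3 (@is_stabilizer M).
Proof. by rewrite /is_stabilizer; dfn. Qed.
#[global] Instance Def1_atom_tuple : Def1 (@atom_tuple M).
Proof. by rewrite /atom_tuple; dfn. Qed.
Definition ac g x : M := iota (act g x).
#[global] Instance DefF2_ac : DefF2 ac.
Proof. by rewrite /ac; dfn. Qed.

Context (S : M) (atoms_S : forall a, a ∈ S <-> atom a).

Definition act_step g u f v : Prop :=
  (atom u /\ app g u v) \/
  (is_set u /\ is_set v /\ forall w, w ∈ v <-> exists z, z ∈ u /\ app f z w).

Lemma Def3_act_step g : Def3 (act_step g).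
Proof. by rewrite /act_step; dfn. Qed.

Lemma act_step_total g u f : is_permutation S g -> is_function f ->
  (forall z, z ∈ u -> exists w, app f z w) -> exists v, act_step g u f v.
Proof.
move=> [_ [Hg _]] [_ Ff] Hf.
case: (classic (atom u)) => [Au|Su].
  have /Hg [v Hv] : u ∈ S by apply/atoms_S.
  by exists v; left.
have D : Def1 (fun w => exists z, z ∈ u /\ app f z w) by dfn.
have [|v [Sv Hv]] := u_mk D; last by exists v; right.
by apply: (Bdd_ex (u_bdd u)); try (by dfn); move=> z _; exact: Ff.
Qed.

Lemma act_step_unique g u f f' v v' : is_permutation S g -> is_function f -> is_function f' ->
  (forall z, z ∈ u -> exists w, app f z w /\ app f' z w) ->
  act_step g u f v -> act_step g u f' v' -> v = v'.
Proof.
move=> [[_ Fg] _] [_ Ff] [_ Ff'] Hf [[Au Hv]|[Su [Sv Hv]]] [[Au' Hv']|[Su' [Sv' Hv']]] //.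
  exact: Fg Hv Hv'.
apply: u_ext => // w; rewrite Hv Hv'; split=> -[z [Hz Hw]]; have [w0 [H1 H2]] := Hf z Hz;
  exists z; split=> //.
- by rewrite (Ff _ _ _ Hw H1).
- by rewrite (Ff' _ _ _ Hw H2).
Qed.

Section Permutation.
Context (g : M) (Pg : is_permutation S g).

Lemma actE x y : act g x y <-> y = ac g x.
Proof.
have U z y1 y2 : act g z y1 -> act g z y2 -> y1 = y2.
  apply: (recursion_unique (Dstep := Def3_act_step g)) => u f f' v v'; exact: act_step_unique Pg.
have Tx : exists v, act g x v.
  apply: (recursion_total (Dstep := Def3_act_step g)).
    move=> u f; exact: act_step_total Pg.
  move=> u f f' v v'; exact: act_step_unique Pg.
split=> [Hy|->]; last by refine (iota_spec Tx _) => y1 y2 H1 H2; exact: U H2 H1.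
by symmetry; refine (iota_eq Hy _) => z Hz; exact: U Hz Hy.
Qed.

Lemma ac_inv x : exists f, (forall z, z ∈ x -> app f z (ac g z)) /\
  (forall z w, app f z w -> w = ac g z) /\ act_step g x f (ac g x).
Proof.
have [|f [Ff [Cf [Rf Sf]]]] := @recursion_inv M (act_step g) x (ac g x).
  exact/actE.
exists f; split; last by split=> // z w /Rf /actE.
by move=> z /Cf [w Hw]; have -> : ac g z = w by symmetry; apply/actE/Rf.
Qed.

Lemma ac_app a : atom a -> app g a (ac g a).
Proof. by move=> Aa; have [f [_ [_ [[]|[]]]]] := ac_inv a. Qed.

Lemma ac_atom x : atom (ac g x) <-> atom x.
Proof.
split=> Hx.
  by have [f [_ [_ [[]|[_ []]]]]] := ac_inv x.
by apply/atoms_S; case: Pg => _ [_ [-> _]]; exists x; exact: ac_app.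
Qed.

Lemma ac_mem w x : w ∈ ac g x <-> exists z, z ∈ x /\ w = ac g z.
Proof.
case: (classic (atom x)) => [Ax|Sx].
  split=> [Hw|[z [Hz _]]]; last by case: (u_atom_empty Ax Hz).
  by have /ac_atom A := Ax; case: (u_atom_empty A Hw).
have [f [Cf [Hf [[]//|[_ [_ ->]]]]]] := ac_inv x.
split=> [[z [Hz /Hf ->]]|[z [Hz ->]]]; first by exists z.
by exists z; split=> //; exact: Cf.
Qed.

Lemma ac_eq x y : is_set x -> is_set y -> (forall w, w ∈ y <-> exists z, z ∈ x /\ w = ac g z) ->
  ac g x = y.
Proof.
move=> Sx Sy H; apply: u_ext => //; first by move/ac_atom.
by move=> w; rewrite ac_mem H.
Qed.

Lemma ac_upr x y : ac g (upr x y) = upr (ac g x) (ac g y).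
Proof.
apply: ac_eq; [exact: (proj1 (upr_spec _ _))|exact: (proj1 (upr_spec _ _))|] => w.
rewrite in_upr; split=> [[->|->]|[z [/in_upr [->|->]]]]; auto.
  by exists x; split=> //; apply/in_upr; auto.
by exists y; split=> //; apply/in_upr; auto.
Qed.

Lemma ac_pr x y : ac g (pr x y) = pr (ac g x) (ac g y).
Proof. by rewrite /pr !ac_upr. Qed.
End Permutation.

Lemma app_dom g a b : is_permutation S g -> app g a b -> atom a /\ atom b.
Proof.
by move=> [_ [H1 [H2 _]]] H; split; apply/atoms_S; [apply/H1; exists b|apply/H2; exists a].
Qed.

Lemma app_ac g a b : is_permutation S g -> app g a b -> b = ac g a.
Proof.
move=> Pg H; case: (Pg) => -[_ Fg] _; apply: (Fg _ _ _ H); apply: (ac_app Pg).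
by case: (app_dom Pg H).
Qed.

Lemma ac_inverse g h : is_permutation S g -> is_permutation S h ->
  (forall a b, app g a b -> app h b a) -> forall x, ac h (ac g x) = x.
Proof.
move=> Pg Ph Hgh; apply: u_ind; first by dfn.
move=> x IH; case: (classic (atom x)) => [Ax|Sx].
  by symmetry; apply: (app_ac Ph); apply: Hgh; exact: (ac_app Pg).
apply: (ac_eq Ph) => //; first by move/(ac_atom Pg).
move=> w; split=> [Hw|[z [/(ac_mem Pg) [z' [Hz' ->]] ->]]]; last by rewrite IH.
by exists (ac g w); rewrite IH //; split=> //; apply/(ac_mem Pg); exists w.
Qed.

Lemma ac_comp f g k : is_permutation S f -> is_permutation S g -> is_permutation S k ->
  (forall a b c, app f a b -> app g b c -> app k a c) ->
  forall x, ac k x = ac g (ac f x).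
Proof.
move=> Pf Pg Pk H; apply: u_ind; first by dfn.
move=> x IH; case: (classic (atom x)) => [Ax|Sx].
  symmetry; apply: (app_ac Pk); apply: H; first exact: (ac_app Pf).
  by apply: (ac_app Pg); apply/(ac_atom Pf).
apply: (ac_eq Pk) => //; first by move/(ac_atom Pg)/(ac_atom Pf).
move=> w; split=> [/(ac_mem Pg) [z [/(ac_mem Pf) [z' [Hz' ->]] ->]]|[z [Hz ->]]].
  by exists z'; rewrite IH.
rewrite IH //; apply/(ac_mem Pg); exists (ac f z); split=> //.
by apply/(ac_mem Pf); exists z.
Qed.

Lemma ac_id g : is_permutation S g -> (forall a, atom a -> app g a a) ->
  forall x, ac g x = x.
Proof.
move=> Pg H; apply: u_ind; first by dfn.
move=> x IH; case: (classic (atom x)) => [Ax|Sx].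
  by symmetry; apply: (app_ac Pg); exact: H.
apply: (ac_eq Pg) => // w; split=> [Hw|[z [Hz ->]]]; last by rewrite IH.
by exists w; rewrite IH.
Qed.

Context (T : M).
Definition autom g : Prop := is_permutation S g /\
  forall a b a' b', app g a a' -> app g b b' -> (app T a b <-> app T a' b').

#[global] Instance Def1_autom : Def1 autom.
Proof. by rewrite /autom; dfn. Qed.

Lemma is_automorphismE g : is_automorphism (pr S T) g <-> autom g.
Proof.
split=> [[S' [T' [/is_pairE /pr_inj [<- <-] H]]]|H]; first exact: H.
by exists S, T; split=> //; apply/is_pairE.
Qed.

Lemma permutation_graph (R : M -> M -> Prop) : Def2 R ->
  (forall a b, R a b -> atom a /\ atom b) ->
  (forall a b b', R a b -> R a b' -> b = b') -> (forall a a' b, R a b -> R a' b -> a = a') ->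
  (forall a, atom a -> exists b, R a b) -> (forall b, atom b -> exists a, R a b) ->
  is_permutation S (graph R) /\ forall a b, app (graph R) a b <-> R a b.
Proof.
move=> DR H0 H1 H2 H3 H4.
have BS : Bdd (fun a : M => atom a) by apply: (Bdd_sub (u_bdd S)) => a /atoms_S.
have [|Rg Hg] := graph_spec DR u_atom u_atom BS BS; first exact: H0.
split=> //; split; first by split=> // x y y'; rewrite !Hg; exact: H1.
split; [|split].
- move=> a; rewrite atoms_S; split=> [/H3 [b Hb]|[b /Hg /H0 []//]]; by exists b; apply/Hg.
- move=> a; rewrite atoms_S; split=> [/H4 [b Hb]|[b /Hg /H0 []//]]; by exists b; apply/Hg.
- by move=> a a' b; rewrite !Hg; exact: H2.
Qed.

Lemma autom_inverse g : autom g -> exists h, autom h /\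
  (forall a b, app h a b <-> app g b a) /\ is_inverse g h.
Proof.
move=> [Pg Hg]; case: (Pg) => -[Rg Fg] [D1 [D2 Ig]].
have [||||||Ph Hh] := @permutation_graph (fun a b => app g b a).
- by dfn.
- by move=> a b /(app_dom Pg) [].
- move=> a b b'; exact: Ig.
- move=> a a' b; exact: Fg.
- by move=> a /atoms_S /D2.
- by move=> a /atoms_S /D1.
exists (graph (fun a b => app g b a)); split; [split=> //|split=> //].
  by move=> a b a' b' /Hh H1 /Hh H2; rewrite (Hg _ _ _ _ H1 H2).
case: Ph => -[Rh _] _; split; first by case: Rh.
move=> p; split.
  move=> Hp; have [x [y E]] := relation_mem Rh Hp.
  exists y, x; rewrite is_pairE; split=> //; apply/Hh; apply/appE; by rewrite -E.
by move=> [x [y [H /is_pairE ->]]]; apply/appE/Hh.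
Qed.

Lemma autom_comp f g : autom f -> autom g -> exists k, autom k /\
  (forall a c, app k a c <-> exists b, app f a b /\ app g b c) /\ is_composition g f k.
Proof.
move=> [Pf Hf] [Pg Hg]; case: (Pg) => -[Rg Fg] [D1 [D2 Ig]]; case: (Pf) => -[Rf Ff] [E1 [E2 If]].
have [||||||Ph Hh] := @permutation_graph (fun a c => exists b, app f a b /\ app g b c).
- by dfn.
- by move=> a c [b [/(app_dom Pf) [? _] /(app_dom Pg) []]].
- by move=> a c c' [b [H1 H2]] [b' [H3 H4]]; rewrite (Ff _ _ _ H1 H3) in H2; exact: Fg H2 H4.
- by move=> a a' c [b [H1 H2]] [b' [H3 H4]]; rewrite (Ig _ _ _ H2 H4) in H1; exact: If H1 H3.
- move=> a /atoms_S /E1 [b Hb]; have [_ /atoms_S /D1 [c Hc]] := app_dom Pf Hb.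
  by exists c, b.
- move=> a /atoms_S /D2 [b Hb]; have [/atoms_S /E2 [c Hc] _] := app_dom Pg Hb.
  by exists c, b.
exists (graph (fun a c => exists b, app f a b /\ app g b c)); split; [split=> //|split=> //].
  by move=> a b a' b' /Hh [a1 [H1 H2]] /Hh [b1 [H3 H4]]; rewrite (Hf _ _ _ _ H1 H3) (Hg _ _ _ _ H2 H4).
case: Ph => -[Rh _] _; split; first by case: Rh.
move=> p; split.
  move=> Hp; have [x [y E]] := relation_mem Rh Hp.
  have /Hh [b [H1 H2]] : app (graph (fun a c => exists b, app f a b /\ app g b c)) x y.
    by apply/appE; rewrite -E.
  by exists x, b, y; rewrite is_pairE.
by move=> [x [b [z [H1 [H2 /is_pairE ->]]]]]; apply/appE/Hh; exists b.
Qed.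

Lemma autom_id : exists k, autom k /\ forall a, atom a -> app k a a.
Proof.
have [||||||Ph Hh] := @permutation_graph (fun a c => atom a /\ a = c).
- by dfn.
- by move=> a c [H <-].
- by move=> a b b' [_ <-] [_ <-].
- by move=> a b b' [_ ->] [_ ->].
- by move=> a Ha; exists a.
- by move=> a Ha; exists a.
exists (graph (fun a c => atom a /\ a = c)); split.
  by split=> // a b a' b' /Hh [_ <-] /Hh [_ <-].
by move=> a Ha; apply/Hh.
Qed.

Lemma Bdd_autom : Bdd autom.
Proof.
pose (Q := fun p => exists a b, atom a /\ atom b /\ p = pr a b).
have DQ : Def1 Q by rewrite /Q; dfn.
have BS : Bdd (fun a : M => atom a) by apply: (Bdd_sub (u_bdd S)) => a /atoms_S.
have BQ : Bdd Q by exact: (Bdd_pr u_atom u_atom BS BS).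
apply: (Bdd_sub (Bdd_pow DQ BQ)) => g [Pg _].
case: (Pg) => -[Rg _] _; split; first by case: Rg.
move=> p Hp; have [x [y E]] := relation_mem Rg Hp; exists x, y.
by have [] := @app_dom g x y Pg; [apply/appE; rewrite -E|].
Qed.

Definition Aut : M := setof autom.

Lemma in_Aut g : g ∈ Aut <-> autom g.
Proof. exact: (in_setof Def1_autom Bdd_autom). Qed.

Lemma is_AutE G : is_Aut (pr S T) G <-> G = Aut.
Proof.
split=> [[SG HG]|->].
  symmetry; apply: setof_eq => // g; by rewrite HG is_automorphismE.
split; first exact: (setof_set Def1_autom Bdd_autom).
by move=> g; rewrite in_Aut is_automorphismE.
Qed.

Lemma stabilizer_exists x : exists H, is_stabilizer Aut x H /\
  (forall g, g ∈ H <-> autom g /\ ac g x = x) /\ subgroup H Aut.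
Proof.
have D : Def1 (fun g => autom g /\ ac g x = x) by dfn.
have [|H [SH HH]] := u_mk D; first by apply: (Bdd_sub Bdd_autom) => g [].
exists H; split; [|split=> //].
  split=> // g; rewrite HH in_Aut; split=> -[Ag E]; split=> //; case: (Ag) => Pg _.
    by apply/(actE Pg).
  by symmetry; apply/(actE Pg).
split; [split=> //; split|split; [|split]].
- exact: (setof_set Def1_autom Bdd_autom).
- by move=> g /HH [Ag _]; apply/in_Aut.
- have [k [Ak Hk]] := autom_id; exists k; apply/HH; split=> //.
  by case: (Ak) => Pk _; exact: (ac_id Pk).
- move=> f g h /HH [Af Ef] /HH [Ag Eg] Hh.
  have [k [Ak [Hk [Sk Hk']]]] := autom_comp Af Ag.
  have Ehk : h = k.
    case: Hh => Sh Hh; apply: u_ext => // p; by rewrite Hh Hk'.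
  subst h; apply/HH; split=> //.
  have -> : ac k x = ac g (ac f x); last by rewrite Ef.
  apply: ac_comp; [by case: Af|by case: Ag|by case: Ak|].
  by move=> a b c H1 H2; apply/Hk; exists b.
- move=> f h /HH [Af Ef] Hh.
  have [k [Ak [Hk [Sk Hk']]]] := autom_inverse Af.
  have Ehk : h = k.
    case: Hh => Sh Hh; apply: u_ext => // p; by rewrite Hh Hk'.
  subst h; apply/HH; split=> //.
  rewrite -{1}Ef; apply: ac_inverse; [by case: Af|by case: Ak|].
  by move=> a b H1; apply/Hk.
Qed.

(** Stabilizers exist as sets and are subgroups, so the filter condition on the stabilizer of [y]
    comes down to one inclusion: whatever fixes the tuple [t] fixes [y]. *)
Lemma in_PM_Aut x : in_PM Aut (F_fin Aut) x <->
  forall y, in_TC_singleton x y ->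
    exists t, atom_tuple t /\ forall g, autom g -> ac g t = t -> ac g y = y.
Proof.
split=> HP y /HP.
  move=> [H [[SH HH] [_ [t [K [At [[SK HK] [_ [_ Hsub]]]]]]]]].
  exists t; split=> // g Ag Eg; case: (Ag) => Pg _; symmetry; apply/(actE Pg).
  have /HH [] // : g ∈ H.
  by apply/Hsub/HK; rewrite in_Aut; split=> //; apply/(actE Pg).
move=> [t [At Ht]].
have [H [StH [HH SgH]]] := stabilizer_exists y.
have [K [StK [HK SgK]]] := stabilizer_exists t.
exists H; split=> //; split=> //; exists t, K; split=> //; split=> //.
split; [by case: StK|split; [by case: StH|]].
by move=> g /HK [Ag Eg]; apply/HH; split=> //; exact: Ht.
Qed.
End Action.

(** * Finite sets and finite partial isomorphisms *)

Notation "x ⊆ y" := (forall z, z ∈ x -> z ∈ y) (at level 70, no associativity).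

Notation setV := (@setof V PreUniverse_V).

Lemma in_setV (P : V -> Prop) : Def (fun y : unit * V => P (snd y)) -> Bdd P -> forall w, w ∈ setV P <-> P w.
Proof. by move=> DP BP; apply: (@in_setof V PreUniverse_V). Qed.

Lemma V_bdd_pr (A B : V) : Bdd (fun z : V => exists x y, x ∈ A /\ y ∈ B /\ z = pr x y).
Proof.
apply: (Bdd_image2 (P := fun x => x ∈ A) (Q := fun x => x ∈ B) (F := @pr V PreUniverse_V));
  try exact: V_bdd; by dfn.
Qed.

Definition adj (B a : V) : V := setV (fun z => z ∈ B \/ z = a).
Instance DefF2_adj : DefF2 adj.
Proof. by rewrite /adj; dfn. Qed.

Lemma in_adj B a z : z ∈ adj B a <-> z ∈ B \/ z = a.
Proof. by apply: in_setV; [dfn|apply: Bdd_or; [exact: V_bdd|exact: Bdd_one]]. Qed.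

(** Kuratowski finiteness in the sense of [V]. Only elements of [A] are adjoined, because no set [F]
    is closed under adjoining arbitrary elements: its union would contain all of [V]. *)
Record Fin (A : V) : Prop := { Fin_elim : forall F, emp ∈ F ->
  (forall B a, B ∈ F -> a ∈ A -> adj B a ∈ F) -> A ∈ F }.
Instance Def1_Fin : Def1 Fin.
Proof.
have D : Def1 (fun A => forall F, emp ∈ F ->
  (forall B a, B ∈ F -> a ∈ A -> adj B a ∈ F) -> A ∈ F) by dfn.
by apply: Def_ext D => -[u A] /=; split=> [H|[H]].
Qed.

Lemma emptyV (x : V) : (forall z, ~ z ∈ x) -> x = emp.
Proof. by move=> H; apply: V_ext => z; split=> [/H|/in_emp]. Qed.

Lemma Fin_emp : Fin emp.
Proof. by []. Qed.

Lemma Fin_adj A a : Fin A -> Fin (adj A a).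
Proof.
move=> FA; split=> F H0 HS.
have [G HG] : exists G : V, forall B, B ∈ G <-> B ∈ F /\ subset B A.
  by apply: V_sep; dfn.
apply: (HS); last by apply/in_adj; right.
suff : A ∈ G by move/HG => [].
apply: (Fin_elim FA); first by apply/HG; split=> //; apply/subsetV => z /in_emp.
move=> B b /HG [HB /subsetV HBA] Hb; apply/HG; split.
  by apply: HS => //; apply/in_adj; left.
by apply/subsetV => z /in_adj [/HBA|->].
Qed.

Lemma Fin_ind (P : V -> Prop) : Def1 P -> P emp ->
  (forall B a, Fin B -> P B -> P (adj B a)) -> forall A, Fin A -> P A.
Proof.
move=> DP P0 PS A FA.
have [G HG] : exists G : V, forall B, B ∈ G <-> (subset B A /\ Fin B) /\ P B.
  have D : Def1 (fun B : V => (subset B A /\ Fin B) /\ P B) by dfn.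
  by apply: (V_mk D); apply: (Bdd_sub (Bdd_powV A)) => B [[]].
suff : A ∈ G by move/HG => [].
apply: (Fin_elim FA).
  by apply/HG; split=> //; split; [apply/subsetV => z /in_emp|exact: Fin_emp].
move=> B a /HG [[/subsetV HB FB] PB] Ha; apply/HG; split; last exact: PS.
split; last exact: Fin_adj.
by apply/subsetV => z /in_adj [/HB|->].
Qed.

Lemma Fin_sub A B : Fin A -> (B ⊆ A) -> Fin B.
Proof.
move=> FA; move: A FA B.
apply: Fin_ind; first by dfn.
  by move=> B HB; rewrite (@emptyV B) => [z Hz|]; [exact: (in_emp (HB z Hz))|exact: Fin_emp].
move=> A a _ IH B HB.
have [C HC] : exists C : V, forall z, z ∈ C <-> z ∈ B /\ z <> a by apply: V_sep; dfn.
have FC : Fin C.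
  by apply: IH => z /HC [/HB /in_adj []].
case: (classic (a ∈ B)) => Ha.
  have -> : B = adj C a; last exact: Fin_adj.
  apply: V_ext => z; rewrite in_adj HC; split=> [Hz|[[]|->]] //.
  by case: (classic (z = a)) => H; [right|left].
have -> // : B = C.
apply: V_ext => z; rewrite HC; split=> [Hz|[]] //; split=> // E; by rewrite -E in Ha.
Qed.

Definition FinP (P : V -> Prop) : Prop := exists A, Fin A /\ forall x, P x -> x ∈ A.

Lemma FinP_set A : FinP (fun x => x ∈ A) -> Fin A.
Proof. by move=> [B [FB HB]]; exact: Fin_sub FB HB. Qed.

Lemma Fin_FinP A : Fin A -> FinP (fun x => x ∈ A).
Proof. by exists A. Qed.

Lemma FinP_sub (P Q : V -> Prop) : FinP Q -> (forall x, P x -> Q x) -> FinP P.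
Proof. by move=> [A [FA HA]] H; exists A; split=> // x /H /HA. Qed.

Lemma FinP_uniq (P : V -> Prop) : (forall x y, P x -> P y -> x = y) -> FinP P.
Proof.
move=> H; case: (classic (exists x, P x)) => [[x Hx]|Hn].
  exists (adj emp x); split; first exact: (Fin_adj _ Fin_emp).
  by move=> y Hy; apply/in_adj; right; exact: H.
by exists emp; split=> [|x Hx]; [exact: Fin_emp|case: Hn; exists x].
Qed.

Lemma FinP_or (P Q : V -> Prop) : FinP P -> FinP Q -> FinP (fun x => P x \/ Q x).
Proof.
move=> [A [FA HA]] [B [FB HB]].
suff [C [FC HC]] : exists C, Fin C /\ forall x, x ∈ A \/ x ∈ B -> x ∈ C.
  by exists C; split=> // x [/HA|/HB] H; apply: HC; auto.
move: A FA {HA}; apply: Fin_ind.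
- by dfn.
- by exists B; split=> // x [/in_emp|].
- move=> A a FA [C [FC HC]]; exists (adj C a); split; first exact: Fin_adj.
  by move=> x [/in_adj [H|->]|H]; apply/in_adj; auto.
Qed.

Lemma FinP_bigU (P : V -> Prop) (Q : V -> V -> Prop) : Def1 P -> Def2 Q -> FinP P ->
  (forall x, P x -> FinP (Q x)) -> FinP (fun y => exists x, P x /\ Q x y).
Proof.
move=> DP DQ [A [FA HA]] HQ.
suff : FinP (fun y => exists x, x ∈ A /\ P x /\ Q x y).
  by move/FinP_sub; apply=> y [x [H1 H2]]; exists x; split=> //; exact: HA.
move: A FA {HA}; apply: Fin_ind.
- by rewrite /FinP; dfn.
- by exists emp; split=> [|y [x [/in_emp]]] //; exact: Fin_emp.
- move=> B a FB IH.
  have Ha : FinP (fun y => P a /\ Q a y).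
    case: (classic (P a)) => [Pa|NP]; last by exists emp; split=> [|x []] //; exact: Fin_emp.
    by apply: FinP_sub (HQ a Pa) _ => y [].
  apply: FinP_sub (FinP_or IH Ha) _ => y [x [/in_adj [H1|->] H2]]; auto.
  by left; exists x.
Qed.

Lemma FinP_ex (P : V -> Prop) (Q : V -> V -> Prop) : Def1 P -> Def2 Q -> FinP P ->
  (forall x, P x -> forall y y', Q x y -> Q x y' -> y = y') -> FinP (fun y => exists x, P x /\ Q x y).
Proof. by move=> DP DQ HP H; apply: FinP_bigU => // x Hx; apply: FinP_uniq; exact: H. Qed.

Lemma adj_self n : adj n n = suc n.
Proof. by []. Qed.

Lemma Fin_nat n : is_nat n -> Fin n.
Proof.
move: n; apply: nat_ind; first exact: Fin_emp.
by move=> n _ /(Fin_adj n); rewrite adj_self.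
Qed.

Lemma FinP_Bdd (P : V -> Prop) : FinP P -> Bdd P.
Proof. by move=> [A [_ HA]]; exists A. Qed.

Lemma FinP_mk (P : V -> Prop) : FinP P -> Def (fun y : unit * V => P (snd y)) ->
  exists c, Fin c /\ forall w, w ∈ c <-> P w.
Proof.
move=> FP DP; have [c Hc] := V_mk DP (FinP_Bdd FP).
by exists c; split=> //; apply: FinP_set; apply: FinP_sub FP _ => z /Hc.
Qed.

(** Obtained from ∈-recursion on all of [V]: the clause tests whether its argument is empty or a
    successor, and the third alternative, with value [emp], only makes it total. *)
Lemma nat_recursion (a : V) (G : V -> V -> V) : DefF2 G ->
  exists q : V -> V, DefF1 q /\ q emp = a /\ forall b, q (suc b) = G b (q b).
Proof.
move=> DG.
pose (st := fun u f v : V => (is_empty u /\ v = a) \/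
  (exists b w, is_succ b u /\ app f b w /\ v = G b w) \/
  (~ is_empty u /\ ~ (exists b, is_succ b u) /\ v = emp)).
have Dst : Def3 st by rewrite /st; dfn.
have Hfun u f g v v' : is_function f -> is_function g ->
  (forall z, z ∈ u -> exists w, app f z w /\ app g z w) -> st u f v -> st u g v' -> v = v'.
  move=> [_ Ff] [_ Fg] Hfg.
  case=> [[E ->]|[[b [w [S [Hw ->]]]]|[N1 [N2 ->]]]];
    case=> [[E' ->]|[[b' [w' [S' [Hw' ->]]]]|[N1' [N2' ->]]]] //.
  - by move/is_emptyE: E => E; move/is_succE: S' => S'; case: (@suc_neq_emp V _ b'); rewrite -S'.
  - by move/is_emptyE: E' => E; move/is_succE: S => S; case: (@suc_neq_emp V _ b); rewrite -S.
  - have Eb : b = b' by apply: suc_inj; move/is_succE: S => <-; move/is_succE: S' => <-.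
    subst b'; have [|w0 [H1 H2]] := Hfg b; first by apply/(proj2 S); right.
    by rewrite (Ff _ _ _ Hw H1) (Fg _ _ _ Hw' H2).
  - by case: N2'; exists b.
  - by case: N2; exists b'.
have Htot u f : is_function f -> (forall z, z ∈ u -> exists w, app f z w) -> exists v, st u f v.
  move=> _ Hf; case: (classic (is_empty u)) => H1; first by exists a; left.
  case: (classic (exists b, is_succ b u)) => H2; last by exists emp; right; right.
  case: H2 => b Hb; have [|w Hw] := Hf b; first by apply/(proj2 Hb); right.
  by exists (G b w); right; left; exists b, w.
have U x y y' : by_recursion st x y -> by_recursion st x y' -> y = y'.
  exact: (recursion_unique Hfun).
have T x : exists v, by_recursion st x v by exact: (recursion_total Htot Hfun).
pose (q := fun x : V => iota (by_recursion st x)).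
have Hq x : by_recursion st x (q x) by refine (iota_spec (T x) _) => y z Hy Hz; exact: U Hz Hy.
have Hq' x y : by_recursion st x y -> y = q x by move=> Hy; exact: U Hy (Hq x).
exists q; split; last split.
- have D : Def2 (by_recursion st) by rewrite /by_recursion; dfn.
  by rewrite /q; dfn.
- have [f [Ff [Cf [Rf [[_ ->] //|[[b [w [/is_succE E _]]]|[[]]]]]]]] := recursion_inv (Hq emp).
    by case: (suc_neq_emp (esym E)).
  exact/is_emptyE.
- move=> b; have [f [Ff [Cf [Rf [[/is_emptyE E _]|[[b' [w [/is_succE E [Hw ->]]]]|[_ [N _]]]]]]]] := recursion_inv (Hq (suc b)).
  + by case: (suc_neq_emp E).
  + by have Eb := V_suc_inj E; subst b'; rewrite (Hq' _ _ (Rf _ _ Hw)).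
  + by case: N; exists b; apply/is_succE.
Qed.

(** * Dense linear orders given by definable relations *)

Record linear (X : V) (le : V -> V -> Prop) : Prop := {
  lin_def : Def2 le;
  lin_dom : forall x y, le x y -> x ∈ X /\ y ∈ X;
  lin_refl : forall x, x ∈ X -> le x x;
  lin_trans : forall x y z, le x y -> le y z -> le x z;
  lin_anti : forall x y, le x y -> le y x -> x = y;
  lin_total : forall x y, x ∈ X -> y ∈ X -> le x y \/ le y x }.

Lemma linear_flip X le : linear X le -> linear X (fun x y => le y x).
Proof.
move=> [D H1 H2 H3 H4 H5]; split=> //.
- by dfn.
- by move=> x y /H1 [].
- by move=> x y z H6 H7; exact: H3 H7 H6.
- by move=> x y H6 H7; exact: H4.
- by move=> x y Hx Hy; exact: H5.
Qed.

Lemma linear_max X le A : linear X le -> Fin A -> (A ⊆ X) ->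
  (forall z, ~ z ∈ A) \/ exists m, m ∈ A /\ forall z, z ∈ A -> le z m.
Proof.
move=> [D H1 H2 H3 H4 H5]; move: A.
apply: Fin_ind; first by dfn.
  by move=> _; left=> z /in_emp.
move=> B a FB IH HX; right.
have Xa : a ∈ X by apply: HX; apply/in_adj; right.
have [z Hz|HB|[m [Hm HB]]] := IH; first by apply: HX; apply/in_adj; left.
  exists a; split; first by apply/in_adj; right.
  by move=> z /in_adj [/HB|->] //; exact: H2.
have Xm : m ∈ X by apply: HX; apply/in_adj; left.
case: (H5 a m Xa Xm) => Ham.
  by exists m; split=> [|z /in_adj [/HB|->] //]; apply/in_adj; left.
exists a; split; first by apply/in_adj; right.
by move=> z /in_adj [/HB Hz|->]; [exact: H3 Hz Ham|exact: H2].
Qed.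

Record dense_order (X : V) (le : V -> V -> Prop) : Prop := {
  do_linear :> linear X le;
  do_point : exists x, x ∈ X;
  do_dense : forall x y, le x y -> x <> y -> exists z, le x z /\ x <> z /\ le z y /\ z <> y;
  do_left : forall x, x ∈ X -> exists z, le z x /\ z <> x;
  do_right : forall x, x ∈ X -> exists z, le x z /\ x <> z }.

Definition slt (le : V -> V -> Prop) x y := le x y /\ x <> y.

Lemma slt_trans X le x y z : linear X le -> slt le x y -> slt le y z -> slt le x z.
Proof.
move=> L [H1 H2] [H3 H4]; split; first exact: (lin_trans L H1 H3).
by move=> E; subst z; apply: H2; exact: (lin_anti L).
Qed.

Lemma slt_not X le x y : linear X le -> slt le x y -> ~ le y x.
Proof. by move=> L [H1 H2] H3; apply: H2; exact: (lin_anti L). Qed.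

Lemma not_le X le x y : linear X le -> x ∈ X -> y ∈ X -> ~ le y x -> slt le x y.
Proof.
move=> L Hx Hy H; case: (lin_total L Hx Hy) => // H1; split=> // E; subst y.
by apply: H; exact: (lin_refl L).
Qed.

Lemma le_slt X le x y z : linear X le -> le x y -> slt le y z -> slt le x z.
Proof.
move=> L H1 [H3 H4]; split; first exact: (lin_trans L H1 H3).
by move=> E; subst z; apply: H4; exact: (lin_anti L).
Qed.

Lemma slt_le X le x y z : linear X le -> slt le x y -> le y z -> slt le x z.
Proof.
move=> L [H1 H2] H3; split; first exact: (lin_trans L H1 H3).
by move=> E; subst z; apply: H2; exact: (lin_anti L).
Qed.

(** It is enough to separate the maximum of [Lo] from the minimum of [Hi]; the absence of endpoints
    covers the cases where one of them is missing. Two points are produced so that at least one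
    differs from any prescribed point. *)
Lemma gap X le Lo Hi : dense_order X le -> Fin Lo -> Fin Hi ->
  (Lo ⊆ X) -> (Hi ⊆ X) ->
  (forall l h, l ∈ Lo -> h ∈ Hi -> slt le l h) ->
  exists e1 e2, slt le e1 e2 /\ (forall l, l ∈ Lo -> slt le l e1) /\ (forall h, h ∈ Hi -> slt le e2 h).
Proof.
move=> DO FL FH XL XH HLH; have L := do_linear DO.
have between x y : slt le x y -> exists e1 e2, slt le x e1 /\ slt le e1 e2 /\ slt le e2 y.
  move=> [H1 H2]; have [z [H3 [H4 [H5 H6]]]] := do_dense DO H1 H2.
  have [w [H7 [H8 [H9 H10]]]] := do_dense DO H3 H4.
  by exists w, z.
have above x : x ∈ X -> exists z, slt le x z by move=> /(do_right DO).
have below x : x ∈ X -> exists z, slt le z x by move=> /(do_left DO).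
have [E1|[m [Hm Hmax]]] := linear_max L FL XL;
  have [E2|[k [Hk Hmin]]] := linear_max (linear_flip L) FH XH.
- have [x /above [y Hxy]] := do_point DO.
  by exists x, y; split=> //; split=> [l /E1|h /E2].
- have [y Hy] := below k (XH _ Hk).
  have [e1 [e2 [H1 [H2 H3]]]] := between _ _ Hy.
  exists e1, e2; split=> //; split=> [l /E1 //|h /Hmin]; exact: (slt_le L).
- have [y Hy] := above m (XL _ Hm).
  have [e1 [e2 [H1 [H2 H3]]]] := between _ _ Hy.
  exists e1, e2; split=> //; split=> [l /Hmax Hl|h /E2 //]; exact: (le_slt L Hl).
- have [e1 [e2 [H1 [H2 H3]]]] := between _ _ (HLH m k Hm Hk).
  exists e1, e2; split=> //; split=> [l /Hmax Hl|h /Hmin]; [exact: (le_slt L Hl)|exact: (slt_le L)].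
Qed.

(** Asking for an equivalence of the two orders makes [p] a function and injective: two images of
    one point are comparable in both directions, hence equal by antisymmetry. *)
Definition piso (X1 : V) (le1 : V -> V -> Prop) (X2 : V) (le2 : V -> V -> Prop) (p : V) : Prop :=
  (forall z, z ∈ p -> exists d e, d ∈ X1 /\ e ∈ X2 /\ z = pr d e) /\
  (forall d e d' e', pr d e ∈ p -> pr d' e' ∈ p -> (le1 d d' <-> le2 e e')).

Definition conv (p : V) : V := setV (fun z => exists d e, pr d e ∈ p /\ z = pr e d).
Instance DefF1_conv : DefF1 conv.
Proof. by rewrite /conv; dfn. Qed.

Lemma FinP_pairs (p : V) (G : V -> V -> V) : Fin p -> DefF2 G ->
  FinP (fun z => exists d e, pr d e ∈ p /\ z = G d e).
Proof.
move=> Fp DG.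
have H : FinP (fun z => exists x, x ∈ p /\ exists d e, x = pr d e /\ z = G d e).
  apply: FinP_ex; [by dfn|by dfn|exact: Fin_FinP|].
  by move=> x _ y y' [d [e [-> ->]]] [d' [e' [/pr_inj [-> ->] ->]]].
by apply: FinP_sub H _ => z [d [e [H1 ->]]]; exists (pr d e); split=> //; exists d, e.
Qed.

Lemma FinP_range (p : V) : Fin p -> FinP (fun e => exists d, pr d e ∈ p).
Proof.
move=> Fp; have D : DefF2 (fun _ e : V => e) by dfn.
by apply: FinP_sub (FinP_pairs Fp D) _ => e [d H]; exists d, e.
Qed.

Lemma conv_FinP p : Fin p -> FinP (fun z => exists d e, pr d e ∈ p /\ z = pr e d).
Proof. by move=> Fp; apply: FinP_pairs => //; dfn. Qed.

Lemma in_convE p z : Fin p -> z ∈ conv p <-> exists d e, pr d e ∈ p /\ z = pr e d.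
Proof. by move=> Fp; apply: in_setV; [dfn|exact/FinP_Bdd/conv_FinP]. Qed.

Lemma in_conv p d e : Fin p -> pr e d ∈ conv p <-> pr d e ∈ p.
Proof.
move=> Fp; rewrite in_convE //.
by split=> [[d' [e' [H /pr_inj [-> ->]]]]|H] //; exists d, e.
Qed.

Lemma in_conv_inv p z : Fin p -> z ∈ conv p -> exists d e, pr d e ∈ p /\ z = pr e d.
Proof. by move=> Fp; rewrite in_convE. Qed.

(** * Extending finite partial isomorphisms *)

Section PartialIso.
Context (X1 X2 : V) (le1 le2 : V -> V -> Prop).
Context (DO1 : dense_order X1 le1) (DO2 : dense_order X2 le2).
Let L1 := do_linear DO1.
Let L2 := do_linear DO2.

Definition PI p := Fin p /\ piso X1 le1 X2 le2 p.

Lemma PI_dom p d e : PI p -> pr d e ∈ p -> d ∈ X1 /\ e ∈ X2.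
Proof. by move=> [_ [H _]] /H [d' [e' [H1 [H2 /pr_inj [-> ->]]]]]. Qed.

Lemma piso_fun p d e e' : piso X1 le1 X2 le2 p -> pr d e ∈ p -> pr d e' ∈ p -> e = e'.
Proof.
move=> [H0 H] H1 H2; have [d0 [e0 [Xd [_ /pr_inj [Ed _]]]]] := H0 _ H1; subst d0.
by apply: (lin_anti L2); apply/(H _ _ _ _ H1 H2) || apply/(H _ _ _ _ H2 H1); exact: (lin_refl L1).
Qed.

Lemma piso_inj p d d' e : piso X1 le1 X2 le2 p -> pr d e ∈ p -> pr d' e ∈ p -> d = d'.
Proof.
move=> [H0 H] H1 H2; have [d0 [e0 [_ [Xe /pr_inj [_ Ee]]]]] := H0 _ H1; subst e0.
by apply: (lin_anti L1); apply/(H _ _ _ _ H1 H2) || apply/(H _ _ _ _ H2 H1); exact: (lin_refl L2).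
Qed.

Lemma piso_slt p d e d' e' : piso X1 le1 X2 le2 p -> pr d e ∈ p -> pr d' e' ∈ p ->
  slt le1 d d' -> slt le2 e e'.
Proof.
move=> Hp H1 H2 [H3 H4]; split; first exact/(proj2 Hp _ _ _ _ H1 H2).
by move=> E; subst e'; apply: H4; exact: piso_inj Hp H1 H2.
Qed.

Lemma PI_emp : PI emp.
Proof. by split; [exact: Fin_emp|split=> [z /in_emp|d e d' e' /in_emp]]. Qed.

(** A new image must lie above the images [Lo] of the points below [d] and below the images [Hi] of
    those above it. Both points of the gap qualify, and this freedom later serves to move a point
    off itself. *)
Lemma one_point p d : PI p -> d ∈ X1 -> (forall e, ~ pr d e ∈ p) ->
  exists e1 e2, slt le2 e1 e2 /\ PI (adj p (pr d e1)) /\ PI (adj p (pr d e2)).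
Proof.
move=> [Fp Hp] Xd Nd; have D1 := lin_def L1; have D2 := lin_def L2.
have HF (Q : V -> Prop) : Def1 Q ->
  exists A, Fin A /\ forall e, e ∈ A <-> exists d', pr d' e ∈ p /\ Q d'.
  move=> DQ; apply: FinP_mk; last by dfn.
  by apply: FinP_sub (FinP_range Fp) _ => e [d' [H _]]; exists d'.
have [Lo [FLo HLo]] := HF (fun d' => slt le1 d' d) ltac:(rewrite /slt; dfn).
have [Hi [FHi HHi]] := HF (fun d' => slt le1 d d') ltac:(rewrite /slt; dfn).
have [|||e1 [e2 [H12 [HL HH]]]] := gap DO2 FLo FHi.
- by move=> l /HLo [d' [H _]]; case: (PI_dom (conj Fp Hp) H).
- by move=> l /HHi [d' [H _]]; case: (PI_dom (conj Fp Hp) H).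
- move=> l h /HLo [d' [H1 H2]] /HHi [d'' [H3 H4]].
  by apply: (piso_slt Hp H1 H3); exact: (slt_trans L1 H2 H4).
have good e : (forall l, l ∈ Lo -> slt le2 l e) -> (forall h, h ∈ Hi -> slt le2 e h) -> e ∈ X2 ->
  PI (adj p (pr d e)).
  move=> HL' HH' Xe; split; first exact: Fin_adj.
  split=> [z /in_adj [/(proj1 Hp) //|->]|]; first by exists d, e.
  have cmp d' e' : pr d' e' ∈ p -> (le1 d d' <-> le2 e e') /\ (le1 d' d <-> le2 e' e).
    move=> H; have [Xd' Xe'] := PI_dom (conj Fp Hp) H.
    have Nd' : d <> d' by move=> E; subst d'; exact: (Nd e').
    case: (lin_total L1 Xd Xd') => Hd.
      have S1 : slt le1 d d' by [].
      have S2 : slt le2 e e' by apply: HH'; apply/HHi; exists d'.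
      have N1 := slt_not L1 S1; have N2 := slt_not L2 S2.
      by split; split=> // _; case: S2.
    have S1 : slt le1 d' d by split=> // E; apply: Nd'.
    have S2 : slt le2 e' e by apply: HL'; apply/HLo; exists d'.
    have N1 := slt_not L1 S1; have N2 := slt_not L2 S2.
    by split; split=> // _; case: S2.
  move=> a b a' b' /in_adj [H1|/pr_inj [-> ->]] /in_adj [H2|/pr_inj [-> ->]].
  - exact: (proj2 Hp).
  - exact: (proj2 (cmp _ _ H1)).
  - exact: (proj1 (cmp _ _ H2)).
  - by split=> _; [exact: (lin_refl L2)|exact: (lin_refl L1)].
have [X1' X2'] := lin_dom L2 (proj1 H12).
exists e1, e2; split=> //; split; apply: good => //.
- by move=> h /HH; exact: (slt_trans L2).
- by move=> l /HL H; exact: (slt_trans L2 H).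
Qed.

Instance Def1_PI : Def1 PI.
Proof. by have D1 := lin_def L1; have D2 := lin_def L2; rewrite /PI /piso; dfn. Qed.

Lemma PI_extend p A : PI p -> Fin A -> (A ⊆ X1) ->
  exists q, PI q /\ (p ⊆ q) /\ forall d, d ∈ A -> exists e, pr d e ∈ q.
Proof.
move=> Hp; move: A.
apply: Fin_ind.
- by dfn.
- by move=> _; exists p; split=> //; split=> // d /in_emp.
- move=> B a FB IH HX; have [d Hd|q [Pq [Hpq Hq]]] := IH; first by apply: HX; apply/in_adj; left.
  case: (classic (exists e, pr a e ∈ q)) => [[e He]|Na].
    by exists q; split=> //; split=> // d /in_adj [/Hq|->] //; exists e.
  have Xa : a ∈ X1 by apply: HX; apply/in_adj; right.
  have [|e [_ [_ [Pe _]]]] := one_point Pq Xa; first by move=> e He; apply: Na; exists e.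
  exists (adj q (pr a e)); split=> //; split=> [z /Hpq H|d /in_adj [/Hq [e' H]|->]].
  + by apply/in_adj; left.
  + by exists e'; apply/in_adj; left.
  + by exists e; apply/in_adj; right.
Qed.
End PartialIso.
#[global] Arguments PI X1 X2 le1 le2 p : clear implicits.

Lemma PI_conv X1 X2 le1 le2 p : PI X1 X2 le1 le2 p -> PI X2 X1 le2 le1 (conv p).
Proof.
move=> [Fp Hp]; split.
  apply: FinP_set; apply: FinP_sub (conv_FinP Fp) _ => z; exact: in_conv_inv.
split.
  move=> z /(in_conv_inv Fp) [d [e [H ->]]]; have [H1 H2] := PI_dom (conj Fp Hp) H.
  by exists e, d.
move=> d e d' e' /(in_conv _ _ Fp) H1 /(in_conv _ _ Fp) H2.
by rewrite (proj2 Hp _ _ _ _ H1 H2).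
Qed.

Lemma conv_conv X1 X2 le1 le2 p : PI X1 X2 le1 le2 p -> conv (conv p) = p.
Proof.
move=> Hp; have Hc := PI_conv Hp; apply: V_ext => z.
split=> [/(in_conv_inv (proj1 Hc)) [d [e [/(in_conv _ _ (proj1 Hp)) H ->]]] //|Hz].
have [d [e [_ [_ E]]]] := proj1 (proj2 Hp) _ Hz; subst z.
by apply/(in_conv _ _ (proj1 Hc))/(in_conv _ _ (proj1 Hp)).
Qed.

Lemma PI_extend_ran X1 X2 le1 le2 p A : dense_order X1 le1 -> dense_order X2 le2 ->
  PI X1 X2 le1 le2 p -> Fin A -> (A ⊆ X2) ->
  exists q, PI X1 X2 le1 le2 q /\ (p ⊆ q) /\ forall e, e ∈ A -> exists d, pr d e ∈ q.
Proof.
move=> DO1 DO2 Hp FA XA; have Hc := PI_conv Hp.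
have [q [Pq [Hpq Hq]]] := PI_extend DO2 DO1 Hc FA XA.
exists (conv q); split; first exact: PI_conv Pq; split.
  move=> z Hz; have [d [e [_ [_ E]]]] := proj1 (proj2 Hp) _ Hz; subst z.
  by apply/(in_conv _ _ (proj1 Pq)); apply: Hpq; apply/(in_conv _ _ (proj1 Hp)).
by move=> e /Hq [d Hd]; exists d; apply/(in_conv _ _ (proj1 Pq)).
Qed.

(* [E n] is the [n]-th of a sequence of finite sets with dense union; the last
   clause says that the order has enough cuts for a partial automorphism [g]
   defined on that union to extend to all of [X]. *)
Definition staged (X : V) (le : V -> V -> Prop) (E : V -> V) : Prop :=
  (forall n, is_nat n -> Fin (E n) /\ forall x, x ∈ E n -> x ∈ X) /\
  (forall x y, slt le x y -> exists n z, is_nat n /\ z ∈ E n /\ slt le x z /\ slt le z y) /\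
  (forall g, piso X le X le g ->
    (forall n x, is_nat n -> x ∈ E n -> (exists e, pr x e ∈ g) /\ (exists d, pr d x ∈ g)) ->
    forall x, x ∈ X -> exists y, y ∈ X /\ forall d e, pr d e ∈ g -> (le d x <-> le e y)).

Record separable_order (X : V) (le : V -> V -> Prop) : Prop := {
  so_dense :> dense_order X le;
  so_stage : exists E, DefF1 E /\ staged X le E }.

(** * Homogeneity: finite partial automorphisms extend to automorphisms *)

Section Homogeneity.
Context (X : V) (le : V -> V -> Prop) (SO : separable_order X le).
Let DO := so_dense SO.
Let L := do_linear DO.
Notation iso := (piso X le X le).
Notation fiso := (PI X X le le).

Definition bijective (g : V) : Prop :=
  (forall x, x ∈ X -> exists y, pr x y ∈ g) /\ (forall y, y ∈ X -> exists x, pr x y ∈ g).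

Context (E : V -> V) (DE : DefF1 E) (HE : staged X le E).

Definition refines (s n t : V) : Prop :=
  fiso t /\ (s ⊆ t) /\
  forall x, x ∈ E n -> (exists e, pr x e ∈ t) /\ (exists d, pr d x ∈ t).

Lemma refines_exists s n : fiso s -> is_nat n -> exists t, refines s n t.
Proof.
move=> Ps Hn; have [FE XE] := proj1 HE n Hn.
have [t [Pt [Hst Ht]]] := PI_extend DO DO Ps FE XE.
have [u [Pu [Htu Hu]]] := PI_extend_ran DO DO Pt FE XE.
exists u; split=> //; split=> [z /Hst /Htu //|x Hx]; split; last exact: Hu.
by have [e He] := Ht x Hx; exists e; exact: Htu.
Qed.

Lemma Bdd_fiso : Bdd fiso.
Proof.
have [a Ha] := V_bdd_pr X X.
apply: (Bdd_sub (Bdd_powV a)) => p [_ [Hp _]]; apply/subsetV => z /Hp [d [e [H1 [H2 ->]]]].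
by apply: Ha; exists d, e.
Qed.

(** Recursion along the natural numbers of [V] needs a definable step, so the refinement is selected
    by the axiom of choice of [V]. Tagging each refinement with [pr s n] makes the sets of
    candidates disjoint, and the selector [c] then enters the definition of [ch] as a parameter. *)
Lemma choose_refinement : exists ch : V -> V -> V, DefF2 ch /\
  forall s n, fiso s -> is_nat n -> refines s n (ch s n).
Proof.
have D := lin_def L; have DP := Def1_PI DO DO.
have DR : Def3 refines by rewrite /refines; dfn.
have BP := Bdd_fiso.
pose (fam := fun w => exists s n, fiso s /\ is_nat n /\
   forall z, z ∈ w <-> exists t, refines s n t /\ z = pr (pr s n) t).
have Dfam : Def1 fam by rewrite /fam; dfn.
have Hfam s n : fiso s -> is_nat n ->
    exists w, forall z, z ∈ w <-> exists t, refines s n t /\ z = pr (pr s n) t.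
  move=> Ps Hn; apply: V_mk; first by dfn.
  have DRs : Def1 (refines s n) by dfn.
  apply: (Bdd_ex (P := refines s n)); try by dfn.
    by apply: (Bdd_sub BP) => t [].
  by move=> t _ y y' -> ->.
have [|F HF] := V_mk Dfam.
  apply: (Bdd_sub (Q := fun w => exists s, fiso s /\ exists n, is_nat n /\
     forall z, z ∈ w <-> exists t, refines s n t /\ z = pr (pr s n) t)).
    apply: (Bdd_bigU BP); try by dfn.
    move=> s _; apply: (Bdd_ex Bdd_nat); try by dfn.
    by move=> n _ y y' H1 H2; apply: V_ext => z; rewrite H1 H2.
  by move=> w [s [n [H1 [H2 H3]]]]; exists s; split=> //; exists n.
have [||c Hc] := zfc_choice VZ (x := F).
- move=> y /HF [s [n [Ps [Hn Hy]]]]; have [t Ht] := refines_exists Ps Hn.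
  by exists (pr (pr s n) t); apply/Hy; exists t.
- move=> y y' z /HF [s [n [Ps [Hn Hy]]]] /HF [s' [n' [Ps' [Hn' Hy']]]] /Hy [t [_ ->]] /Hy'.
  move=> [t' [_ /pr_inj [/pr_inj [E1 E2] _]]]; subst s' n'.
  by apply: V_ext => w; rewrite Hy Hy'.
exists (fun s n => iota (fun t => refines s n t /\ pr (pr s n) t ∈ c)); split.
  by dfn.
move=> s n Ps Hn.
have [w Hw] := Hfam s n Ps Hn.
have Fw : w ∈ F by apply/HF; exists s, n.
have [z [[Hz Hzc] Uz]] := Hc w Fw.
move/Hw: Hz => [t [Rt E1]]; subst z.
pose (Q := fun t => refines s n t /\ pr (pr s n) t ∈ c).
cut (Q (iota Q)); first by case.
refine (iota_spec _ _); first by exists t.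
have U t' : refines s n t' -> pr (pr s n) t' ∈ c -> t' = t.
  move=> R1 C1; have /pr_inj [] // : pr (pr s n) t = pr (pr s n) t'.
  by apply: Uz; split=> //; apply/Hw; exists t'.
by move=> t1 t2 [R1 C1] [R2 C2]; rewrite (U _ R1 C1) (U _ R2 C2).
Qed.

Lemma nat_trichotomy (m n : V) : is_nat m -> is_nat n -> m ∈ n \/ m = n \/ n ∈ m.
Proof. by move=> Hm Hn; apply: ordinal_trichotomy; exact: nat_ordinal. Qed.

(* Cantor's back-and-forth: the union of a chain of finite partial
   automorphisms absorbing the finite sets [E n]. *)
Lemma back_and_forth s : fiso s -> exists g, iso g /\ (s ⊆ g) /\
  forall n x, is_nat n -> x ∈ E n -> (exists e, pr x e ∈ g) /\ (exists d, pr d x ∈ g).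
Proof.
move=> Ps; have [ch [Dch Hch]] := choose_refinement.
have [q [Dq [q0 qS]]] := @nat_recursion s (fun n t => ch t n) ltac:(dfn).
have D := lin_def L; have DP := Def1_PI DO DO.
have Pq n : is_nat n -> fiso (q n).
  move: n; apply: nat_ind; [by dfn|by rewrite q0|].
  by move=> n Hn Pn; rewrite qS; case: (Hch _ _ Pn Hn).
have Hq n : is_nat n -> refines (q n) n (q (suc n)) by move=> Hn; rewrite qS; exact: (Hch _ _ (Pq n Hn) Hn).
have mono n : is_nat n -> forall m z, m ∈ n -> z ∈ q m -> z ∈ q n.
  move: n; apply: nat_ind; first by dfn.
    by move=> m z /in_emp.
  move=> n Hn IH m z /in_suc Hm Hz; have [_ [Hsub _]] := Hq n Hn; apply: Hsub.
  by case: Hm Hz => [Hm Hz|-> //]; exact: IH Hm Hz.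
have Dg : Def1 (fun z => exists n, is_nat n /\ z ∈ q n) by dfn.
have [|g Hg] := V_mk Dg; first by apply: (Bdd_bigU Bdd_nat); try (by dfn); move=> n _; exact: V_bdd.
have two z z' : z ∈ g -> z' ∈ g -> exists n, is_nat n /\ z ∈ q n /\ z' ∈ q n.
  move=> /Hg [n [Hn Hz]] /Hg [m [Hm Hz']].
  have [H|[H|H]] := nat_trichotomy Hn Hm.
  - by exists m; split=> //; split=> //; exact: mono H Hz.
  - by subst m; exists n.
  - by exists n; split=> //; split=> //; exact: mono H Hz'.
exists g; split; [split|split].
- by move=> z /Hg [n [Hn Hz]]; case: (Pq n Hn) => _ [H _]; exact: H.
- move=> d e d' e' H1 H2; have [n [Hn [H3 H4]]] := two _ _ H1 H2.
  by case: (Pq n Hn) => _ [_ H]; exact: H.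
- by move=> z Hz; apply/Hg; exists emp; rewrite q0; split=> //; exact: is_nat_emp.
- move=> n x Hn Hx; have [_ [_ H]] := Hq n Hn; have [[e He] [d Hd]] := H x Hx.
  by split; [exists e|exists d]; apply/Hg; exists (suc n); split=> //; exact: is_nat_suc.
Qed.

Lemma piso_flip g : iso g -> exists h, iso h /\ forall d e, pr d e ∈ h <-> pr e d ∈ g.
Proof.
move=> [H1 H2].
have D : Def1 (fun z => exists d e, pr e d ∈ g /\ z = pr d e) by dfn.
have [|h Hh] := V_mk D.
  apply: (Bdd_sub (Q := fun z => exists x, x ∈ g /\ exists d e, x = pr e d /\ z = pr d e)).
    apply: (Bdd_ex (V_bdd g)); try by dfn.
    by move=> x _ y y' [d [e [-> ->]]] [d' [e' [/pr_inj [-> ->] ->]]].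
  by move=> z [d [e [H ->]]]; exists (pr e d); split=> //; exists d, e.
have Hh' d e : pr d e ∈ h <-> pr e d ∈ g.
  by rewrite Hh; split=> [[d' [e' [H /pr_inj [-> ->]]]] //|H]; exists d, e.
exists h; split=> //; split.
  move=> z /Hh [d [e [/H1 [d' [e' [A [B /pr_inj [-> ->]]]]] ->]]].
  by exists e', d'.
by move=> d e d' e' /Hh' A /Hh' B; rewrite (H2 _ _ _ _ A B).
Qed.

(** The automorphism [g] of back-and-forth is known to be defined and onto only on the stages. Its
    extension [k] pairs [x] with [y] when they determine corresponding cuts of [g]; the last clause
    of [staged], applied to [g] and to its inverse [h], makes [k] total and onto. *)
Lemma homogeneous_staged s : fiso s -> exists g, iso g /\ (s ⊆ g) /\ bijective g.
Proof.
move=> Ps; have [g [Ig [Hsg Hg]]] := back_and_forth Ps.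
have D := lin_def L; case: (HE) => _ [Edense Efill].
have [h [Ih Hh]] := piso_flip Ig.
pose (R := fun x y => x ∈ X /\ y ∈ X /\ forall d e, pr d e ∈ g -> (le d x <-> le e y)).
have DR : Def1 (fun z => exists x y, R x y /\ z = pr x y) by rewrite /R; dfn.
have [|k Hk] := V_mk DR.
  apply: (Bdd_sub (V_bdd_pr X X)) => z [x [y [[H1 [H2 _]] ->]]].
  by exists x, y.
have Hk' x y : pr x y ∈ k <-> R x y.
  by rewrite Hk; split=> [[x' [y' [H /pr_inj [-> ->]]]] //|H]; exists x, y.
exists k; split; [split|split; [|split]].
- by move=> z /Hk [x [y [[Hx [Hy _]] ->]]]; exists x, y.
- move=> x y x' y' /Hk' [Xx [Xy Hxy]] /Hk' [Xx' [Xy' Hxy']]; split=> Hle; apply: NNPP => N.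
    (* The stage point [e] lies strictly between [y'] and [y]. Its preimage [d] is below [x], hence
       below [x'], and this puts [e] below [y'], a contradiction. The other direction is the mirror
       image. *)
    have [n [e [Hn [He [S1 S2]]]]] := Edense _ _ (not_le L Xy' Xy N).
    have [_ [d Hd]] := Hg n e Hn He.
    apply: (slt_not L S1); apply/(Hxy' _ _ Hd); apply: (lin_trans L) Hle; apply/(Hxy _ _ Hd).
    exact: (proj1 S2).
  have [n [d [Hn [He [S1 S2]]]]] := Edense _ _ (not_le L Xx' Xx N).
  have [[e Hd] _] := Hg n d Hn He.
  apply: (slt_not L S1); apply/(Hxy' _ _ Hd); apply: (lin_trans L) Hle; apply/(Hxy _ _ Hd).
  exact: (proj1 S2).
- move=> z /Hsg Hz; have [d [e [Xd [Xe Ez]]]] := proj1 Ig _ Hz; subst z; apply/Hk'.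
  by split=> //; split=> // d' e' H; exact: (proj2 Ig).
- by move=> x Xx; have [y [Xy Hy]] := Efill g Ig Hg x Xx; exists y; apply/Hk'.
- move=> y Xy; have [|x [Xx Hx]] := Efill h Ih _ y Xy.
    move=> n x Hn Hx; have [[e He] [d Hd]] := Hg n x Hn Hx.
    by split; [exists d|exists e]; apply/Hh.
  exists x; apply/Hk'; split=> //; split=> // d e H.
  by rewrite (Hx e d) //; apply/Hh.
Qed.
End Homogeneity.

Lemma homogeneous X le s : separable_order X le -> PI X X le le s ->
  exists g, piso X le X le g /\ (s ⊆ g) /\ bijective X g.
Proof.
move=> SO; have [E [DE HE]] := so_stage SO; exact: (homogeneous_staged SO DE HE).
Qed.

(** * The back-and-forth system *)

(* What the argument needs to know about [Vstar X] and the automorphism group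
   [smG] of an order on its atoms; [pt g] is the permutation of [X] induced by
   [g]. *)
Record symmodel := {
  sm :> structure;
  sm_universe : Universe sm;
  smX : V;
  smle : V -> V -> Prop;
  sm_order : separable_order smX smle;
  atm : V -> sm;
  atm_def : DefF1 atm;
  atm_atom : forall d, d ∈ smX -> atom (atm d);
  atm_surj : forall a, atom a -> exists d, d ∈ smX /\ a = atm d;
  atm_inj : forall d e, d ∈ smX -> e ∈ smX -> atm d = atm e -> d = e;
  smG : sm -> Prop;
  smG_def : Def1 smG;
  pt : sm -> V -> V;
  pt_def : DefF2 pt;
  pt_dom : forall g d, smG g -> d ∈ smX -> pt g d ∈ smX;
  pt_atm : forall g d, smG g -> d ∈ smX -> ac g (atm d) = atm (pt g d);
  pt_le : forall g d e, smG g -> d ∈ smX -> e ∈ smX -> (smle d e <-> smle (pt g d) (pt g e));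
  smG_mem : forall g w x, smG g -> w ∈ ac g x <-> exists z, z ∈ x /\ w = ac g z;
  smG_atom : forall g x, smG g -> atom (ac g x) <-> atom x;
  smG_inv : forall g, smG g -> exists h, smG h /\ (forall x, ac h (ac g x) = x) /\ (forall x, ac g (ac h x) = x);
  smG_comp : forall f g, smG f -> smG g -> exists k, smG k /\ forall x, ac k x = ac g (ac f x);
  smG_homog : forall s, PI smX smX smle smle s ->
    exists g, smG g /\ forall d e, pr d e ∈ s -> pt g d = e }.
#[global] Existing Instance sm_universe.
#[global] Existing Instance atm_def.
#[global] Existing Instance smG_def.
#[global] Existing Instance pt_def.

(** * Supports and hereditarily symmetric elements *)

Section Model.
Context (A : symmodel).
Implicit Types g h k x y z : A.

Lemma M_ext x y : is_set x -> is_set y -> (forall z, z ∈ x <-> z ∈ y) -> x = y.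
Proof. exact: u_ext. Qed.

Lemma smG_eq g x y : smG g -> is_set x -> is_set y ->
  (forall w, w ∈ y <-> exists z, z ∈ x /\ w = ac g z) -> ac g x = y.
Proof.
move=> Gg Sx Sy H; apply: M_ext => //; first by move/(smG_atom _ Gg).
by move=> w; rewrite H smG_mem.
Qed.

Lemma smG_upr g x y : smG g -> ac g (upr x y) = upr (ac g x) (ac g y).
Proof.
move=> Gg; apply: (smG_eq Gg); [exact: (proj1 (upr_spec _ _))|exact: (proj1 (upr_spec _ _))|] => w.
rewrite in_upr; split=> [[->|->]|[z [/in_upr [->|->]]]]; auto.
  by exists x; split=> //; apply/in_upr; auto.
by exists y; split=> //; apply/in_upr; auto.
Qed.

Lemma smG_pr g x y : smG g -> ac g (pr x y) = pr (ac g x) (ac g y).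
Proof. by move=> Gg; rewrite /pr !smG_upr. Qed.

Lemma pt_of_ac g d : smG g -> d ∈ smX A -> ac g (atm A d) = atm A d -> pt g d = d.
Proof.
move=> Gg Xd; rewrite pt_atm // => E; apply: (atm_inj _ Xd E); exact: pt_dom.
Qed.

Lemma pt_inv g h d : smG g -> smG h -> (forall x, ac h (ac g x) = x) -> d ∈ smX A -> pt h (pt g d) = d.
Proof.
move=> Gg Gh H Xd; have Xg := pt_dom Gg Xd.
by apply: (atm_inj _ Xd); [exact: pt_dom|rewrite -pt_atm // -pt_atm // H].
Qed.

(* Take for [k2] the conjugate of [k] by [g]. *)
Lemma smG_conj g k : smG g -> smG k -> exists k2, smG k2 /\
  (forall x, ac k2 x = x -> ac k (ac g x) = ac g x) /\
  (forall d, d ∈ smX A -> pt k (pt g d) = pt g d -> pt k2 d = d).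
Proof.
move=> Gg Gk; have [h [Gh [Hhg Hgh]]] := smG_inv Gg.
have [k1 [Gk1 Hk1]] := smG_comp Gg Gk; have [k2 [Gk2 Hk2]] := smG_comp Gk1 Gh.
exists k2; split=> //; split=> [x E|d Xd E]; first by rewrite -{2}E Hk2 Hk1 Hgh.
apply: pt_of_ac => //; have Xg := pt_dom Gg Xd.
by rewrite Hk2 Hk1 (pt_atm Gg Xd) (pt_atm Gk Xg) E -(pt_atm Gg Xd) Hhg.
Qed.

(** Supports are finite subsets of [smX] in [V] rather than tuples of atoms inside the model, so
    that they can be compared with domains and ranges of partial isomorphisms; [fin_supported_tuple]
    connects the two notions. *)
Definition supports (c : V) x : Prop :=
  forall g, smG g -> (forall d, d ∈ c -> pt g d = d) -> ac g x = x.
Definition fin_supported x : Prop := exists c, Fin c /\ (c ⊆ smX A) /\ supports c x.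
Definition hsym x : Prop := forall y, in_TC_singleton x y -> fin_supported y.

#[global] Instance Def1_fin_supported : Def1 fin_supported.
Proof. by rewrite /fin_supported /supports; dfn. Qed.
#[global] Instance Def1_hsym : Def1 hsym.
Proof. by rewrite /hsym; dfn. Qed.

Lemma hsym_unfold x : hsym x <-> fin_supported x /\ forall z, z ∈ x -> hsym z.
Proof.
split=> [H|[H1 H2] y /in_TC_unfold [->//|[z [Hz Hy]]]]; last exact: (H2 z Hz y Hy).
split=> [|z Hz y Hy]; first by apply: H; exact: in_TC_refl.
by apply: H; exact: in_TC_step Hz Hy.
Qed.

Lemma hsym_fin_supported x : hsym x -> fin_supported x.
Proof. by move/hsym_unfold => []. Qed.

Lemma hsym_mem x z : hsym x -> z ∈ x -> hsym z.
Proof. by move/hsym_unfold => [_]; apply. Qed.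

Lemma hsym_atm d : d ∈ smX A -> hsym (atm A d).
Proof.
move=> Xd; apply/hsym_unfold; split; last by move=> z /(u_atom_empty (atm_atom Xd)).
exists (adj emp d); split; first exact: (Fin_adj _ Fin_emp).
split=> [e /in_adj [/in_emp //|-> //]|g Gg H].
by rewrite pt_atm // H //; apply/in_adj; right.
Qed.

Lemma hsym_upr x y : hsym x -> hsym y -> hsym (upr x y).
Proof.
move=> Hx Hy; apply/hsym_unfold; split; last by move=> z /in_upr [->|->].
have [c [Fc [Xc Sc]]] := hsym_fin_supported Hx; have [c' [Fc' [Xc' Sc']]] := hsym_fin_supported Hy.
have [C [FC HC]] := FinP_or (Fin_FinP Fc) (Fin_FinP Fc').
have D : Def1 (fun d => d ∈ c \/ d ∈ c') by dfn.
have [|b Hb] := V_mk D; first by exists C.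
exists b; split; first by apply: FinP_set; exists C; split=> // d /Hb /HC.
split=> [d /Hb [/Xc|/Xc'] //|g Gg H].
rewrite smG_upr // (Sc g Gg) ?(Sc' g Gg) // => d Hd; apply: H; apply/Hb; auto.
Qed.

Lemma hsym_pr x y : hsym x -> hsym y -> hsym (pr x y).
Proof. by move=> Hx Hy; apply: hsym_upr; apply: hsym_upr. Qed.
End Model.

(** * Similarity as a fixed point of [Phi], and its equivariance *)

Section Core.
Context (A1 A2 : symmodel).
Implicit Types (p q r s : V) (x : A1) (y : A2) (g : A1).
Notation PI12 := (PI (smX A1) (smX A2) (smle A1) (smle A2)).
Notation PI11 := (PI (smX A1) (smX A1) (smle A1) (smle A1)).
Let O1 : dense_order _ _ := so_dense (sm_order A1).
Let O2 : dense_order _ _ := so_dense (sm_order A2).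

Instance Def1_PI12 : Def1 PI12.
Proof. exact: Def1_PI. Qed.

Definition suppL p x : Prop :=
  forall g, smG g -> (forall d e, pr d e ∈ p -> pt g d = d) -> ac g x = x.
Definition suppR p y : Prop :=
  forall h, smG h -> (forall d e, pr d e ∈ p -> pt h e = e) -> ac h y = y.

(* Quantifying over all extensions [q] of [p] makes similarity monotone in [p]. *)
Definition Phi (B : V -> A1 -> A2 -> Prop) p x y : Prop :=
  (PI12 p /\ hsym x /\ hsym y /\ suppL p x /\ suppR p y) /\
  (atom x \/ atom y -> exists d e, pr d e ∈ p /\ x = atm A1 d /\ y = atm A2 e) /\
  (forall q x', PI12 q -> (p ⊆ q) -> x' ∈ x -> suppL q x' ->
     exists y', y' ∈ y /\ B q x' y') /\
  (forall q y', PI12 q -> (p ⊆ q) -> y' ∈ y -> suppR q y' ->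
     exists x', x' ∈ x /\ B q x' y').

Definition code p x y : V := pr p (pr (inj x) (inj y)).
Definition good (b : V) : Prop := forall p x y, code p x y ∈ b ->
  Phi (fun q x' y' => code q x' y' ∈ b) p x y.
(** The union of all sets of coded triples that are post-fixed points of [Phi]. Quantifying over
    such sets makes the relation definable in [V], with no need for a recursion on pairs drawn from
    two universes. *)
Definition sim p x y : Prop := exists b, good b /\ code p x y ∈ b.

Instance Def2_suppL : Def2 suppL.
Proof. by rewrite /suppL; dfn. Qed.
Instance Def2_suppR : Def2 suppR.
Proof. by rewrite /suppR; dfn. Qed.
Instance Def3_sim : Def3 sim.
Proof. by rewrite /sim /good /Phi /code; dfn. Qed.

Lemma code_inj p x y p' x' y' : code p x y = code p' x' y' -> p = p' /\ x = x' /\ y = y'.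
Proof. by move=> /pr_inj [-> /pr_inj [H1 H2]]; split=> //; split; apply: inj_inj. Qed.

Lemma Phi_mono (B B' : V -> A1 -> A2 -> Prop) p x y :
  (forall q x' y', x' ∈ x -> y' ∈ y -> B q x' y' -> B' q x' y') -> Phi B p x y -> Phi B' p x y.
Proof.
move=> H [H1 [H2 [H3 H4]]]; split=> //; split=> //; split.
  by move=> q x' Pq Hpq Hx Sx; have [y' [Hy HB]] := H3 q x' Pq Hpq Hx Sx; exists y'; auto.
by move=> q y' Pq Hpq Hy Sy; have [x' [Hx HB]] := H4 q y' Pq Hpq Hy Sy; exists x'; auto.
Qed.

Lemma sim_Phi p x y : sim p x y -> Phi sim p x y.
Proof.
move=> [b [Gb Hb]]; apply: Phi_mono (Gb _ _ _ Hb) => q x' y' _ _ H; by exists b.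
Qed.

Lemma Bdd_PI12 : Bdd PI12.
Proof.
have [a Ha] := V_bdd_pr (smX A1) (smX A2).
apply: (Bdd_sub (Bdd_powV a)) => p [_ [Hp _]]; apply/subsetV => z /Hp [d [e [H1 [H2 ->]]]].
by apply: Ha; exists d, e.
Qed.

(** A single good set has to witness the conclusion. It collects the similar triples whose
    components lie in the transitive closures of [x] and [y], together with the triple at hand;
    since [Phi] looks only at elements, this set is closed. *)
Lemma Phi_sim p x y : Phi sim p x y -> sim p x y.
Proof.
move=> H0.
pose (Q := fun z => exists q, PI12 q /\ exists x', in_TC_singleton x x' /\
  exists y', in_TC_singleton y y' /\ z = code q x' y' /\
    (sim q x' y' \/ (q = p /\ x' = x /\ y' = y))).
have DQ : Def1 Q by rewrite /Q /code; dfn.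
have BQ : Bdd Q.
  apply: (Bdd_bigU Bdd_PI12); try (by rewrite /code; dfn); move=> q _.
  apply: (Bdd_bigU (Bdd_TC x)); try (by rewrite /code; dfn); move=> x' _.
  apply: (Bdd_ex (Bdd_TC y)); try (by rewrite /code; dfn).
  by move=> y' _ t t' [-> _] [-> _].
have [b Hb] := V_mk DQ BQ.
have Hb' q x' y' : code q x' y' ∈ b -> in_TC_singleton x x' /\ in_TC_singleton y y' /\ Phi sim q x' y'.
  move=> /Hb [q1 [Pq [x1 [Tx [y1 [Ty [/code_inj [E1 [E2 E3]] H]]]]]]]; subst q1 x1 y1.
  split=> //; split=> //; case: H => [/sim_Phi //|[-> [-> ->]] //].
exists b; split.
  move=> q x' y' /Hb' [Tx [Ty H]]; apply: Phi_mono H => r x2 y2 Hx2 Hy2 Hs; apply/Hb.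
  exists r; split; first by case: (sim_Phi Hs) => -[].
  exists x2; split; first exact: in_TC_mem Tx Hx2.
  exists y2; split; first exact: in_TC_mem Ty Hy2.
  by split=> //; left.
apply/Hb; exists p; split; first by case: H0 => -[].
exists x; split; first exact: in_TC_refl.
exists y; split; first exact: in_TC_refl.
by split=> //; right.
Qed.

Lemma sim_PI p x y : sim p x y -> PI12 p.
Proof. by move=> /sim_Phi [[]]. Qed.

Lemma sim_mono p q x y : sim p x y -> PI12 q -> (p ⊆ q) -> sim q x y.
Proof.
move=> /sim_Phi [[Pp [Hx [Hy [Sx Sy]]]] [Hat [Hf Hb]]] Pq Hpq; apply: Phi_sim.
split; [split=> //; split=> //; split=> //; split|split; [|split]].
- by move=> g Gg Hg; apply: Sx => // d e /Hpq; exact: Hg.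
- by move=> g Gg Hg; apply: Sy => // d e /Hpq; exact: Hg.
- by move=> /Hat [d [e [H1 H2]]]; exists d, e; split=> //; exact: Hpq.
- by move=> r x' Pr Hqr; apply: Hf => // z /Hpq /Hqr.
- by move=> r x' Pr Hqr; apply: Hb => // z /Hpq /Hqr.
Qed.

Lemma extendL p x : PI12 p -> fin_supported x -> exists q, PI12 q /\ (p ⊆ q) /\ suppL q x.
Proof.
move=> Pp [c [Fc [Xc Sc]]]; have [q [Pq [Hpq Hq]]] := PI_extend O1 O2 Pp Fc Xc.
exists q; split=> //; split=> // g Gg Hg; apply: Sc => // d /Hq [e He]; exact: Hg He.
Qed.

Lemma extendR p y : PI12 p -> fin_supported y -> exists q, PI12 q /\ (p ⊆ q) /\ suppR q y.
Proof.
move=> Pp [c [Fc [Xc Sc]]]; have [q [Pq [Hpq Hq]]] := PI_extend_ran O1 O2 Pp Fc Xc.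
exists q; split=> //; split=> // g Gg Hg; apply: Sc => // d /Hq [e He]; exact: Hg He.
Qed.

Lemma PI_fun p d e e' : PI12 p -> pr d e ∈ p -> pr d e' ∈ p -> e = e'.
Proof. by move=> [_ Hp]; exact: (piso_fun O1 O2 Hp). Qed.

(** By ∈-induction on [x]. An element [w] of [y] is supported over some [q ⊇ p]; it has a partner
    [x'] in [x] over [q], which in turn has a partner in [y'], and by induction that partner is [w].
    The opposite inclusion holds by symmetry. *)
Lemma sim_fun p x y y' : sim p x y -> sim p x y' -> y = y'.
Proof.
move: x p y y'; apply: u_ind.
  by dfn.
suff half x : (forall x', x' ∈ x -> forall p y y', sim p x' y -> sim p x' y' -> y = y') ->
   forall p y y', sim p x y -> sim p x y' -> y ⊆ y'.
  move=> x IH p y y' Hy Hy'.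
  have [[Pp _] [Hat _]] := sim_Phi Hy; have [_ [Hat' _]] := sim_Phi Hy'.
  case: (classic (atom x \/ atom y \/ atom y')) => Hatom.
    have Ax : atom x.
      case: Hatom => [//|[Ay|Ay]].
        have [d [e [H [-> _]]]] := Hat (or_intror Ay).
        by apply: atm_atom; case: (PI_dom Pp H).
      have [d [e [H [-> _]]]] := Hat' (or_intror Ay).
      by apply: atm_atom; case: (PI_dom Pp H).
    have [d [e [H [E1 ->]]]] := Hat (or_introl Ax).
    have [d' [e' [H' [E2 ->]]]] := Hat' (or_introl Ax).
    have Ed : d = d'.
      apply: (@atm_inj A1); [by case: (PI_dom Pp H)|by case: (PI_dom Pp H')|by rewrite -E1].
    by subst d'; rewrite (PI_fun Pp H H').
  apply: M_ext; [by move=> ?; apply: Hatom; auto|by move=> ?; apply: Hatom; auto|] => w.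
  by split; [exact: (half x IH p y y')|exact: (half x IH p y' y)].
move=> IH p y y' Hy Hy' w Hw.
have [[Pp [_ [HSy _]]] [_ [_ Hb]]] := sim_Phi Hy; have [_ [_ [Hf _]]] := sim_Phi Hy'.
have [q [Pq [Hpq Sq]]] := extendR Pp (hsym_fin_supported (hsym_mem HSy Hw)).
have [x' [Hx' Hs]] := Hb q w Pq Hpq Hw Sq.
have [[_ [_ [_ [SL _]]]] _] := sim_Phi Hs.
have [w' [Hw' Hs']] := Hf q x' Pq Hpq Hx' SL.
by rewrite (IH x' Hx' _ _ _ Hs Hs').
Qed.

Lemma identity_PI p : PI12 p -> exists s, PI11 s /\ (forall d e, pr d e ∈ p -> pr d d ∈ s) /\
  forall d d', pr d d' ∈ s -> d' = d /\ exists e, pr d e ∈ p.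
Proof.
move=> [Fp Hp].
have D : Def1 (fun z => exists d e, pr d e ∈ p /\ z = pr d d) by dfn.
have DG : DefF2 (fun d _ : V => pr d d) by dfn.
have [s [Fs Hs]] := FinP_mk (FinP_pairs Fp DG) D.
exists s; split; [split=> //; split|split].
- move=> z /Hs [d [e [H ->]]]; exists d, d.
  by have [] := PI_dom (conj Fp Hp) H.
- by move=> d e d' e' /Hs [a [b [_ /pr_inj [-> ->]]]] /Hs [a' [b' [_ /pr_inj [-> ->]]]].
- by move=> d e H; apply/Hs; exists d, e.
- by move=> d d' /Hs [a [b [H /pr_inj [-> ->]]]]; split=> //; exists b.
Qed.

(* A point outside the domain of [p] can be moved by homogeneity. *)
Lemma suppL_atm p d : PI12 p -> d ∈ smX A1 -> suppL p (atm A1 d) -> exists e, pr d e ∈ p.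
Proof.
move=> Pp Xd Sd; apply: NNPP => N.
have [s [Ps [Hs Hs']]] := identity_PI Pp.
(* The identity on [dom p] can be extended by sending [d] to either of two distinct points, one of
   which is not [d]. An automorphism extending that map fixes [dom p] but not the atom of [d]. *)
have [|e1 [e2 [[_ E12] [P1 P2]]]] := one_point O1 O1 Ps Xd.
  by move=> e /Hs' [_ [e' He']]; apply: N; exists e'.
have [e [Ne Pe]] : exists e, e <> d /\ PI11 (adj s (pr d e)).
  case: (classic (e1 = d)) => H; last by exists e1.
  by exists e2; split=> // E; apply: E12; rewrite H E.
have [g [Gg Hg]] := smG_homog Pe; apply: Ne.
have <- : pt g d = e by apply: Hg; apply/in_adj; right.
apply: pt_of_ac => //; apply: Sd => // d' e' H'.
by apply: Hg; apply/in_adj; left; exact: Hs H'.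
Qed.

(** This is [p] composed with the inverse of [g]: the domain is moved by [g] while the range stays
    in place. *)
Definition mvL (g : A1) p : V := setV (fun z => exists d e, pr d e ∈ p /\ z = pr (pt g d) e).
Instance DefF2_mvL : DefF2 mvL.
Proof. by rewrite /mvL; dfn. Qed.

Lemma FinP_mvL g p : Fin p -> FinP (fun z => exists d e, pr d e ∈ p /\ z = pr (pt g d) e).
Proof. by move=> Fp; apply: FinP_pairs => //; dfn. Qed.

Lemma in_mvL g p z : Fin p -> z ∈ mvL g p <-> exists d e, pr d e ∈ p /\ z = pr (pt g d) e.
Proof. by move=> Fp; apply: in_setV; [dfn|exact/FinP_Bdd/FinP_mvL]. Qed.

Lemma PI_mvL g p : smG g -> PI12 p -> PI12 (mvL g p).
Proof.
move=> Gg Pp; case: (Pp) => Fp Hp; split; [|split].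
- by apply: FinP_set; apply: FinP_sub (FinP_mvL g Fp) _ => z /(in_mvL _ _ Fp).
- move=> z /(in_mvL _ _ Fp) [d [e [H ->]]]; have [X1 X2] := PI_dom Pp H.
  by exists (pt g d), e; split=> //; exact: pt_dom.
- move=> d e d' e' /(in_mvL _ _ Fp) [a [b [H1 /pr_inj [-> ->]]]].
  move=> /(in_mvL _ _ Fp) [a' [b' [H2 /pr_inj [-> ->]]]].
  have [X1 _] := PI_dom Pp H1; have [X2 _] := PI_dom Pp H2.
  by rewrite -(pt_le Gg X1 X2); exact: (proj2 Hp).
Qed.

Lemma mvL_inv g (h : A1) p : smG g -> smG h -> (forall x, ac h (ac g x) = x) -> PI12 p -> mvL h (mvL g p) = p.
Proof.
move=> Gg Gh H Pp; have Fg := proj1 (PI_mvL Gg Pp); have Fp := proj1 Pp.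
apply: V_ext => z; rewrite in_mvL //; split.
  move=> [d [e [/(in_mvL _ _ Fp) [d' [e' [H' /pr_inj [-> ->]]]] ->]]].
  by rewrite (pt_inv Gg Gh H) //; case: (PI_dom Pp H').
move=> Hz; have [d [e [Xd [_ E]]]] := proj1 (proj2 Pp) _ Hz; subst z.
exists (pt g d), e; rewrite (pt_inv Gg Gh H) //; split=> //.
by apply/in_mvL => //; exists d, e.
Qed.

Lemma mvL_sub g p q : PI12 p -> PI12 q -> (p ⊆ q) -> forall z, z ∈ mvL g p -> z ∈ mvL g q.
Proof.
move=> Pp Pq H z /(in_mvL _ _ (proj1 Pp)) [d [e [H' ->]]]; apply/(in_mvL _ _ (proj1 Pq)).
by exists d, e; split=> //; exact: H.
Qed.

Lemma suppL_mvL g p x : smG g -> PI12 p -> suppL p x -> suppL (mvL g p) (ac g x).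
Proof.
move=> Gg Pp Sx k Gk Hk; have [k2 [Gk2 [Hx Hd]]] := smG_conj Gg Gk.
apply: Hx; apply: Sx => // d e H; have [Xd _] := PI_dom Pp H; apply: Hd => //.
by apply: (Hk _ e); apply/(in_mvL _ _ (proj1 Pp)); exists d, e.
Qed.

Lemma suppR_mvL g p y : smG g -> PI12 p -> suppR p y <-> suppR (mvL g p) y.
Proof.
move=> Gg Pp; split=> Sy h Gh Hh; apply: Sy => // d e H.
  by apply: (Hh (pt g d) e); apply/(in_mvL _ _ (proj1 Pp)); exists d, e.
by move/(in_mvL _ _ (proj1 Pp)): H => [d' [e' [H' /pr_inj [_ ->]]]]; exact: Hh H'.
Qed.

Lemma hsym_ac g x : smG g -> hsym x -> hsym (ac g x).
Proof.
move=> Gg; move: x; apply: u_ind; first by dfn.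
move=> x IH /hsym_unfold [[c [Fc [Xc Sc]]] Hx]; apply/hsym_unfold; split; last first.
  by move=> z /(smG_mem _ _ Gg) [w [Hw ->]]; apply: IH => //; exact: Hx.
have D : Def1 (fun e => exists d, d ∈ c /\ e = pt g d) by dfn.
have F : FinP (fun e => exists d, d ∈ c /\ e = pt g d).
  by apply: FinP_ex; [dfn|dfn|exact: Fin_FinP|move=> d _ t t' -> ->].
have [b [Fb Hb]] := FinP_mk F D.
exists b; split=> //; split=> [e /Hb [d [Hd ->]]|k Gk Hk]; first by apply: pt_dom => //; exact: Xc.
have [k2 [Gk2 [Hx2 Hd2]]] := smG_conj Gg Gk.
apply: Hx2; apply: Sc => // d Hd; apply: Hd2; first exact: Xc.
by apply: Hk; apply/Hb; exists d.
Qed.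

(** Extensions of the moved map are exactly the moved extensions of [p]: [back] pulls them back by
    the inverse [h] of [g], where the hypothesis applies, and ∈-induction moves the resulting pair
    of elements forward again. *)
Lemma sim_moveL g p x y : smG g -> sim p x y -> sim (mvL g p) (ac g x) y.
Proof.
move=> Gg; have [h [Gh [Hhg Hgh]]] := smG_inv Gg; move: x p y.
apply: u_ind; first by dfn.
move=> x IH p y /sim_Phi [[Pp [Hx [Hy [Sx Sy]]]] [Hat [Hf Hb]]].
have Pg := PI_mvL Gg Pp.
have back q : PI12 q -> (forall z, z ∈ mvL g p -> z ∈ q) ->
  PI12 (mvL h q) /\ (forall z, z ∈ p -> z ∈ mvL h q) /\ mvL g (mvL h q) = q.
  move=> Pq Hpq; split; first exact: PI_mvL; split; last exact: mvL_inv.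
  move=> z Hz; rewrite -(mvL_inv Gg Gh Hhg Pp) in Hz; exact: mvL_sub Hz.
apply: Phi_sim; split; [split=> //; split; [exact: hsym_ac|split=> //; split]|split; [|split]].
- exact: suppL_mvL.
- by apply/(suppR_mvL _ Gg Pp).
- move=> H; have [|d [e [H1 [-> ->]]]] := Hat.
    by case: H => H; [left; apply/(smG_atom _ Gg)|right].
  have [Xd _] := PI_dom Pp H1.
  exists (pt g d), e; rewrite pt_atm //; split=> //.
  by apply/(in_mvL _ _ (proj1 Pp)); exists d, e.
- move=> q x' Pq Hpq /(smG_mem _ _ Gg) [w [Hw ->]] Sw.
  have [Pq' [Hpq' Eq]] := back q Pq Hpq.
  have [|y' [Hy' Hs]] := Hf _ w Pq' Hpq' Hw.
    by rewrite -(Hhg w); exact: suppL_mvL.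
  by exists y'; split=> //; rewrite -Eq; exact: IH.
- move=> q y' Pq Hpq Hy' Sq.
  have [Pq' [Hpq' Eq]] := back q Pq Hpq.
  have [|x' [Hx' Hs]] := Hb _ y' Pq' Hpq' Hy'; first by apply/(suppR_mvL _ Gh Pq).
  exists (ac g x'); split; first by apply/(smG_mem _ _ Gg); exists x'.
  by rewrite -Eq; exact: IH.
Qed.

(* Two extensions [q], [r] of [p] need not be compatible, but they become so after
   enlarging [r] and moving it by an automorphism fixing [dom p]. *)
Lemma amalgamL p q r : PI12 p -> PI12 q -> PI12 r ->
  (p ⊆ q) -> (p ⊆ r) ->
  exists r2 g, PI12 r2 /\ (r ⊆ r2) /\ smG g /\
    (forall d e, pr d e ∈ p -> pt g d = d) /\ (forall z, z ∈ q -> z ∈ mvL g r2).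
Proof.
move=> Pp Pq Pr Hpq Hpr.
have [|c [Fc Hc]] := FinP_mk (FinP_range (proj1 Pq)); first by dfn.
(* Enlarging [r] until its range covers that of [q] gives every point of [dom q] a counterpart in
   [dom r2], namely the one with the same image. *)
have [|r2 [Pr2 [Hr2 Hcov]]] := PI_extend_ran O1 O2 Pr Fc.
  by move=> e /Hc [d H]; case: (PI_dom Pq H).
(* The set [s] is [r2] followed by the inverse of [q]. It is a finite partial automorphism and is
   the identity on [dom p], where [q] and [r2] agree; the automorphism extending it carries [r2]
   onto a superset of [q]. *)
have F2 : FinP (fun z => exists d d', (exists e, pr d e ∈ r2 /\ pr d' e ∈ q) /\ z = pr d d').
  apply: (FinP_sub (Q := fun z => exists w, w ∈ r2 /\ exists d d' e, w = pr d e /\ pr d' e ∈ q /\ z = pr d d')).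
    apply: FinP_ex; [by dfn|by dfn|exact: Fin_FinP (proj1 Pr2)|].
    move=> w _ t t' [d [d' [e [-> [H ->]]]]] [a [a' [b [/pr_inj [Ea Eb] [H' ->]]]]].
    by subst a b; rewrite (piso_inj O1 O2 (proj2 Pq) H H').
  by move=> z [d [d' [[e [H1 H2]] ->]]]; exists (pr d e); split=> //; exists d, d', e.
have [|s [Fs Hs]] := FinP_mk F2; first by dfn.
have Hs' d d' : pr d d' ∈ s <-> exists e, pr d e ∈ r2 /\ pr d' e ∈ q.
  by rewrite Hs; split=> [[a [a' [H /pr_inj [-> ->]]]] //|H]; exists d, d'.
have Ps : PI11 s.
  split=> //; split.
    move=> z /Hs [d [d' [[e [H1 H2]] ->]]]; exists d, d'.
    by have [] := PI_dom Pr2 H1; have [] := PI_dom Pq H2.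
  move=> d e d' e' /Hs' [a [H1 H2]] /Hs' [a' [H3 H4]].
  by rewrite (proj2 (proj2 Pr2) _ _ _ _ H1 H3) (proj2 (proj2 Pq) _ _ _ _ H2 H4).
have [g [Gg Hg]] := smG_homog Ps.
exists r2, g; split=> //; split=> //; split=> //; split.
  by move=> d e H; apply: Hg; apply/Hs'; exists e; split; [exact/Hr2/Hpr|exact: Hpq].
move=> z Hz; have [d [e [Xd [Xe E]]]] := proj1 (proj2 Pq) _ Hz; subst z.
have [|d' Hd'] := Hcov e; first by apply/Hc; exists d.
apply/(in_mvL _ _ (proj1 Pr2)); exists d', e; split=> //.
by rewrite (Hg d' d) //; apply/Hs'; exists e.
Qed.
End Core.

Notation PIso A1 A2 := (PI (smX A1) (smX A2) (smle A1) (smle A2)).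
#[global] Existing Instance Def1_PI12.
#[global] Existing Instance Def3_sim.
#[global] Existing Instance Def2_suppL.
#[global] Existing Instance Def2_suppR.
#[global] Existing Instance DefF2_mvL.

Lemma suppL_conv (A1 A2 : symmodel) (p : V) (y : A2) :
  Fin p -> @suppL A2 (conv p) y <-> @suppR A2 p y.
Proof.
move=> Fp; split=> S h Gh Hh; apply: S => // d e H.
  by move/(in_conv _ _ Fp): H; exact: Hh.
by apply: (Hh e d); apply/(in_conv _ _ Fp).
Qed.

Lemma suppR_conv (A1 A2 : symmodel) (p : V) (x : A1) :
  Fin p -> @suppR A1 (conv p) x <-> @suppL A1 p x.
Proof.
move=> Fp; split=> S h Gh Hh; apply: S => // d e H.
  by move/(in_conv _ _ Fp): H; exact: Hh.
by apply: (Hh e d); apply/(in_conv _ _ Fp).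
Qed.

Lemma conv_sub (A1 A2 : symmodel) (p q : V) : PIso A1 A2 p -> PIso A1 A2 q ->
  (p ⊆ q) -> forall z, z ∈ conv p -> z ∈ conv q.
Proof.
move=> Pp Pq H z /(in_conv_inv (proj1 Pp)) [d [e [H1 ->]]].
by apply/(in_conv _ _ (proj1 Pq)); exact: H.
Qed.

Lemma conv_sub_r (A1 A2 : symmodel) (p q : V) : PIso A1 A2 p -> PIso A2 A1 q ->
  (conv p ⊆ q) -> forall z, z ∈ p -> z ∈ conv q.
Proof.
move=> Pp Pq H; rewrite -(conv_conv Pp); apply: (@conv_sub A2 A1) => //; exact: PI_conv.
Qed.

(** Inverting [p] exchanges the two halves of [Phi]. This symmetry lets facts about ranges and
    right-hand elements be deduced from those about domains and left-hand ones. *)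
Lemma sim_conv (A1 A2 : symmodel) (p : V) (x : A1) (y : A2) : sim p x y -> sim (conv p) y x.
Proof.
move: x p y.
apply: u_ind; first by dfn.
move=> x IH p y /sim_Phi [[Pp [Hx [Hy [Sx Sy]]]] [Hat [Hf Hb]]].
have Pc := PI_conv Pp; have Fp := proj1 Pp.
apply: Phi_sim; split; [split=> //; split=> //; split=> //; split|split; [|split]].
- by apply/(@suppL_conv A1 A2).
- by apply/(@suppR_conv A1 A2).
- move=> H; have [|d [e [H1 [H2 H3]]]] := Hat; first by tauto.
  by exists e, d; split=> //; apply/(in_conv _ _ Fp).
- move=> q y' Pq Hpq Hy' Sq; have Pcq := PI_conv Pq.
  have [|x' [Hx' Hs]] := Hb (conv q) y' Pcq (conv_sub_r Pp Pq Hpq) Hy'.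
    by apply/(@suppR_conv A2 A1) => //; exact: (proj1 Pq).
  by exists x'; split=> //; rewrite -(conv_conv Pq); exact: IH.
- move=> q x' Pq Hpq Hx' Sq; have Pcq := PI_conv Pq.
  have [|y' [Hy' Hs]] := Hf (conv q) x' Pcq (conv_sub_r Pp Pq Hpq) Hx'.
    by apply/(@suppL_conv A2 A1) => //; exact: (proj1 Pq).
  by exists y'; split=> //; rewrite -(conv_conv Pq); exact: IH.
Qed.

(** * Similarity as a partial bijection, and the transfer of supports *)

Section Extension.
Context (A1 A2 : symmodel).
Implicit Types (p q r : V) (x : A1) (y : A2) (g : A1) (h : A2).
Notation PI12 := (PIso A1 A2).

Lemma sim_inj p x x' y : sim p x y -> sim p x' y -> x = x'.
Proof. by move=> /sim_conv H /sim_conv H'; exact: sim_fun H H'. Qed.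

Lemma sim_mem p x y x' y' : sim p x y -> sim p x' y' -> x' ∈ x <-> y' ∈ y.
Proof.
move=> H H'; have [[Pp _] [_ [Hf Hb]]] := sim_Phi H.
have [[_ [_ [_ [SL SR]]]] _] := sim_Phi H'.
split=> Hm.
  have [y2 [Hy2 H2]] := Hf p x' Pp (fun z Hz => Hz) Hm SL.
  by rewrite (sim_fun H' H2).
have [x2 [Hx2 H2]] := Hb p y' Pp (fun z Hz => Hz) Hm SR.
by rewrite (sim_inj H' H2).
Qed.

Lemma sim_atom p x y : sim p x y -> atom x <-> atom y.
Proof.
move=> /sim_Phi [[Pp _] [Hat _]]; split=> Ha.
  have [d [e [H [_ ->]]]] := Hat (or_introl Ha).
  by apply: atm_atom; case: (PI_dom Pp H).
have [d [e [H [-> _]]]] := Hat (or_intror Ha).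
by apply: atm_atom; case: (PI_dom Pp H).
Qed.

Definition mvR h p := conv (mvL h (conv p)).

Lemma PI_mvR h p : smG h -> PI12 p -> PI12 (mvR h p).
Proof. by move=> Gh Pp; apply: PI_conv; apply: PI_mvL => //; exact: PI_conv. Qed.

Lemma sim_moveR h p x y : smG h -> sim p x y -> sim (mvR h p) x (ac h y).
Proof. by move=> Gh /sim_conv /(sim_moveL Gh) /sim_conv. Qed.

Lemma mvR_fix h p q : smG h -> PI12 p -> PI12 q -> (p ⊆ q) ->
  (forall d e, pr d e ∈ p -> pt h e = e) -> forall z, z ∈ p -> z ∈ mvR h q.
Proof.
move=> Gh Pp Pq Hpq Hfix z Hz.
have [d [e [Xd [_ E]]]] := proj1 (proj2 Pp) _ Hz; subst z.
have Pc := PI_conv Pq; have Pm := PI_mvL Gh Pc.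
apply/(in_conv _ _ (proj1 Pm))/(in_mvL _ _ (proj1 Pc)).
exists e, d; rewrite (Hfix _ _ Hz); split=> //.
by apply/(in_conv _ _ (proj1 Pq)); exact: Hpq.
Qed.

Lemma mvL_fix g p q : smG g -> PI12 p -> PI12 q -> (p ⊆ q) ->
  (forall d e, pr d e ∈ p -> pt g d = d) -> forall z, z ∈ p -> z ∈ mvL g q.
Proof.
move=> Gg Pp Pq Hpq Hfix z Hz.
have [d [e [Xd [_ E]]]] := proj1 (proj2 Pp) _ Hz; subst z.
apply/(in_mvL _ _ (proj1 Pq)).
by exists d, e; rewrite (Hfix _ _ Hz); split=> //; exact: Hpq.
Qed.

Lemma mvR_inv h h' p : smG h -> smG h' -> (forall y, ac h' (ac h y) = y) -> PI12 p -> mvR h' (mvR h p) = p.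
Proof.
move=> Gh Gh' H Pp; have Pc := PI_conv Pp; rewrite /mvR.
by rewrite (conv_conv (PI_mvL Gh Pc)) (mvL_inv Gh Gh' H Pc) (conv_conv Pp).
Qed.

Lemma amalgamR p q r : PI12 p -> PI12 q -> PI12 r ->
  (p ⊆ q) -> (p ⊆ r) ->
  exists r2 h, PI12 r2 /\ (r ⊆ r2) /\ smG h /\
    (forall d e, pr d e ∈ p -> pt h e = e) /\ (forall z, z ∈ q -> z ∈ mvR h r2).
Proof.
move=> Pp Pq Pr Hpq Hpr.
have [||r2 [h [Pr2 [Hr [Gh [Hfix Hq]]]]]] := amalgamL (PI_conv Pp) (PI_conv Pq) (PI_conv Pr).
- exact: (conv_sub Pp Pq).
- exact: (conv_sub Pp Pr).
exists (conv r2), h; split; first exact: PI_conv.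
split; first exact: (conv_sub_r Pr Pr2).
split=> //; split=> [d e H|].
  by apply: (Hfix e d); apply/(in_conv _ _ (proj1 Pp)).
rewrite /mvR (conv_conv Pr2); apply: (conv_sub_r Pq) => //; exact: PI_mvL.
Qed.

(** Let [g] fix [dom p]. Then [ac g x] is similar to [y] over the moved [q], which still extends
    [p]. Amalgamation on the right gives [h] fixing [ran p], hence fixing [y], such that both [x]
    and [ac g x] are similar to [y] over one common map; injectivity makes them equal. *)
Lemma sim_suppL p q x y : sim q x y -> PI12 p -> (p ⊆ q) -> suppR p y -> suppL p x.
Proof.
move=> Hs Pp Hpq Sy g Gg Hg.
have Pq := sim_PI Hs; have Pg := PI_mvL Gg Pq.
have Hpg := mvL_fix Gg Pp Pq Hpq Hg.
have [r [h [Pr [Hr [Gh [Hfix Hq]]]]]] := amalgamR Pp Pq Pg Hpq Hpg.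
have H1 : sim r (ac g x) y := sim_mono (sim_moveL Gg Hs) Pr Hr.
have H2 := sim_moveR Gh H1.
rewrite (Sy h Gh Hfix) in H2.
have H3 := sim_mono Hs (PI_mvR Gh Pr) Hq.
exact: sim_inj H2 H3.
Qed.
End Extension.

Lemma sim_suppR (A1 A2 : symmodel) (p q : V) (x : A1) (y : A2) : sim q x y -> PIso A1 A2 p ->
  (p ⊆ q) -> suppL p x -> suppR p y.
Proof.
move=> Hs Pp Hpq Sx; have Pq := sim_PI Hs.
apply/(@suppL_conv A1 A2); first exact: (proj1 Pp).
apply: (sim_suppL (sim_conv Hs) (PI_conv Pp) (conv_sub Pp Pq Hpq)).
by apply/(@suppR_conv A1 A2) => //; exact: (proj1 Pp).
Qed.

(** * Restriction of similarity and existence of partners *)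

Section Existence.
Context (A1 A2 : symmodel).
Implicit Types (p q r : V) (x : A1) (y : A2) (g : A1) (h : A2).
Notation PI12 := (PIso A1 A2).

(** For an element [x'] of [x] supported over some [r ⊇ p], amalgamation moves an enlargement [r2]
    of [r] by [g] to a map extending [q]. As [g] fixes [x], the moved element is still in [x] and
    has a partner in [y]; moving back gives similarity over [r2], and induction restricts it to [r].
    Elements of [y] are treated dually. *)
Lemma sim_restrict p q x y : sim q x y -> PI12 p -> (p ⊆ q) -> suppL p x -> sim p x y.
Proof.
move: x p q y; apply: u_ind; first by dfn.
move=> x IH p q y Hs Pp Hpq Sx.
have Sy := sim_suppR Hs Pp Hpq Sx.
have [[Pq [HSx [HSy _]]] [Hat [Hf Hb]]] := sim_Phi Hs.
apply: Phi_sim; split; [by []|split; [|split]].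
- move=> /Hat [d [e [H [Ex Ey]]]]; subst x y; exists d.
  have [Xd _] := PI_dom Pq H.
  (* A support of an atom must contain the corresponding point, so [d] is in [dom p] already and not
     only in [dom q]. *)
  have [e' He'] := suppL_atm Pp Xd Sx.
  by exists e; rewrite (PI_fun Pq H (Hpq _ He')).
- move=> r x' Pr Hpr Hx' Sx'.
  have [r2 [g [Pr2 [Hr [Gg [Hfix Hq]]]]]] := amalgamL Pp Pq Pr Hpq Hpr.
  have [k [Gk [Hkg Hgk]]] := smG_inv Gg.
  have Hgx' : ac g x' ∈ x by rewrite -(Sx g Gg Hfix); apply/(smG_mem _ _ Gg); exists x'.
  have Sr2 : suppL r2 x' by move=> f Gf Hfx; apply: Sx' => // d e /Hr; exact: Hfx.
  have [y' [Hy' Hs']] := Hf _ _ (PI_mvL Gg Pr2) Hq Hgx' (suppL_mvL Gg Pr2 Sr2).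
  exists y'; split=> //.
  have := sim_moveL Gk Hs'; rewrite Hkg (mvL_inv Gg Gk Hkg Pr2) => Hs2.
  exact: (IH x' Hx' r r2 y' Hs2 Pr Hr Sx').
- move=> r y' Pr Hpr Hy' Sy'.
  have [r2 [h [Pr2 [Hr [Gh [Hfix Hq]]]]]] := amalgamR Pp Pq Pr Hpq Hpr.
  have [k [Gk [Hkh Hhk]]] := smG_inv Gh.
  have Hhy' : ac h y' ∈ y by rewrite -(Sy h Gh Hfix); apply/(smG_mem _ _ Gh); exists y'.
  have Pm := PI_mvR Gh Pr2.
  have Sr2 : suppR (mvR h r2) (ac h y').
    apply/(@suppL_conv A1 A2); first exact: (proj1 Pm).
    rewrite /mvR (conv_conv (PI_mvL Gh (PI_conv Pr2))).
    apply: (suppL_mvL Gh (PI_conv Pr2)).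
    apply/(@suppL_conv A1 A2); first exact: (proj1 Pr2).
    by move=> f Gf Hfx; apply: Sy' => // d e /Hr; exact: Hfx.
  have [x' [Hx' Hs']] := Hb _ _ Pm Hq Hhy' Sr2.
  exists x'; split=> //.
  have := sim_moveR Gk Hs'; rewrite Hkh (mvR_inv Gh Gk Hkh Pr2) => Hs2.
  exact: (IH x' Hx' r r2 y' Hs2 Pr Hr (sim_suppL Hs2 Pr Hr Sy')).
Qed.

Lemma sim_atm p d e : PI12 p -> pr d e ∈ p -> sim p (atm A1 d) (atm A2 e).
Proof.
move=> Pp H; have [Xd Xe] := PI_dom Pp H; apply: Phi_sim.
split; [split=> //; split; [|split; [|split]]|split; [|split]].
- exact: hsym_atm.
- exact: hsym_atm.
- by move=> g Gg Hg; rewrite pt_atm // (Hg _ _ H).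
- by move=> g Gg Hg; rewrite pt_atm // (Hg _ _ H).
- by move=> _; exists d, e.
- by move=> q x' _ _ /(u_atom_empty (atm_atom Xd)).
- by move=> q x' _ _ /(u_atom_empty (atm_atom Xe)).
Qed.

Lemma sim_exists x p : hsym x -> PI12 p -> suppL p x -> exists y, sim p x y.
Proof.
move: x p; apply: u_ind; first by dfn.
move=> x IH p HSx Pp Sx.
case: (classic (atom x)) => [Ax|NAx].
  have [d [Xd E]] := atm_surj Ax; subst x.
  have [e He] := suppL_atm Pp Xd Sx.
  by exists (atm A2 e); exact: sim_atm.
(* Partners are gathered over all finite [q ⊇ p]. For given [x'] and [q] there is at most one, and
   the maps [q] form a set, so replacement bounds the collection. *)
pose (Q := fun y' : A2 => exists x', x' ∈ x /\ exists q, (PI12 q /\ forall z, z ∈ p -> z ∈ q) /\ sim q x' y').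
have DQ : Def1 Q by rewrite /Q; dfn.
have BQ : Bdd Q.
  apply: (Bdd_bigU (u_bdd x)); try (by dfn); move=> x' _.
  apply: (Bdd_ex (P := fun q => PI12 q /\ forall z, z ∈ p -> z ∈ q)); try (by dfn).
    by apply: (Bdd_sub (Bdd_PI12 A1 A2)) => q [].
  by move=> q _ y y'; exact: sim_fun.
have [y [Sy Hy]] := u_mk DQ BQ.
have Ry : suppR p y.
  (* If [h] fixes [ran p], moving the range of an extension of [p] by [h] gives another extension of
     [p]; so [y] is closed under [h], and likewise under its inverse. *)
  have closed h : smG h -> (forall d e, pr d e ∈ p -> pt h e = e) -> forall y', y' ∈ y -> ac h y' ∈ y.
    move=> Gh Hh y' /Hy [x' [Hx' [q [[Pq Hpq] Hs]]]]; apply/Hy; exists x'; split=> //.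
    exists (mvR h q); split; last exact: sim_moveR.
    by split; [exact: PI_mvR|exact: (mvR_fix Gh Pp Pq Hpq Hh)].
  move=> h Gh Hh; have [k [Gk [Hkh Hhk]]] := smG_inv Gh.
  apply: (smG_eq Gh) => // w; split=> [Hw|[z [Hz ->]]]; last exact: closed.
  exists (ac k w); split; last by rewrite Hhk.
  apply: closed => // d e H; have [_ Xe] := PI_dom Pp H.
  by rewrite -{1}(Hh _ _ H); exact: pt_inv.
exists y; apply: Phi_sim.
split; [split=> //; split=> //; split; [|split=> //]|split; [|split]].
- apply/hsym_unfold; split; last by move=> y' /Hy [x' [Hx' [q [_ /sim_Phi [[_ [_ []]]]]]]].
  have [|c [Fc Hc]] := FinP_mk (FinP_range (proj1 Pp)); first by dfn.
  exists c; split=> //; split=> [e /Hc [d H]|h Gh Hh]; first by case: (PI_dom Pp H).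
  by apply: Ry => // d e H; apply: Hh; apply/Hc; exists d.
- by case=> //; case/Sy.
- move=> q x' Pq Hpq Hx' Sq.
  have [y' Hs] := IH x' Hx' q (hsym_mem HSx Hx') Pq Sq.
  by exists y'; split=> //; apply/Hy; exists x'; split=> //; exists q.
- move=> q y' Pq Hpq /Hy [x' [Hx' [r [[Pr Hpr] Hs]]]] Sq.
  (* The element [y'] entered [y] through some [r] unrelated to [q]. After amalgamation [ac g x'] is
     similar to [y'] over an extension of [q], and it lies in [x] because [g] fixes [x]; restriction
     then brings the similarity down to [q]. *)
  have [r2 [g [Pr2 [Hr [Gg [Hfix Hq]]]]]] := amalgamL Pp Pq Pr Hpq Hpr.
  have Hs2 := sim_moveL Gg (sim_mono Hs Pr2 Hr).
  exists (ac g x'); split.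
    by rewrite -(Sx g Gg Hfix); apply/(smG_mem _ _ Gg); exists x'.
  exact: (sim_restrict Hs2 Pq Hq (sim_suppL Hs2 Pq Hq Sq)).
Qed.

Lemma sim_extend p x : hsym x -> PI12 p -> exists q y, PI12 q /\ (p ⊆ q) /\ sim q x y.
Proof.
move=> HSx Pp; have [q [Pq [Hpq Sq]]] := extendL Pp (hsym_fin_supported HSx).
by have [y Hy] := sim_exists HSx Pq Sq; exists q, y.
Qed.

Lemma sim_set p x y : PI12 p -> hsym x -> hsym y -> suppL p x -> suppR p y -> is_set x -> is_set y ->
  (forall q x', PI12 q -> (p ⊆ q) -> x' ∈ x -> suppL q x' ->
     exists y', y' ∈ y /\ sim q x' y') ->
  (forall q y', PI12 q -> (p ⊆ q) -> y' ∈ y -> suppR q y' ->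
     exists x', x' ∈ x /\ sim q x' y') -> sim p x y.
Proof.
move=> Pp HSx HSy SLx SRy Sx Sy Hf Hb; apply: Phi_sim; split=> //; split=> //.
by case=> [/Sx|/Sy].
Qed.

Lemma sim_upr p x y x' y' : sim p x y -> sim p x' y' -> sim p (upr x x') (upr y y').
Proof.
move=> H H'; have [[Pp [HSx [HSy [SLx SRy]]]] _] := sim_Phi H.
have [[_ [HSx' [HSy' [SLx' SRy']]]] _] := sim_Phi H'.
apply: sim_set => //.
- exact: hsym_upr.
- exact: hsym_upr.
- by move=> g Gg Hg; rewrite smG_upr // SLx // SLx'.
- by move=> g Gg Hg; rewrite smG_upr // SRy // SRy'.
- exact: (proj1 (upr_spec _ _)).
- exact: (proj1 (upr_spec _ _)).
- move=> q w Pq Hpq /in_upr [->|->] _.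
    by exists y; split; [apply/in_upr; left|exact: sim_mono H Pq Hpq].
  by exists y'; split; [apply/in_upr; right|exact: sim_mono H' Pq Hpq].
- move=> q w Pq Hpq /in_upr [->|->] _.
    by exists x; split; [apply/in_upr; left|exact: sim_mono H Pq Hpq].
  by exists x'; split; [apply/in_upr; right|exact: sim_mono H' Pq Hpq].
Qed.

Lemma sim_pr p x y x' y' : sim p x y -> sim p x' y' -> sim p (pr x x') (pr y y').
Proof. by move=> H H'; apply: sim_upr; apply: sim_upr. Qed.
End Existence.

(** The invariant is one [p] over which all values of the two environments are similar. At a
    quantifier [p] is enlarged until the new element has a partner, and monotonicity preserves the
    similarity of the old values. *)
Lemma sat_sim (X : Type) (A1 A2 : symmodel) (D1 : A1 -> Prop) (D2 : A2 -> Prop) :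
  (forall x, D1 x <-> hsym x) -> (forall y, D2 y <-> hsym y) ->
  forall (phi : formula X) (e1 : X -> substructure D1) (e2 : X -> substructure D2) p,
  PIso A1 A2 p -> (forall i, sim p (proj1_sig (e1 i)) (proj1_sig (e2 i))) ->
  sat e1 phi <-> sat e2 phi.
Proof.
move=> H1 H2 phi; elim: phi => {X} /=.
- by move=> X i j e1 e2 p Pp He; exact: sim_mem (He j) (He i).
- by move=> X i e1 e2 p Pp He; exact: sim_atom (He i).
- move=> X i j e1 e2 p Pp He; have Hi := He i; have Hj := He j.
  have U (M : structure) (D : M -> Prop) (a b : substructure D) : proj1_sig a = proj1_sig b -> a = b.
    by move: a b => [a Ha] [b Hb] /= E; subst b; rewrite (proof_irrelevance _ Ha Hb).
  split=> E; apply: U; first by rewrite E in Hi; exact: sim_fun Hi Hj.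
  by rewrite E in Hi; exact: sim_inj Hi Hj.
- by [].
- by move=> X f IHf g IHg e1 e2 p Pp He; rewrite (IHf e1 e2 p Pp He) (IHg e1 e2 p Pp He).
- move=> X f IH e1 e2 p Pp He; split.
  + move=> Hall b; have [q [a [Pq [Hpq Hs]]]] := sim_extend (proj1 (H2 _) (proj2_sig b)) (PI_conv Pp).
    have Hs' := sim_conv Hs; have [[Pcq [Ha _]] _] := sim_Phi Hs'.
    have Hsub := conv_sub_r Pp Pq Hpq.
    apply/(IH (env_cons (exist _ a (proj2 (H1 a) Ha) : substructure D1) e1) (env_cons b e2) (conv q) Pcq).
      by move=> [i|] //=; exact: sim_mono (He i) Pcq Hsub.
    exact: Hall.
  + move=> Hall a; have [q [b [Pq [Hpq Hs]]]] := sim_extend (proj1 (H1 _) (proj2_sig a)) Pp.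
    have [[_ [_ [Hb _]]] _] := sim_Phi Hs.
    apply/(IH (env_cons a e1) (env_cons (exist _ b (proj2 (H2 b) Hb) : substructure D2) e2) q Pq).
      by move=> [i|] //=; exact: sim_mono (He i) Pq Hpq.
    exact: Hall.
Qed.

(** * The two structures of atoms are similar *)

Section Underline.
Context (A : symmodel).

Lemma smG_atoms (S g : A) : (is_set S /\ forall a, a ∈ S <-> atom a) -> smG g -> ac g S = S.
Proof.
move=> [SS hsym] Gg; have [k [Gk [Hkg Hgk]]] := smG_inv Gg.
apply: (smG_eq Gg) => // w; rewrite hsym; split=> [Aw|[z [/hsym Az ->]]]; last exact/(smG_atom _ Gg).
exists (ac k w); rewrite Hgk; split=> //; apply/hsym; exact/(smG_atom _ Gk).
Qed.

Lemma smG_order (T g : A) : (is_set T /\ forall t, t ∈ T <->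
    exists d e, smle A d e /\ t = pr (atm A d) (atm A e)) -> smG g -> ac g T = T.
Proof.
move=> [ST HT] Gg; have [k [Gk [Hkg Hgk]]] := smG_inv Gg; have L := do_linear (so_dense (sm_order A)).
have closed f : smG f -> forall t, t ∈ T -> ac f t ∈ T.
  move=> Gf t /HT [d [e [Hde ->]]]; have [Xd Xe] := lin_dom L Hde; apply/HT.
  exists (pt f d), (pt f e); rewrite smG_pr // !pt_atm //; split=> //.
  exact/(pt_le Gf Xd Xe).
apply: (smG_eq Gg) => // w; split=> [Hw|[z [Hz ->]]]; last exact: closed.
by exists (ac k w); rewrite Hgk; split=> //; exact: closed.
Qed.

Lemma hsym_fixed (x : A) : (forall g, smG g -> ac g x = x) -> (forall z, z ∈ x -> hsym z) -> hsym x.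
Proof.
move=> H1 H2; apply/hsym_unfold; split=> //; exists emp; split; first exact: Fin_emp.
by split=> [d /in_emp|g Gg _] //; exact: H1.
Qed.

Lemma hsym_atoms (S : A) : (is_set S /\ forall a, a ∈ S <-> atom a) -> hsym S.
Proof.
move=> hsym'; apply: hsym_fixed => [g|z /(proj2 hsym') Az]; first exact: smG_atoms.
by have [d [Xd ->]] := atm_surj Az; exact: hsym_atm.
Qed.

Lemma hsym_order (T : A) : (is_set T /\ forall t, t ∈ T <->
    exists d e, smle A d e /\ t = pr (atm A d) (atm A e)) -> hsym T.
Proof.
move=> HT; apply: hsym_fixed => [g|z /(proj2 HT) [d [e [Hde ->]]]]; first exact: smG_order.
have [Xd Xe] := lin_dom (do_linear (so_dense (sm_order A))) Hde.
by apply: hsym_pr; exact: hsym_atm.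
Qed.
End Underline.

Lemma sim_underline (A1 A2 : symmodel) (S1 T1 : A1) (S2 T2 : A2) :
  (is_set S1 /\ forall a, a ∈ S1 <-> atom a) -> (is_set S2 /\ forall a, a ∈ S2 <-> atom a) ->
  (is_set T1 /\ forall t, t ∈ T1 <-> exists d e, smle A1 d e /\ t = pr (atm A1 d) (atm A1 e)) ->
  (is_set T2 /\ forall t, t ∈ T2 <-> exists d e, smle A2 d e /\ t = pr (atm A2 d) (atm A2 e)) ->
  sim emp (pr S1 T1) (pr S2 T2).
Proof.
move=> HS1 HS2 HT1 HT2; have P0 : PIso A1 A2 emp by exact: PI_emp.
have fst_fix (A : symmodel) (g a b : A) : smG g -> ac g (pr a b) = pr a b -> ac g a = a /\ ac g b = b.
  by move=> Gg; rewrite smG_pr // => /pr_inj.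
apply: sim_pr; apply: sim_set => //.
- exact: hsym_atoms HS1.
- exact: hsym_atoms HS2.
- by move=> g Gg _; exact: smG_atoms.
- by move=> g Gg _; exact: smG_atoms.
- by case: HS1.
- by case: HS2.
- move=> q x Pq _ /(proj2 HS1) /(@atm_surj A1) [d [Xd ->]] Sx.
  have [e He] := suppL_atm Pq Xd Sx; have [_ Xe] := PI_dom Pq He.
  exists (atm A2 e); split; last exact: sim_atm.
  by apply/(proj2 HS2); exact: atm_atom.
- move=> q y Pq _ /(proj2 HS2) /(@atm_surj A2) [e [Xe ->]] Sy.
  have [|d Hd] := suppL_atm (PI_conv Pq) Xe.
    by apply/(@suppL_conv A1 A2) => //; exact: (proj1 Pq).
  move/(in_conv _ _ (proj1 Pq)): Hd => Hd; have [Xd _] := PI_dom Pq Hd.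
  exists (atm A1 d); split; last exact: sim_atm.
  by apply/(proj2 HS1); exact: atm_atom.
- exact: hsym_order HT1.
- exact: hsym_order HT2.
- by move=> g Gg _; exact: smG_order.
- by move=> g Gg _; exact: smG_order.
- by case: HT1.
- by case: HT2.
(* What fixes an ordered pair of atoms fixes both entries, so a support of the pair contains both
   points. Hence [q] is defined at [d] and [d'], and it preserves their order. *)
- move=> q x Pq _ /(proj2 HT1) [d [d' [Hd ->]]] Sx.
  have [Xd Xd'] := lin_dom (do_linear (so_dense (sm_order A1))) Hd.
  have [|e He] := suppL_atm Pq Xd; first by move=> g Gg Hg; case: (fst_fix _ _ _ _ Gg (Sx g Gg Hg)).
  have [|e' He'] := suppL_atm Pq Xd'; first by move=> g Gg Hg; case: (fst_fix _ _ _ _ Gg (Sx g Gg Hg)).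
  exists (pr (atm A2 e) (atm A2 e')); split; last by apply: sim_pr; exact: sim_atm.
  apply/(proj2 HT2); exists e, e'; split=> //.
  exact/(proj2 (proj2 Pq) _ _ _ _ He He').
- move=> q y Pq _ /(proj2 HT2) [e [e' [He ->]]] Sy.
  have [Xe Xe'] := lin_dom (do_linear (so_dense (sm_order A2))) He.
  have Sc (b : A2) : (forall g, smG g -> ac g (pr (atm A2 e) (atm A2 e')) = pr (atm A2 e) (atm A2 e') -> ac g b = b) ->
    suppL (conv q) b.
    move=> Hb; apply/(@suppL_conv A1 A2); first exact: (proj1 Pq).
    by move=> g Gg Hg; apply: Hb => //; exact: Sy.
  have [|d Hd] := suppL_atm (PI_conv Pq) Xe; first by apply: Sc => g Gg /(fst_fix _ _ _ _ Gg) [].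
  have [|d' Hd'] := suppL_atm (PI_conv Pq) Xe'; first by apply: Sc => g Gg /(fst_fix _ _ _ _ Gg) [].
  move/(in_conv _ _ (proj1 Pq)): Hd => Hd; move/(in_conv _ _ (proj1 Pq)): Hd' => Hd'.
  exists (pr (atm A1 d) (atm A1 d')); split; last by apply: sim_pr; exact: sim_atm.
  apply/(proj2 HT1); exists d, d'; split=> //.
  exact/(proj2 (proj2 Pq) _ _ _ _ Hd Hd').
Qed.

(** * The permutation model of an ordered set *)

Definition pe_step (y f v : V) : Prop := exists s, tagged0 v s /\
  forall w, w ∈ s <-> exists z, z ∈ y /\ app f z w.
Instance Def3_pe_step : Def3 pe_step.
Proof. by rewrite /pe_step; dfn. Qed.

Lemma pe_step_total (u f : V) : is_function f ->
  (forall z, z ∈ u -> exists w, app f z w) -> exists v, pe_step u f v.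
Proof.
move=> [_ Ff] Hf.
have D : Def1 (fun w : V => exists z, z ∈ u /\ app f z w) by dfn.
have [|s Hs] := V_mk D.
  by apply: (Bdd_ex (V_bdd u)); try (by dfn); move=> z _; exact: Ff.
by exists (pr s emp), s; split=> //; apply/tagged0E.
Qed.

Lemma pe_step_unique (u f g v v' : V) : is_function f -> is_function g ->
  (forall z, z ∈ u -> exists w, app f z w /\ app g z w) ->
  pe_step u f v -> pe_step u g v' -> v = v'.
Proof.
move=> [_ Ff] [_ Fg] Hfg [s [/tagged0E -> Hs]] [s' [/tagged0E -> Hs']].
have -> // : s = s'.
apply: V_ext => w; rewrite Hs Hs'; split=> -[z [Hz Hw]]; have [w0 [H1 H2]] := Hfg z Hz;
  exists z; split=> //.
  by rewrite (Ff _ _ _ Hw H1).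
by rewrite (Fg _ _ _ Hw H2).
Qed.

Instance Def2_pure_embedding : Def2 (@pure_embedding V).
Proof. exact: (Def2_by_recursion (step := pe_step)). Qed.

Lemma pure_embedding_unique (y v v' : V) : pure_embedding y v -> pure_embedding y v' -> v = v'.
Proof. exact: (recursion_unique pe_step_unique). Qed.

Lemma pure_embedding_total (y : V) : exists v, pure_embedding y v.
Proof. exact: (recursion_total pe_step_total pe_step_unique). Qed.

Lemma pure_embedding_inv (y v : V) : pure_embedding y v -> exists s, v = pr s emp /\
  forall w, w ∈ s <-> exists z, z ∈ y /\ pure_embedding z w.
Proof.
move=> H; have [f [Ff [Cf [Rf [s [/tagged0E -> Hs]]]]]] := recursion_inv (H : by_recursion pe_step y v).
exists s; split=> // w; rewrite Hs; split=> -[z [Hz Hw]]; exists z; split=> //; first exact: Rf.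
by have [w' Hw'] := Cf z Hz; rewrite (pure_embedding_unique Hw (Rf _ _ Hw')).
Qed.

(** * Pure sets, atoms and automorphisms in the universe over [X] *)

Section Pure.
Context (X : V).
Notation M := (Vstar X).

Lemma in_Vstar_pure (y v : V) : pure_embedding y v -> in_Vstar X v.
Proof.
move: y v; apply: V_ind; first by dfn.
move=> y IH v /pure_embedding_inv [s [-> Hs]]; apply: in_Vstar_set => w /Hs [z [Hz Hw]].
exact: IH Hz _ Hw.
Qed.

Definition pure (y : V) : M := iota (fun m : M => pure_embedding y (proj1_sig m)).
Instance DefF1_pure : DefF1 pure.
Proof. by rewrite /pure; dfn. Qed.

Lemma sval_inj (a b : M) : proj1_sig a = proj1_sig b -> a = b.
Proof. exact: (@inj_inj _ (Sort_Vstar X)). Qed.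

Lemma pureE (y : V) (m : M) : pure_embedding y (proj1_sig m) <-> m = pure y.
Proof.
have U (m1 m2 : M) : pure_embedding y (proj1_sig m1) -> pure_embedding y (proj1_sig m2) -> m1 = m2.
  by move=> H1 H2; apply: sval_inj; exact: pure_embedding_unique H1 H2.
have [v Hv] := pure_embedding_total y.
have T : exists m : M, pure_embedding y (proj1_sig m).
  by exists (exist _ v (in_Vstar_pure Hv)).
split=> [H|->]; last by refine (iota_spec (P := fun m : M => pure_embedding y (proj1_sig m)) T _) => a b Ha Hb; exact: U Hb Ha.
by symmetry; refine (iota_eq (P := fun m : M => pure_embedding y (proj1_sig m)) H _) => z Hz; exact: U Hz H.
Qed.

Lemma pure_spec (y : V) : exists s, proj1_sig (pure y) = pr s emp /\
  forall w : M, proj1_sig w ∈ s <-> exists z, z ∈ y /\ w = pure z.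
Proof.
have /pure_embedding_inv [s [E Hs]] : pure_embedding y (proj1_sig (pure y)) by apply/pureE.
exists s; split=> // w; rewrite Hs; split=> -[z [Hz Hw]]; exists z; split=> //.
  exact/pureE.
exact/pureE.
Qed.

Lemma pure_mem (w : M) (y : V) : w ∈ pure y <-> exists z, z ∈ y /\ w = pure z.
Proof. by have [s [E Hs]] := pure_spec y; rewrite (Vstar_mem_tag _ E) Hs. Qed.

Lemma pure_set (y : V) : is_set (pure y).
Proof.
have [s [E Hs]] := pure_spec y => /Vstar_atom [z E'].
by apply: (@tag_neq s z); rewrite -E.
Qed.

Lemma pure_eq (y : V) (m : M) : is_set m -> (forall w, w ∈ m <-> exists z, z ∈ y /\ w = pure z) -> m = pure y.
Proof.
move=> Sm H; apply: (@u_ext M _) => //; first exact: pure_set.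
by move=> w; rewrite H pure_mem.
Qed.

Lemma pure_inj (x y : V) : pure x = pure y -> x = y.
Proof.
move: x y; apply: V_ind; first by dfn.
move=> x IH y E; apply: V_ext => z; split=> Hz.
  have : pure z ∈ pure y by rewrite -E; apply/pure_mem; exists z.
  by move/pure_mem => [z' [Hz' E']]; rewrite (IH z Hz z' E').
have : pure z ∈ pure x by rewrite E; apply/pure_mem; exists z.
by move/pure_mem => [z' [Hz' E']]; rewrite -(IH z' Hz' z (esym E')).
Qed.

Lemma pure_upr (x y : V) : upr (pure x) (pure y) = pure (upr x y).
Proof.
apply: pure_eq; first exact: (proj1 (upr_spec _ _)).
move=> w; rewrite in_upr; split=> [[->|->]|[z [/in_upr [->|->] ->]]]; auto.
  by exists x; split=> //; apply/in_upr; left.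
by exists y; split=> //; apply/in_upr; right.
Qed.

Lemma pure_pr (x y : V) : pr (pure x) (pure y) = pure (pr x y).
Proof. by rewrite /pr !pure_upr. Qed.

Lemma pure_emp : emp = pure emp.
Proof.
apply: pure_eq; first exact: (proj1 emp_spec).
by move=> w; split=> [/in_emp|[z [/in_emp]]].
Qed.

Lemma pure_suc (x : V) : suc (pure x) = pure (suc x).
Proof.
apply: pure_eq; first exact: (proj1 (suc_spec _)).
move=> w; rewrite in_suc; split=> [[/pure_mem [z [Hz ->]]|->]|[z [/in_suc [Hz|->] ->]]]; auto.
- by exists z; split=> //; apply/in_suc; left.
- by exists x; split=> //; apply/in_suc; right.
- by left; apply/pure_mem; exists z.
Qed.

(** The pure copy of the set of natural numbers of [V] is an inductive set of the universe over [X],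
    hence contains all its natural numbers. *)
Lemma is_nat_Vstar (n : M) : is_nat n -> exists k, is_nat k /\ n = pure k.
Proof.
have [|N HN] := V_mk _ Bdd_nat; first by dfn.
have : inductive_set (pure N).
  split; first exact: pure_set.
  split; first by exists emp; split; [exact/is_emptyE|rewrite pure_emp; apply/pure_mem; exists emp; split=> //; apply/HN; exact: is_nat_emp].
  move=> y /pure_mem [k [/HN Hk ->]]; exists (suc (pure k)); split; first exact/is_succE.
  by rewrite pure_suc; apply/pure_mem; exists (suc k); split=> //; apply/HN; exact: is_nat_suc.
by move=> H /(_ _ H) /pure_mem [k [/HN Hk ->]]; exists k.
Qed.

Definition vatm (d : V) : M := iota (fun a : M => proj1_sig a = pr d (suc emp)).
Instance DefF1_vatm : DefF1 vatm.
Proof. by rewrite /vatm; dfn. Qed.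

Lemma vatm_spec d : d ∈ X -> proj1_sig (vatm d) = pr d (suc emp).
Proof.
move=> Xd.
refine (iota_spec (P := fun a : M => proj1_sig a = pr d (suc emp)) _ _).
  by exists (exist _ _ (in_Vstar_atom Xd)).
by move=> a b Ha Hb; apply: sval_inj; rewrite Ha Hb.
Qed.

Lemma vatm_eq (a : M) d : d ∈ X -> proj1_sig a = pr d (suc emp) -> a = vatm d.
Proof. by move=> Xd E; apply: sval_inj; rewrite vatm_spec. Qed.

Lemma vatm_atom d : d ∈ X -> atom (vatm d).
Proof. by move=> Xd; apply/Vstar_atom; exists d; exact: vatm_spec. Qed.

Lemma vatm_surj (a : M) : atom a -> exists d, d ∈ X /\ a = vatm d.
Proof.
move=> /Vstar_atom [z E]; case: (in_Vstar_inv (proj2_sig a)) => [[x [Xx E']]|[y [E' _]]].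
  by exists x; split=> //; exact: vatm_eq.
by case: (@tag_neq y z); rewrite -E.
Qed.

Lemma vatm_inj d e : d ∈ X -> e ∈ X -> vatm d = vatm e -> d = e.
Proof. by move=> Xd Xe E; have := vatm_spec Xd; rewrite E vatm_spec // => /pr_inj []. Qed.

Lemma to_atomE (d a : M) : to_atom d a <-> exists x, x ∈ X /\ d = pure x /\ a = vatm x.
Proof.
split=> -[x [Xx [H1 H2]]]; exists x; split=> //.
  by split; [apply/pureE|apply: vatm_eq => //; apply/tagged1E].
by split; [apply/pureE|apply/tagged1E; rewrite H2 vatm_spec].
Qed.

Lemma Bdd_atoms : Bdd (fun a : M => atom a).
Proof.
have [b Hb] := Bdd_image1 (P := fun x : V => x ∈ X) (F := fun x => pr x (suc emp)) (V_bdd X) ltac:(dfn) ltac:(dfn).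
by exists b => a /vatm_surj [d [Xd ->]]; apply: Hb; exists d; split=> //; exact: vatm_spec.
Qed.

Definition atoms : M := setof (fun a : M => atom a).
Lemma atoms_spec : is_set atoms /\ forall a, a ∈ atoms <-> atom a.
Proof. by apply: setof_spec; try (by dfn); exact: Bdd_atoms. Qed.
Lemma in_atoms (a : M) : a ∈ atoms <-> atom a.
Proof. exact: (proj2 atoms_spec). Qed.

Context (L : V) (L_pairs : forall l, l ∈ L -> exists x y, x ∈ X /\ y ∈ X /\ l = pr x y).
Let le (x y : V) : Prop := pr x y ∈ L.

Definition atom_order : M := setof (fun t : M => exists d e, pr d e ∈ L /\ t = pr (vatm d) (vatm e)).
Lemma atom_order_spec : is_set atom_order /\
  forall t, t ∈ atom_order <-> exists d e, pr d e ∈ L /\ t = pr (vatm d) (vatm e).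
Proof.
apply: setof_spec; first by dfn.
refine (Bdd_sub (@Bdd_pr M _ (fun a => atom a) (fun a => atom a) u_atom u_atom Bdd_atoms Bdd_atoms) _).
move=> t [d [e [/L_pairs [x [y [Xx [Xy /pr_inj [E1 E2]]]]] ->]]]; subst x y.
by exists (vatm d), (vatm e); split; [exact: vatm_atom|split; [exact: vatm_atom|]].
Qed.

Lemma app_atom_order d e : d ∈ X -> e ∈ X -> app atom_order (vatm d) (vatm e) <-> pr d e ∈ L.
Proof.
move=> Xd Xe; rewrite appE (proj2 atom_order_spec); split=> [[d' [e' [H /pr_inj [E1 E2]]]]|H]; last by exists d, e.
have [x [y [Xx [Xy /pr_inj [E3 E4]]]]] := L_pairs H; subst x y.
by rewrite (vatm_inj Xd Xx E1) (vatm_inj Xe Xy E2).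
Qed.

Lemma is_underlineE (u : M) : is_underline L u <-> u = pr atoms atom_order.
Proof.
have Hord (T : M) (R : M) : R = pure L -> (forall p : M, p ∈ T <-> exists d d' a a',
   app R d d' /\ to_atom d a /\ to_atom d' a' /\ is_pair p a a') <->
   (forall p : M, p ∈ T <-> exists d e, pr d e ∈ L /\ p = pr (vatm d) (vatm e)).
  move=> ->; have K (p : M) : (exists d d' a a', app (pure L) d d' /\ to_atom d a /\ to_atom d' a' /\ is_pair p a a') <->
     (exists d e, pr d e ∈ L /\ p = pr (vatm d) (vatm e)).
    split.
      move=> [d [d' [a [a' [/appE /pure_mem [l [Hl El]] [/to_atomE [x [Xx [Ed Ea]]] [/to_atomE [y [Xy [Ed' Ea']]] /is_pairE ->]]]]]]].
      subst d d' a a'; exists x, y; split=> //.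
      by move: El; rewrite pure_pr => /pure_inj ->.
    move=> [d [e [H ->]]]; have [x [y [Xx [Xy /pr_inj [E3 E4]]]]] := L_pairs H; subst x y.
    exists (pure d), (pure e), (vatm d), (vatm e); split.
      by apply/appE; rewrite pure_pr; apply/pure_mem; exists (pr d e).
    by split; [apply/to_atomE; exists d|split; [apply/to_atomE; exists e|apply/is_pairE]].
  by split=> H p; rewrite H K.
split.
  move=> [A [FA [D [R [S [T [/is_pairE -> [/pureE -> [/is_pairE E [/is_pairE -> [[SS hsym] [ST HT]]]]]]]]]]]].
  move: E; rewrite -pure_pr => /pr_inj [_ ER].
  have -> : S = atoms by symmetry; apply: setof_eq.
  have -> // : T = atom_order.
  by symmetry; apply: setof_eq => //; apply/(Hord T R (esym ER)).
move=> ->; exists (pr X L), (pure (pr X L)), (pure X), (pure L), atoms, atom_order.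
split; first exact/is_pairE.
split; first exact/pureE.
split; first by apply/is_pairE; rewrite pure_pr.
split; first exact/is_pairE.
split; first exact: atoms_spec.
split; first exact: (proj1 atom_order_spec).
by apply/(Hord _ _ erefl); exact: (proj2 atom_order_spec).
Qed.

Notation aut := (autom atoms atom_order).
Notation Perm := (is_permutation atoms).

Lemma aut_perm (g : M) : aut g -> Perm g.
Proof. by case. Qed.

Lemma ac_pure (g : M) (y : V) : Perm g -> ac g (pure y) = pure y.
Proof.
move=> Pg; move: y; apply: V_ind; first by dfn.
move=> y IH; apply: (ac_eq in_atoms Pg); [exact: pure_set|exact: pure_set|] => w.
rewrite pure_mem; split=> [[z [Hz ->]]|[z [/pure_mem [z' [Hz' ->]] ->]]].
  by exists (pure z); split; [apply/pure_mem; exists z|rewrite IH].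
by exists z'; rewrite IH.
Qed.

Definition vpt (g : M) (d : V) : V := iota (fun e => e ∈ X /\ ac g (vatm d) = vatm e).
Instance DefF2_vpt : DefF2 vpt.
Proof. by rewrite /vpt; dfn. Qed.

Lemma vpt_spec g d : Perm g -> d ∈ X -> vpt g d ∈ X /\ ac g (vatm d) = vatm (vpt g d).
Proof.
move=> Pg Xd.
refine (iota_spec (P := fun e => e ∈ X /\ ac g (vatm d) = vatm e) _ _).
  by apply: vatm_surj; apply/(ac_atom in_atoms Pg); exact: vatm_atom.
by move=> a b [Xa Ha] [Xb Hb]; apply: vatm_inj => //; rewrite -Hb.
Qed.

Lemma aut_order g d e : aut g -> d ∈ X -> e ∈ X -> (pr d e ∈ L <-> pr (vpt g d) (vpt g e) ∈ L).
Proof.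
move=> [Pg Hg] Xd Xe; have [Xgd Ed] := vpt_spec Pg Xd; have [Xge Ee] := vpt_spec Pg Xe.
rewrite -app_atom_order // -(app_atom_order Xgd Xge); apply: Hg.
  by rewrite -Ed; apply: (ac_app in_atoms Pg); exact: vatm_atom.
by rewrite -Ee; apply: (ac_app in_atoms Pg); exact: vatm_atom.
Qed.

Context (SO : separable_order X le).

Lemma lift_automorphism g0 : piso X le X le g0 -> bijective X g0 ->
  exists g, aut g /\ forall d e, pr d e ∈ g0 -> vpt g d = e.
Proof.
move=> Ig [Tg Sg].
have L0 := do_linear (so_dense SO).
pose (R := fun a b : M => exists d e, pr d e ∈ g0 /\ a = vatm d /\ b = vatm e).
have dom d e : pr d e ∈ g0 -> d ∈ X /\ e ∈ X.
  by move=> /(proj1 Ig) [d' [e' [Xd [Xe /pr_inj [-> ->]]]]].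
have DR : Def2 R by rewrite /R; dfn.
have [|||||Pg Hg] := @permutation_graph M (Universe_Vstar X) atoms in_atoms R DR.
- by move=> a b [d [e [/dom [Xd Xe] [-> ->]]]]; split; exact: vatm_atom.
- move=> a b b' [d [e [H [-> ->]]]] [d' [e' [H' [E ->]]]].
  have [Xd Xe] := dom _ _ H; have [Xd' Xe'] := dom _ _ H'.
  by have Ed := vatm_inj Xd Xd' E; subst d'; rewrite (piso_fun (so_dense SO) (so_dense SO) Ig H H').
- move=> a a' b [d [e [H [-> ->]]]] [d' [e' [H' [-> E]]]].
  have [Xd Xe] := dom _ _ H; have [Xd' Xe'] := dom _ _ H'.
  by have Ee := vatm_inj Xe Xe' E; subst e'; rewrite (piso_inj (so_dense SO) (so_dense SO) Ig H H').
- by move=> a /vatm_surj [d [Xd ->]]; have [e He] := Tg d Xd; exists (vatm e), d, e.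
- by move=> a /vatm_surj [d [Xd ->]]; have [e He] := Sg d Xd; exists (vatm e), e, d.
exists (graph R); split; [split=> //|].
  move=> a b a' b' /Hg [d [e [H [-> ->]]]] /Hg [d' [e' [H' [-> ->]]]].
  have [Xd Xe] := dom _ _ H; have [Xd' Xe'] := dom _ _ H'.
  by rewrite !app_atom_order //; exact: (proj2 Ig).
move=> d e H; have [Xd Xe] := dom _ _ H; have [Xp Ep] := vpt_spec Pg Xd.
apply: (vatm_inj Xp Xe); rewrite -Ep; symmetry; apply: (app_ac in_atoms Pg); apply/Hg.
by exists d, e.
Qed.

Definition Vmodel : symmodel.
Proof.
refine (@Build_symmodel M _ X le SO vatm DefF1_vatm vatm_atom vatm_surj vatm_inj
  aut (Def1_autom atoms atom_order) vpt DefF2_vpt _ _ _ _ _ _ _ _).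
- by move=> g d [Pg _] Xd; case: (vpt_spec Pg Xd).
- by move=> g d [Pg _] Xd; case: (vpt_spec Pg Xd).
- by move=> g d e Ag Xd Xe; exact: aut_order.
- by move=> g w x [Pg _]; exact: (ac_mem in_atoms Pg).
- by move=> g x [Pg _]; exact: (ac_atom in_atoms Pg).
- move=> g Ag; have [h [Ah [Hh _]]] := autom_inverse in_atoms Ag.
  exists h; split=> //; split; apply: (ac_inverse in_atoms); try exact: aut_perm.
    by move=> a b; rewrite Hh.
  by move=> a b; rewrite Hh.
- move=> f g Af Ag; have [k [Ak [Hk _]]] := autom_comp in_atoms Af Ag.
  exists k; split=> //; apply: (ac_comp in_atoms); try exact: aut_perm.
  by move=> a b c H1 H2; apply/Hk; exists b.
- move=> s Ps; have [g0 [Ig [Hs Bg]]] := homogeneous SO Ps.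
  have [g [Ag Hg]] := lift_automorphism Ig Bg.
  by exists g; split=> // d e /Hs; exact: Hg.
Defined.

Lemma tuple_entry (t i a : M) : atom_tuple t -> pr i a ∈ t -> atom a /\ exists k, i = pure k.
Proof.
move=> [n [Hn [[Rt Ft] [Dt At]]]] /appE H; split; first exact: At H.
have /Dt Hi : exists a, app t i a by exists a.
have [k [_ E]] := is_nat_Vstar Hn; subst n.
by move/pure_mem: Hi => [j [_ ->]]; exists j.
Qed.

Lemma tuple_of_finite (c : V) : Fin c -> (c ⊆ X) ->
  exists t : M, atom_tuple t /\ forall d, d ∈ c -> exists i, app t i (vatm d).
Proof.
move: c; apply: Fin_ind; first by dfn.
  move=> _; exists emp; split; last by move=> d /in_emp.
  exists emp; split; first exact: is_nat_emp.
  have [Se He] := @emp_spec M _.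
  split; first by split=> [|x y y' /appE /in_emp //]; split=> // p /in_emp.
  split=> [i|i a /appE /in_emp //]; split=> [/in_emp //|[a /appE /in_emp //]].
move=> B a FB IH HX.
have [d Hd|t [[n [Hn [[Rt Ft] [Dt At]]]] Ht]] := IH; first by apply: HX; apply/in_adj; left.
have Xa : a ∈ X by apply: HX; apply/in_adj; right.
have [St' Ht'] : is_set (setof (fun p => p ∈ t \/ p = pr n (vatm a))) /\
  forall p, p ∈ setof (fun p => p ∈ t \/ p = pr n (vatm a)) <-> p ∈ t \/ p = pr n (vatm a).
  by apply: setof_spec; [dfn|apply: Bdd_or; [exact: u_bdd|exact: Bdd_one]].
move: (setof _) St' Ht' => t' St' Ht'.
have Ha i b : app t' i b <-> app t i b \/ (i = n /\ b = vatm a).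
  rewrite !appE Ht'; split=> [[H|/pr_inj []]|[H|[-> ->]]]; auto.
have Nn b : ~ app t n b.
  by move=> H; apply: (@mem_irrefl M _ n); apply/Dt; exists b.
exists t'; split; last first.
  move=> d /in_adj [/Ht [i Hi]|->]; first by exists i; apply/Ha; left.
  by exists n; apply/Ha; right.
exists (suc n); split; first exact: is_nat_suc.
split; [split; first (split=> // p /Ht' [|->])|split].
- by case: Rt => _; apply.
- by exists n, (vatm a); apply/is_pairE.
- move=> i b b' /Ha [H1|[E1 ->]] /Ha [H2|[E2 ->]] //.
  + exact: Ft H1 H2.
  + by subst i; case: (Nn b).
  + by subst i; case: (Nn b').
- move=> i; rewrite in_suc; split.
    move=> [/Dt [b Hb]|->]; first by exists b; apply/Ha; left.
    by exists (vatm a); apply/Ha; right.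
  by move=> [b /Ha [H|[-> _]]]; [left; apply/Dt; exists b|right].
- by move=> i b /Ha [/At //|[_ ->]]; exact: vatm_atom.
Qed.

(** The indices of a tuple are pure, so every automorphism fixes them. Fixing all entries therefore
    fixes the tuple; conversely an automorphism fixing the tuple keeps each index with its value,
    and functionality shows that each entry is fixed. *)
Lemma fin_supported_tuple (y : M) : (exists t, atom_tuple t /\ forall g, aut g -> ac g t = t -> ac g y = y) <->
  fin_supported (A := Vmodel) y.
Proof.
split=> [[t [Tt Ht]]|[c [Fc [Xc Sc]]]].
- have [n [Hn [[Rt Ft] [Dt At]]]] := Tt.
  have [k [Nk Ek]] := is_nat_Vstar Hn.
  have F : FinP (fun d => exists j, j ∈ k /\ (d ∈ X /\ app t (pure j) (vatm d))).
    apply: FinP_ex; [by dfn|by dfn|exact: Fin_FinP (Fin_nat Nk)|].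
    by move=> j _ d d' [Xd H1] [Xd' H2]; apply: vatm_inj => //; exact: Ft H1 H2.
  have [|c [Fc Hc]] := FinP_mk F; first by dfn.
  exists c; split=> //; split=> [d /Hc [j [_ []]] //|g Ag Hg].
  apply: Ht => //; have Pg := aut_perm Ag.
  have fix_entry p : p ∈ t -> ac g p = p.
    move=> Hp; have [i [a Ep]] := relation_mem Rt Hp; subst p.
    have [Aa [j Ej]] := tuple_entry Tt Hp; have [d [Xd Ed]] := vatm_surj Aa; subst i a.
    rewrite (ac_pr in_atoms Pg) (ac_pure _ Pg); congr pr.
    have [_ ->] := vpt_spec Pg Xd; congr vatm; apply: (Hg d); apply/Hc.
    have Ha : app t (pure j) (vatm d) by apply/appE.
    exists j; split=> //.
    have /Dt : exists a, app t (pure j) a by exists (vatm d).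
    by rewrite Ek => /pure_mem [j' [Hj' /pure_inj ->]].
  apply: (ac_eq in_atoms Pg); [by case: Rt|by case: Rt|] => w.
  split=> [Hw|[z [Hz ->]]]; last by rewrite fix_entry.
  by exists w; rewrite fix_entry.
- have [t [Tt Ht]] := tuple_of_finite Fc Xc.
  exists t; split=> // g Ag Eg; apply: Sc => // d Hd; have Pg := aut_perm Ag.
  have [i /appE Hi] := Ht d Hd.
  have [_ [j Ej]] := tuple_entry Tt Hi; subst i.
  have H : pr (pure j) (ac g (vatm d)) ∈ t.
    have <- : ac g (pr (pure j) (vatm d)) = pr (pure j) (ac g (vatm d)).
      by rewrite (ac_pr in_atoms Pg) (ac_pure _ Pg).
    rewrite -Eg; apply/(ac_mem in_atoms Pg).
    by exists (pr (pure j) (vatm d)).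
  have [n [Hn [[Rt Ft] [Dt At]]]] := Tt.
  have [Xp Ep] := vpt_spec Pg (Xc d Hd).
  apply: (vatm_inj Xp (Xc d Hd)); rewrite -Ep.
  by apply: (Ft (pure j)); apply/appE.
Qed.

Lemma PM_hsym (x : M) : (exists u G : M, is_underline L u /\ is_Aut u G /\ in_PM G (F_fin G) x) <->
  hsym (A := Vmodel) x.
Proof.
have E : in_PM (Aut atoms atom_order) (F_fin (Aut atoms atom_order)) x <-> hsym (A := Vmodel) x.
  by rewrite in_PM_Aut; [exact: in_atoms|split=> H y /H /fin_supported_tuple].
split=> [[u [G [/is_underlineE Eu [HG HP]]]]|/E H].
  rewrite Eu in HG; have EG : G = Aut atoms atom_order by apply/(is_AutE in_atoms).
  by apply/E; rewrite -EG.
exists (pr atoms atom_order), (Aut atoms atom_order).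
by split; [apply/is_underlineE|split; [apply/(is_AutE in_atoms)|]].
Qed.
End Pure.

(** * Arithmetic of V *)

Lemma nat_emp_suc (n : V) : is_nat n -> emp ∈ suc n.
Proof.
move: n; apply: nat_ind; first by dfn.
  by apply/in_suc; right.
by move=> n _ H; apply/in_suc; left.
Qed.

Lemma nat_suc_mem (n i : V) : is_nat n -> i ∈ n -> suc i ∈ suc n.
Proof.
move=> Hn; move: n Hn i; apply: nat_ind.
- by dfn.
- by move=> i /in_emp.
- move=> n Hn IH i /in_suc [/IH H|->]; apply/in_suc; by [left|right].
Qed.

Lemma mem_nat (n i : V) : is_nat n -> i ∈ n -> is_nat i.
Proof.
move=> Hn; move: n Hn i; apply: nat_ind.
- by dfn.
- by move=> i /in_emp.
- by move=> n Hn IH i /in_suc [/IH H|->].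
Qed.

Lemma nat_case (n : V) : is_nat n -> n = emp \/ exists m, is_nat m /\ n = suc m.
Proof.
move: n; apply: nat_ind; first by dfn.
  by left.
by move=> n Hn _; right; exists n.
Qed.

(** * Iteration of a class function *)

Section Iterate.
Context (S : V -> V -> Prop).

Lemma iterate_emp (a b : V) : is_iterate S a emp b <-> b = a.
Proof.
split=> [[f [[_ Ff] [[o [/is_zeroE -> Ho]] [_ Hb]]]]|->]; first exact: Ff Hb Ho.
exists (adj emp (pr emp a)).
have H i u : app (adj emp (pr emp a)) i u <-> i = emp /\ u = a.
  by rewrite appE in_adj; split=> [[/in_emp //|/pr_inj //]|[-> ->]]; right.
split; [split; [split|]|split; [|split]].
- exact: V_set.
- by move=> p /in_adj [/in_emp //|->]; exists emp, a; apply/is_pairE.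
- by move=> i u u' /H [_ ->] /H [_ ->].
- by exists emp; split; [exact/is_zeroE|apply/H].
- by move=> i /in_emp.
- exact/H.
Qed.

Lemma iterate_suc (a n b : V) : is_nat n ->
  is_iterate S a (suc n) b <-> exists u, is_iterate S a n u /\ S u b.
Proof.
move=> Hn; split.
  move=> [f [[Rf Ff] [Ho [Hs Hb]]]].
  have [|i [u [u' [/is_succE -> [Hu [Hu' Su]]]]]] := Hs n; first by apply/in_suc; right.
  rewrite (Ff _ _ _ Hb Hu'); exists u; split=> //.
  exists f; split=> //; split=> //; split=> // j Hj; apply: Hs; apply/in_suc; by left.
move=> [u [[f [[Rf Ff] [[o [/is_zeroE -> Ho]] [Hs Hu]]]] Sub]].
(* The given [f] may have a value at [suc n] already, so it is cut down to arguments below [suc n]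
   before the new pair is added. *)
have [F HF] : exists F : V, forall p, p ∈ F <-> p ∈ f /\ exists i w, i ∈ suc n /\ p = pr i w.
  by apply: V_sep; dfn.
have Nn : ~ suc n ∈ suc n by exact: mem_irrefl.
have H i w : app (adj F (pr (suc n) b)) i w <-> (i ∈ suc n /\ app f i w) \/ (i = suc n /\ w = b).
  rewrite !appE in_adj HF; split.
    by move=> [[H1 [i' [w' [H2 /pr_inj [E _]]]]]|/pr_inj [-> ->]]; [left; rewrite -E in H2|right].
  by move=> [[H1 H2]|[-> ->]]; [left; split=> //; exists i, w|right].
exists (adj F (pr (suc n) b)); split; [split; [split|]|split; [|split]].
- exact: V_set.
- move=> p /in_adj [/HF [_ [i [w [_ ->]]]]|->]; first by exists i, w; apply/is_pairE.
  by exists (suc n), b; apply/is_pairE.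
- move=> i w w' /H [[H1 H2]|[E ->]] /H [[H3 H4]|[E' ->]] //; first exact: Ff H2 H4.
    by subst i.
  by subst i.
- by exists emp; split; [exact/is_zeroE|apply/H; left; split=> //; exact: nat_emp_suc].
- move=> i /in_suc [Hi|->].
    have [i' [v [v' [/is_succE -> [Hv [Hv' Sv]]]]]] := Hs i Hi.
    exists (suc i), v, v'; split; first exact/is_succE.
    split; first by apply/H; left; split=> //; apply/in_suc; left.
    by split=> //; apply/H; left; split=> //; exact: nat_suc_mem.
  exists (suc n), u, b; split; first exact/is_succE.
  split; first by apply/H; left; split=> //; apply/in_suc; right.
  by split=> //; apply/H; right.
- by apply/H; right.
Qed.
End Iterate.

Instance Def3_nat_add : Def3 (@nat_add V).
Proof. by rewrite /nat_add /is_iterate /is_zero; dfn. Qed.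
Instance Def3_nat_mul : Def3 (@nat_mul V).
Proof. by rewrite /nat_mul /is_iterate /is_zero; dfn. Qed.

(** The natural numbers of [V] as a Rocq type: on it addition and multiplication become total
    functions, and the [ring] tactic applies. *)
Definition N := {n : V | is_nat n}.

Instance Sort_N : Sort N.
Proof.
refine {| inj := fun n : N => proj1_sig n; dflt := exist _ emp (is_nat_emp (M := V)) : N |}.
- by move=> [x Hx] [y Hy] /= E; subst y; rewrite (proof_irrelevance _ Hx Hy).
- have D : Def1 (@is_nat V) by dfn.
  have [f [c Hf]] := Def1_formula D.
  exists f, c => a; rewrite -Hf; split=> [[[y Hy] /= <- //]|Ha].
  by exists (exist _ a Ha).
Defined.

Instance DefF1_svalN : @DefF1 N V _ _ (@proj1_sig V (fun n => is_nat n)).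
Proof. exact: (@DefT_inj _ _ _ _ (fun y : unit * N => snd y) (DefT_snd _ _)). Qed.

Definition nval (n : N) : V := proj1_sig n.
Lemma nval_inj (a b : N) : nval a = nval b -> a = b.
Proof. exact: (@inj_inj _ Sort_N). Qed.

Lemma nval_nat (a : N) : is_nat (nval a).
Proof. exact: proj2_sig. Qed.

Definition N0 : N := exist _ emp (is_nat_emp (M := V)).
Definition NS (n : N) : N := exist _ (suc (nval n)) (is_nat_suc (nval_nat n)).
Definition Nadd (m n : N) : N := iota (fun k : N => nat_add (nval m) (nval n) (nval k)).
Definition Nmul (m n : N) : N := iota (fun k : N => nat_mul (nval m) (nval n) (nval k)).

Instance DefF1_NS : DefF1 NS.
Proof.
apply: DefT_eq; apply: (Def_ext (P := fun y : unit * N * N => nval (snd y) = suc (nval (snd (fst y))))).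
  by move=> [[u n] m] /=; split=> [E|->] //; exact: nval_inj.
by dfn.
Qed.
Instance DefF2_Nadd : DefF2 Nadd.
Proof. by rewrite /Nadd; dfn. Qed.
Instance DefF2_Nmul : DefF2 Nmul.
Proof. by rewrite /Nmul; dfn. Qed.

Lemma N_ind (P : N -> Prop) : Def1 P -> P N0 -> (forall n, P n -> P (NS n)) -> forall n, P n.
Proof.
move=> DP P0 PS [n Hn].
suff H : forall m, is_nat m -> forall k : N, nval k = m -> P k by exact: (H n Hn).
apply: nat_ind; first by dfn.
  by move=> k E; have -> : k = N0 by exact: nval_inj.
move=> m Hm IH k E.
have -> : k = NS (exist _ m Hm) by exact: nval_inj.
by apply: PS; exact: IH.
Qed.

Lemma nat_addE (m n k : N) : nat_add (nval m) (nval n) (nval k) <-> k = Nadd m n.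
Proof.
have H : (exists k : N, nat_add (nval m) (nval n) (nval k)) /\
    forall k1 k2 : V, nat_add (nval m) (nval n) k1 -> nat_add (nval m) (nval n) k2 -> k1 = k2.
  move: n; apply: N_ind; first by dfn.
    by split; [exists m; apply/iterate_emp|move=> k1 k2 /iterate_emp -> /iterate_emp ->].
  move=> n [[j Hj] U]; split.
    by exists (NS j); apply/iterate_suc; [exact: nval_nat|exists (nval j); split=> //; apply/is_succE].
  move=> k1 k2 /(iterate_suc _ _ _ (nval_nat n)) [u [Hu /is_succE ->]].
  by move=> /(iterate_suc _ _ _ (nval_nat n)) [u' [Hu' /is_succE ->]]; rewrite (U _ _ Hu Hu').
case: H => T U; split=> [Hk|->].
  by symmetry; refine (iota_eq (P := fun k : N => nat_add (nval m) (nval n) (nval k)) Hk _) => z Hz; apply: nval_inj; exact: U.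
by refine (iota_spec (P := fun k : N => nat_add (nval m) (nval n) (nval k)) T _) => y z Hy Hz; apply: nval_inj; exact: U.
Qed.

Lemma nat_add_N (m n : N) (k : V) : nat_add (nval m) (nval n) k <-> k = nval (Nadd m n).
Proof.
have H : nat_add (nval m) (nval n) (nval (Nadd m n)) by apply/nat_addE.
split=> [Hk|-> //].
have Hn : is_nat k.
  move: n k Hk {H}; apply: N_ind; first by dfn.
    by move=> k /iterate_emp ->; exact: nval_nat.
  by move=> n IH k /(iterate_suc _ _ _ (nval_nat n)) [u [Hu /is_succE ->]]; apply: is_nat_suc; exact: IH.
have /nat_addE <- // : nat_add (nval m) (nval n) (nval (exist _ k Hn : N)) by [].
Qed.

Lemma Nadd0 (m : N) : Nadd m N0 = m.
Proof. by symmetry; apply/nat_addE/iterate_emp. Qed.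

Lemma NaddS (m n : N) : Nadd m (NS n) = NS (Nadd m n).
Proof.
symmetry; apply/nat_addE/iterate_suc; first exact: nval_nat.
exists (nval (Nadd m n)); split; last exact/is_succE.
exact/nat_add_N.
Qed.

Lemma nat_mul_N (m n : N) (k : V) : nat_mul (nval m) (nval n) k <-> k = nval (Nmul m n).
Proof.
have H : (exists k : N, forall k' : V, nat_mul (nval m) (nval n) k' <-> k' = nval k).
  move: n; apply: N_ind; first by dfn.
    exists N0 => k'; split=> [[o [/is_zeroE -> /iterate_emp //]]|->].
    by exists emp; split; [exact/is_zeroE|exact/iterate_emp].
  move=> n [j Hj]; exists (Nadd j m) => k'; split.
    move=> [o [/is_zeroE -> /(iterate_suc _ _ _ (nval_nat n)) [u [Hu Ha]]]].
    have Eu : u = nval j by apply/Hj; exists emp; split=> //; exact/is_zeroE.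
    by subst u; exact/nat_add_N.
  move=> ->; exists emp; split; first exact/is_zeroE.
  apply/(iterate_suc _ _ _ (nval_nat n)); exists (nval j); split; last exact/nat_add_N.
  have [o [/is_zeroE -> //]] : nat_mul (nval m) (nval n) (nval j) by apply/Hj.
case: H => j Hj; rewrite Hj.
have -> // : Nmul m n = j.
refine (iota_eq (P := fun k : N => nat_mul (nval m) (nval n) (nval k)) _ _); first exact/Hj.
by move=> z /Hj; exact: nval_inj.
Qed.

Lemma Nmul0 (m : N) : Nmul m N0 = N0.
Proof.
apply: nval_inj; symmetry; apply/nat_mul_N; exists emp.
by split; [exact/is_zeroE|exact/iterate_emp].
Qed.

Lemma NmulS (m n : N) : Nmul m (NS n) = Nadd (Nmul m n) m.
Proof.
apply: nval_inj; symmetry; apply/nat_mul_N; exists emp; split; first exact/is_zeroE.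
apply/(iterate_suc _ _ _ (nval_nat n)); exists (nval (Nmul m n)); split; last exact/nat_add_N.
have [o [/is_zeroE -> //]] : nat_mul (nval m) (nval n) (nval (Nmul m n)) by apply/nat_mul_N.
Qed.

Lemma NS_inj (m n : N) : NS m = NS n -> m = n.
Proof. by move=> E; apply: nval_inj; apply: V_suc_inj; exact: (f_equal nval E). Qed.

Lemma NS_neq (m : N) : NS m <> N0.
Proof. by move=> E; apply: (@suc_neq_emp V _ (nval m)); exact: (f_equal nval E). Qed.

Lemma N0add (n : N) : Nadd N0 n = n.
Proof. by move: n; apply: N_ind; [dfn|exact: Nadd0|move=> n IH; rewrite NaddS IH]. Qed.

Lemma NSadd (m n : N) : Nadd (NS m) n = NS (Nadd m n).
Proof. by move: n; apply: N_ind; [dfn|rewrite !Nadd0|move=> n IH; rewrite !NaddS IH]. Qed.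

Lemma NaddC (m n : N) : Nadd m n = Nadd n m.
Proof. by move: n; apply: N_ind; [dfn|rewrite Nadd0 N0add|move=> n IH; rewrite NaddS NSadd IH]. Qed.

Lemma NaddA (m n k : N) : Nadd m (Nadd n k) = Nadd (Nadd m n) k.
Proof. by move: k; apply: N_ind; [dfn|rewrite !Nadd0|move=> k IH; rewrite !NaddS IH]. Qed.

Lemma N0mul (n : N) : Nmul N0 n = N0.
Proof. by move: n; apply: N_ind; [dfn|exact: Nmul0|move=> n IH; rewrite NmulS IH Nadd0]. Qed.

Lemma NSmul (m n : N) : Nmul (NS m) n = Nadd (Nmul m n) n.
Proof.
move: n; apply: N_ind; [by dfn|by rewrite !Nmul0 Nadd0|move=> n IH].
by rewrite !NmulS IH !NaddS -!NaddA (NaddC n m).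
Qed.

Lemma NmulC (m n : N) : Nmul m n = Nmul n m.
Proof. by move: n; apply: N_ind; [dfn|rewrite Nmul0 N0mul|move=> n IH; rewrite NmulS NSmul IH]. Qed.

Lemma NmulDl (m n k : N) : Nmul (Nadd m n) k = Nadd (Nmul m k) (Nmul n k).
Proof.
move: k; apply: N_ind; [by dfn|by rewrite !Nmul0 Nadd0|move=> k IH].
by rewrite !NmulS IH -!NaddA (NaddA (Nmul n k)) (NaddC (Nmul n k) m) -!NaddA.
Qed.

Lemma NmulA (m n k : N) : Nmul m (Nmul n k) = Nmul (Nmul m n) k.
Proof.
move: k; apply: N_ind; [by dfn|by rewrite !Nmul0|move=> k IH].
by rewrite !NmulS -IH NmulC NmulDl NmulC (NmulC n m).
Qed.

Definition N1 := NS N0.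

Lemma N_semiring : semi_ring_theory N0 N1 Nadd Nmul (@eq N).
Proof.
split.
- exact: N0add.
- exact: NaddC.
- exact: NaddA.
- by move=> n; rewrite /N1 NSmul N0mul N0add.
- exact: N0mul.
- exact: NmulC.
- exact: NmulA.
- exact: NmulDl.
Qed.

Add Ring N_ring : N_semiring.

Declare Scope internal_nat_scope.
Delimit Scope internal_nat_scope with I.
Notation "a + b" := (Nadd a b) : internal_nat_scope.
Notation "a * b" := (Nmul a b) : internal_nat_scope.

Lemma NS_add1 (n : N) : NS n = (N1 + n)%I.
Proof. by rewrite /N1 NSadd N0add. Qed.

Lemma Nadd_cancel (m n k : N) : (m + k = n + k)%I -> m = n.
Proof.
move: k; apply: N_ind; [by dfn|by rewrite !Nadd0|].
by move=> k IH; rewrite !NaddS => /NS_inj.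
Qed.

Lemma N_case (n : N) : n = N0 \/ exists m, n = NS m.
Proof.
move: n; apply: N_ind; [by dfn|by left|by move=> n _; right; exists n].
Qed.

Lemma Nmem_add (m n : N) : nval m ∈ nval n <-> exists k, n = (m + NS k)%I.
Proof.
move: n; apply: N_ind; first by dfn.
  split=> [/in_emp //|[k]]; rewrite NaddS => E; by case: (NS_neq (esym E)).
move=> n IH; rewrite in_suc; split.
  move=> [/IH [k ->]|/nval_inj ->]; last by exists N0; rewrite NaddS Nadd0.
  by exists (NS k); rewrite !NaddS.
move=> [k]; rewrite NaddS => /NS_inj ->.
have [->|[j ->]] := N_case k; first by right; rewrite Nadd0.
left; move: IH => _; rewrite NaddS.
move: j; apply: N_ind; first by dfn.
  by rewrite Nadd0; apply/in_suc; right.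
by move=> j H; rewrite NaddS; apply/in_suc; left.
Qed.

Lemma N_trichotomy (m n : N) : (exists k, n = m + NS k)%I \/ m = n \/ (exists k, m = n + NS k)%I.
Proof.
rewrite -!Nmem_add.
have [H|[H|H]] := ordinal_trichotomy (nat_ordinal (nval_nat m)) (nat_ordinal (nval_nat n)); auto.
by right; left; exact: nval_inj.
Qed.

Lemma nat_leE (m n : N) : nat_le (nval m) (nval n) <-> exists k, n = (m + k)%I.
Proof.
split=> [[/Nmem_add [k E]|/nval_inj ->]|[k ->]].
- by exists (NS k).
- by exists N0; rewrite Nadd0.
- have [->|[j ->]] := N_case k; first by right; rewrite Nadd0.
  by left; apply/Nmem_add; exists j.
Qed.

(** * Comparison of fractions by cross-multiplication *)

Local Open Scope internal_nat_scope.

(* The order of [(a - b) / (c + 1)] and [(a' - b') / (c' + 1)]: taking [c + 1]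
   for the denominator avoids the side condition that it is nonzero. *)
Definition Fle (a b c a' b' c' : N) : Prop :=
  exists k, a' * NS c + b * NS c' = a * NS c' + b' * NS c + k.
Definition Flt (a b c a' b' c' : N) : Prop :=
  exists k, a' * NS c + b * NS c' = a * NS c' + b' * NS c + NS k.

Lemma NS_mul (c d : N) : exists k, NS c * NS d = NS k.
Proof. by exists (NS c * d + c); rewrite NmulS NaddS. Qed.

Lemma Nadd_NS_neq (m k : N) : m <> m + NS k.
Proof.
move=> E; have {}E : N0 + m = NS k + m by rewrite N0add NaddC -E.
by move/Nadd_cancel: E => /esym; exact: NS_neq.
Qed.

Lemma Fle_total (a b c a' b' c' : N) : Fle a b c a' b' c' \/ Flt a' b' c' a b c.
Proof.
have [[k E]|[E|[k E]]] := N_trichotomy (a * NS c' + b' * NS c) (a' * NS c + b * NS c').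
- by left; exists (NS k).
- by left; exists N0; rewrite E Nadd0.
- by right; exists k.
Qed.

Lemma Flt_not (a b c a' b' c' : N) : Flt a b c a' b' c' <-> ~ Fle a' b' c' a b c.
Proof.
split=> [[k E] [j E']|H]; last by case: (Fle_total a' b' c' a b c).
rewrite E -NaddA NSadd in E'; exact: Nadd_NS_neq E'.
Qed.

Lemma Fle_refl (a b c : N) : Fle a b c a b c.
Proof. by exists N0; rewrite Nadd0. Qed.

Lemma Flt_le (a b c a' b' c' : N) : Flt a b c a' b' c' -> Fle a b c a' b' c'.
Proof. by move=> [k E]; exists (NS k). Qed.

Lemma Fle_trans (a b c a' b' c' a'' b'' c'' : N) :
  Fle a b c a' b' c' -> Fle a' b' c' a'' b'' c'' -> Fle a b c a'' b'' c''.
Proof.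
move=> [k1 H1] [k2 H2].
have [//|[j Hj]] := Fle_total a b c a'' b'' c''.
set C := NS c in H1 H2 Hj *; set C' := NS c' in H1 H2 Hj *; set C'' := NS c'' in H1 H2 Hj *.
(* The first inequality times [C''] plus the second times [C] is the desired one times [C'], up to
   equal terms on both sides. Against the opposite strict inequality [Hj], a number would equal
   itself plus a successor, as [C'] is positive. *)
have E : C' * (a'' * C + b * C'') + (a' * C * C'' + b' * C * C'') =
   C' * (a * C'' + b'' * C) + (a' * C * C'' + b' * C * C'') + (k1 * C'' + k2 * C).
  transitivity (C'' * (a' * C + b * C') + C * (a'' * C' + b' * C'')); first by ring.
  by rewrite H1 H2; ring.
have [i Hi] : exists i, C' * NS j = NS i by exact: NS_mul.
exfalso; apply: (@Nadd_NS_neq (C' * (a'' * C + b * C'') + (a' * C * C'' + b' * C * C'')) (i + (k1 * C'' + k2 * C))).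
rewrite {1}E Hj -NSadd -Hi; ring.
Qed.

Lemma F_dense (a b c a' b' c' : N) : Flt a b c a' b' c' ->
  exists a'' b'' c'', Flt a b c a'' b'' c'' /\ Flt a'' b'' c'' a' b' c'.
Proof.
move=> [k H].
set C := NS c in H *; set C' := NS c' in H *.
have [d Hd] : exists d, C * C' + C * C' = NS d.
  by have [i Hi] := NS_mul c c'; exists (C * C' + i); rewrite -NaddS -Hi.
(* The midpoint of the two fractions, with denominator [NS d] equal to twice [C * C']. *)
exists (a * C' + a' * C), (b * C' + b' * C), d; split.
  have [i Hi] : exists i, C * NS k = NS i by exact: NS_mul.
  exists i; rewrite -Hd -Hi.
  transitivity (a * C' * C + b * C * C' + C * (a' * C + b * C')); first by rewrite -/C; ring.
  by rewrite H -/C; ring.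
have [i Hi] : exists i, C' * NS k = NS i by exact: NS_mul.
exists i; rewrite -Hd -Hi.
transitivity (a' * C * C' + b' * C * C' + C' * (a' * C + b * C')); first by rewrite -/C'; ring.
by rewrite H -/C'; ring.
Qed.

Lemma F_above (a b c : N) : Flt a b c (a + NS c) b c.
Proof. by have [k E] := NS_mul c c; exists k; rewrite -E; ring. Qed.

Lemma F_below (a b c : N) : Flt a (b + NS c) c a b c.
Proof. by have [k E] := NS_mul c c; exists k; rewrite -E; ring. Qed.

Definition frac (a b c : N) : V := pr (pr (nval a) (nval b)) (nval (NS c)).
Instance Def2_fraction_le : Def2 (@fraction_le V).
Proof. by rewrite /fraction_le /is_fraction /is_zero /nat_le; dfn. Qed.

Lemma is_fractionE (t a b c : V) : is_fraction t a b c <->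
  exists a' b' c' : N, t = frac a' b' c' /\ a = nval a' /\ b = nval b' /\ c = nval (NS c').
Proof.
split.
  move=> [Na [Nb [Nc [Hc [p [/is_pairE -> /is_pairE ->]]]]]].
  case: (nat_case Nc) => [E|[m [Nm E]]]; first by case: Hc; apply/is_zeroE.
  by exists (exist _ a Na : N), (exist _ b Nb : N), (exist _ m Nm : N); rewrite /frac E.
move=> [a' [b' [c' [-> [-> [-> ->]]]]]].
split; [exact: nval_nat|split; [exact: nval_nat|split; [exact: nval_nat|split]]].
  by move=> /is_zeroE; exact: suc_neq_emp.
by exists (pr (nval a') (nval b')); split; apply/is_pairE.
Qed.

Lemma frac_inj (a b c a' b' c' : N) : frac a b c = frac a' b' c' -> a = a' /\ b = b' /\ c = c'.
Proof.
move=> /pr_inj [/pr_inj [/nval_inj -> /nval_inj ->] E]; split=> //; split=> //.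
by apply: NS_inj; exact: nval_inj.
Qed.

Lemma fraction_leE (a b c a' b' c' : N) :
  fraction_le (frac a b c) (frac a' b' c') <-> Fle a b c a' b' c'.
Proof.
split.
  move=> [x [y [z [x' [y' [z' [H1 [H2 H]]]]]]]].
  move/is_fractionE: H1 => [a1 [b1 [c1 [/frac_inj [<- [<- <-]] [Ex [Ey Ez]]]]]].
  move/is_fractionE: H2 => [a2 [b2 [c2 [/frac_inj [<- [<- <-]] [Ex' [Ey' Ez']]]]]].
  subst x y z x' y' z'; move: H => [m1 [m2 [n1 [n2 [s [s' [H1 [H2 [H3 [H4 [H5 [H6 H7]]]]]]]]]]]].
  move/nat_mul_N: H1 H3 => -> H3; move/nat_mul_N: H2 H3 => -> /nat_add_N E3.
  move/nat_mul_N: H4 H6 => -> H6; move/nat_mul_N: H5 H6 => -> /nat_add_N E6.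
  by subst s s'; exact/nat_leE.
move=> /nat_leE H.
exists (nval a), (nval b), (nval (NS c)), (nval a'), (nval b'), (nval (NS c')).
split; first by apply/is_fractionE; exists a, b, c.
split; first by apply/is_fractionE; exists a', b', c'.
exists (nval (a * NS c')), (nval (b' * NS c)), (nval (a' * NS c)), (nval (b * NS c')),
  (nval (a * NS c' + b' * NS c)), (nval (a' * NS c + b * NS c')).
by split; [exact/nat_mul_N|split; [exact/nat_mul_N|split; [exact/nat_add_N|
   split; [exact/nat_mul_N|split; [exact/nat_mul_N|split; [exact/nat_add_N|]]]]]].
Qed.

Lemma fraction_le_frac (t t' : V) : fraction_le t t' ->
  (exists a b c, t = frac a b c) /\ (exists a b c, t' = frac a b c).
Proof.
move=> [x [y [z [x' [y' [z' [H1 [H2 _]]]]]]]].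
move/is_fractionE: H1 => [a1 [b1 [c1 [-> _]]]]; move/is_fractionE: H2 => [a2 [b2 [c2 [-> _]]]].
by split; [exists a1, b1, c1|exists a2, b2, c2].
Qed.

Lemma fraction_le_trans (t u v : V) : fraction_le t u -> fraction_le u v -> fraction_le t v.
Proof.
move=> H1 H2.
have [[a [b [c Et]]] [a' [b' [c' Eu]]]] := fraction_le_frac H1.
have [_ [a'' [b'' [c'' Ev]]]] := fraction_le_frac H2; subst t u v.
move/fraction_leE: H1 => H1; move/fraction_leE: H2 => H2; apply/fraction_leE.
exact: Fle_trans H1 H2.
Qed.

Lemma Bdd_fractions : Bdd (fun t : V => exists a b c, t = frac a b c).
Proof.
have [w Hw] := Bdd_nat; have Hw' (a : N) : nval a ∈ w by exact: (Hw _ (proj2_sig a)).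
have [B HB] := V_bdd_pr w w.
have [C HC] := V_bdd_pr B w.
exists C => t [a [b [c ->]]]; apply: HC.
exists (pr (nval a) (nval b)), (nval (NS c)); split; last by split=> //; exact: Hw'.
by apply: HB; exists (nval a), (nval b); split; [exact: Hw'|split=> //; exact: Hw'].
Qed.

Definition cls (t : V) : V := setV (fun s => fraction_le s t /\ fraction_le t s).
Instance DefF1_cls : DefF1 cls.
Proof. by rewrite /cls; dfn. Qed.

Lemma in_cls (t s : V) : s ∈ cls t <-> fraction_le s t /\ fraction_le t s.
Proof.
apply: in_setV; first by dfn.
by apply: (Bdd_sub Bdd_fractions) => w [/fraction_le_frac [H _] _].
Qed.

Lemma rationalE (q : V) : is_rational q <-> exists a b c, q = cls (frac a b c).
Proof.
split=> [[t [[x [y [z /is_fractionE [a [b [c [-> _]]]]]]] H]]|[a [b [c ->]]]].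
  by exists a, b, c; apply: V_ext => s; rewrite H in_cls.
exists (frac a b c); split; last by move=> s; exact: in_cls.
by exists (nval a), (nval b), (nval (NS c)); apply/is_fractionE; exists a, b, c.
Qed.

Lemma in_cls_self (a b c : N) : frac a b c ∈ cls (frac a b c).
Proof. by apply/in_cls; split; apply/fraction_leE; exact: Fle_refl. Qed.

Lemma rational_leE (a b c a' b' c' : N) :
  rational_le (cls (frac a b c)) (cls (frac a' b' c')) <-> Fle a b c a' b' c'.
Proof.
split=> [[t [t' [/in_cls [H1 H2] [/in_cls [H3 H4] H]]]]|/fraction_leE H].
  by apply/fraction_leE; apply: fraction_le_trans H2 _; exact: fraction_le_trans H H3.
by exists (frac a b c), (frac a' b' c'); split; [exact: in_cls_self|split=> //; exact: in_cls_self].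
Qed.

Lemma cls_eq (a b c a' b' c' : N) : Fle a b c a' b' c' -> Fle a' b' c' a b c ->
  cls (frac a b c) = cls (frac a' b' c').
Proof.
move=> /fraction_leE H1 /fraction_leE H2; apply: V_ext => s; rewrite !in_cls.
by split=> -[H3 H4]; split; apply: fraction_le_trans; eassumption.
Qed.

Definition fraction_stage (n : V) : V :=
  setV (fun q => exists a b c, a ∈ n /\ b ∈ n /\ c ∈ n /\ q = cls (pr (pr a b) (suc c))).
Instance DefF1_fraction_stage : DefF1 fraction_stage.
Proof. by rewrite /fraction_stage; dfn. Qed.

Lemma FinP_fraction_stage (n : V) : is_nat n ->
  FinP (fun q => exists a b c, a ∈ n /\ b ∈ n /\ c ∈ n /\ q = cls (pr (pr a b) (suc c))).
Proof.
move=> Hn; have F : FinP (fun i => i ∈ n) by exact: Fin_FinP (Fin_nat Hn).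
apply: (FinP_sub (Q := fun q => exists a, a ∈ n /\ exists b, b ∈ n /\ exists c, c ∈ n /\ q = cls (pr (pr a b) (suc c)))).
  apply: FinP_bigU => //; try (by dfn); move=> a _.
  apply: FinP_bigU => //; try (by dfn); move=> b _.
  by apply: FinP_ex => //; try (by dfn); move=> c _ y y' -> ->.
by move=> q [a [b [c [H1 [H2 [H3 E]]]]]]; exists a; split=> //; exists b; split=> //; exists c.
Qed.

Lemma in_fraction_stage (n q : V) : is_nat n -> q ∈ fraction_stage n <->
  exists a b c : N, nval a ∈ n /\ nval b ∈ n /\ nval c ∈ n /\ q = cls (frac a b c).
Proof.
move=> Hn.
have H : q ∈ fraction_stage n <-> exists a b c, a ∈ n /\ b ∈ n /\ c ∈ n /\ q = cls (pr (pr a b) (suc c)).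
  by apply: in_setV; [dfn|exact: FinP_Bdd (FinP_fraction_stage Hn)].
rewrite H; split=> [[a [b [c [H1 [H2 [H3 E]]]]]]|[a [b [c [H1 [H2 [H3 E]]]]]]].
  by exists (exist _ a (mem_nat Hn H1) : N), (exist _ b (mem_nat Hn H2) : N), (exist _ c (mem_nat Hn H3) : N).
by exists (nval a), (nval b), (nval c).
Qed.

Lemma fraction_stage_cover (q : V) : is_rational q -> exists n, is_nat n /\ q ∈ fraction_stage n.
Proof.
move=> /rationalE [a [b [c ->]]]; exists (nval (NS (a + b + c))); split; first exact: nval_nat.
apply/in_fraction_stage; first exact: nval_nat.
exists a, b, c; split; first by apply/Nmem_add; exists (b + c); rewrite NaddS NaddA.
split; first by apply/Nmem_add; exists (a + c); rewrite !NS_add1; ring.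
by split=> //; apply/Nmem_add; exists (a + b); rewrite !NS_add1; ring.
Qed.

(** * The orders of the rationals and of the reals *)

Section RationalOrder.
Context (X L : V) (HXL : is_rational_order X L).
Let le (x y : V) : Prop := pr x y ∈ L.

Lemma rle (a b c a' b' c' : N) : pr (cls (frac a b c)) (cls (frac a' b' c')) ∈ L <-> Fle a b c a' b' c'.
Proof.
rewrite -rational_leE (proj2 HXL); split=> [[q [q' [Hq [Hq' [Hle /is_pairE /pr_inj [-> ->]]]]]] //|H].
exists (cls (frac a b c)), (cls (frac a' b' c')).
split; first by apply/rationalE; exists a, b, c.
split; first by apply/rationalE; exists a', b', c'.
by split=> //; apply/is_pairE.
Qed.

Lemma in_rationals q : q ∈ X <-> exists a b c, q = cls (frac a b c).
Proof. by rewrite (proj1 HXL) rationalE. Qed.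

Lemma rational_order_dom l : l ∈ L -> exists x y, x ∈ X /\ y ∈ X /\ l = pr x y.
Proof.
move=> /(proj2 HXL) [q [q' [Hq [Hq' [_ /is_pairE ->]]]]].
by exists q, q'; split; [apply/(proj1 HXL)|split=> //; apply/(proj1 HXL)].
Qed.

Lemma rational_linear : linear X le.
Proof.
split.
- by rewrite /le; dfn.
- by move=> x y /rational_order_dom [x' [y' [Hx [Hy /pr_inj [-> ->]]]]].
- by move=> x /in_rationals [a [b [c ->]]]; apply/rle; exact: Fle_refl.
- move=> x y z Hxy Hyz.
  have [x' [y' [/in_rationals [a [b [c Ex]]] [/in_rationals [a' [b' [c' Ey]]] /pr_inj [E1 E2]]]]] := rational_order_dom Hxy.
  have [_ [z' [_ [/in_rationals [a'' [b'' [c'' Ez]]] /pr_inj [_ E4]]]]] := rational_order_dom Hyz.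
  subst x y z x' y' z'; apply/rle; exact: Fle_trans (proj1 (rle _ _ _ _ _ _) Hxy) (proj1 (rle _ _ _ _ _ _) Hyz).
- move=> x y Hxy Hyx.
  have [x' [y' [/in_rationals [a [b [c Ex]]] [/in_rationals [a' [b' [c' Ey]]] /pr_inj [E1 E2]]]]] := rational_order_dom Hxy.
  by subst x y x' y'; apply: cls_eq; exact/rle.
- move=> x y /in_rationals [a [b [c ->]]] /in_rationals [a' [b' [c' ->]]].
  have [H|/Flt_le H] := Fle_total a b c a' b' c'; [by left; apply/rle|by right; apply/rle].
Qed.

Lemma rlt (a b c a' b' c' : N) : slt le (cls (frac a b c)) (cls (frac a' b' c')) <-> Flt a b c a' b' c'.
Proof.
rewrite Flt_not -rle; split=> [H|H]; first exact: (slt_not rational_linear H).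
by apply: (not_le rational_linear) => //; apply/in_rationals; [exists a, b, c|exists a', b', c'].
Qed.

Lemma rational_dense : dense_order X le.
Proof.
split; first exact: rational_linear.
- by exists (cls (frac N0 N0 N0)); apply/in_rationals; exists N0, N0, N0.
- move=> x y Hxy Nxy.
  have [x' [y' [/in_rationals [a [b [c Ex]]] [/in_rationals [a' [b' [c' Ey]]] /pr_inj [E1 E2]]]]] := rational_order_dom Hxy.
  subst x y x' y'.
  have [a'' [b'' [c'' [/rlt [H1 H2] /rlt [H3 H4]]]]] := F_dense (proj1 (rlt _ _ _ _ _ _) (conj Hxy Nxy)).
  by exists (cls (frac a'' b'' c'')).
- by move=> x /in_rationals [a [b [c ->]]]; exists (cls (frac a (b + NS c) c)); apply/rlt; exact: F_below.
- by move=> x /in_rationals [a [b [c ->]]]; exists (cls (frac (a + NS c) b c)); apply/rlt; exact: F_above.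
Qed.

Lemma rational_separable : separable_order X le.
Proof.
split; first exact: rational_dense.
exists fraction_stage; split; first exact: DefF1_fraction_stage.
split; [|split].
- move=> n Hn; split.
    apply: FinP_set; apply: FinP_sub (FinP_fraction_stage Hn) _ => q.
    move=> /(in_fraction_stage _ Hn) [a [b [c [H1 [H2 [H3 E]]]]]].
    by exists (nval a), (nval b), (nval c).
  by move=> q /(in_fraction_stage _ Hn) [a [b [c [_ [_ [_ ->]]]]]]; apply/in_rationals; exists a, b, c.
- move=> x y [Hxy Nxy]; have [z [H1 [H2 [H3 H4]]]] := do_dense rational_dense Hxy Nxy.
  have [_ Xz] := lin_dom rational_linear H1.
  have [n [Hn Hz]] := fraction_stage_cover (proj1 (proj1 HXL z) Xz).
  by exists n, z.
- move=> g Ig Hg x Xx; have [n [Hn Hx]] := fraction_stage_cover (proj1 (proj1 HXL x) Xx).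
  have [[y Hy] _] := Hg n x Hn Hx; exists y; split; last by move=> d e H; exact: (proj2 Ig).
  by have [d [e [_ [Xe /pr_inj [_ ->]]]]] := proj1 Ig _ Hy.
Qed.
End RationalOrder.

(** * Dedekind cuts, with the rational cuts as dense stages *)

Section RealOrder.
Context (X L : V) (HXL : is_rational_order X L).
Context (Y K : V) (HYK : is_real_order Y K).
Let qle (x y : V) : Prop := pr x y ∈ L.
Let kle (x y : V) : Prop := pr x y ∈ K.
Let QL : linear X qle := rational_linear HXL.
Let QD : dense_order X qle := rational_dense HXL.

Lemma rational_le_order x y : x ∈ X -> y ∈ X -> rational_le x y <-> qle x y.
Proof.
move=> /(in_rationals HXL) [a [b [c ->]]] /(in_rationals HXL) [a' [b' [c' ->]]].
by rewrite rational_leE -(rle HXL).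
Qed.

Lemma realE x : is_real x <-> ((x ⊆ X) /\ (exists q, q ∈ x) /\
  (exists q, q ∈ X /\ ~ q ∈ x) /\ (forall q q', q ∈ x -> qle q' q -> q' ∈ x) /\
  (forall q, q ∈ x -> exists q', q' ∈ x /\ slt qle q q')).
Proof.
have HX q : q ∈ X <-> is_rational q := proj1 HXL q.
split=> -[H1 [H2 [[q0 [H3 H3']] [H4 H5]]]].
  have H1' q : q ∈ x -> q ∈ X by move=> /H1 /HX.
  split=> //; split=> //; split; first by exists q0; split=> //; apply/HX.
  split=> [q q' Hq Hle|q Hq].
    have [Xq' _] := lin_dom QL Hle.
    by apply: (H4 q q' Hq); [apply/HX|apply/rational_le_order => //; exact: H1'].
  have [q' [Hq' [Hle Ne]]] := H5 q Hq; exists q'; split=> //; split=> //.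
  by apply/rational_le_order => //; exact: H1'.
split; first by move=> q /H1 /HX.
split=> //; split; first by exists q0; split=> //; apply/HX.
split=> [q q' Hq /HX Rq' Hle|q Hq].
  by apply: (H4 q q' Hq); apply/rational_le_order => //; exact: H1.
have [q' [Hq' [Hle Ne]]] := H5 q Hq; exists q'; split=> //; split=> //.
by apply/rational_le_order => //; exact: H1.
Qed.

Lemma in_reals x : x ∈ Y <-> is_real x.
Proof. exact: (proj1 HYK). Qed.

Lemma kleE x y : kle x y <-> x ∈ Y /\ y ∈ Y /\ x ⊆ y.
Proof.
rewrite /kle (proj2 HYK) !in_reals; split.
  by move=> [c [c' [H1 [H2 [/subsetV H3 /is_pairE /pr_inj [-> ->]]]]]].
by move=> [H1 [H2 H3]]; exists x, y; split=> //; split=> //; split; [apply/subsetV|apply/is_pairE].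
Qed.

Lemma real_lt x q q' : x ∈ Y -> q ∈ x -> q' ∈ X -> ~ q' ∈ x -> slt qle q q'.
Proof.
move=> /in_reals /realE [H1 [_ [_ [H4 _]]]] Hq Xq' Nq'.
apply: (not_le QL) => //; first exact: H1.
by move=> H; apply: Nq'; exact: H4 Hq H.
Qed.

Lemma real_linear : linear Y kle.
Proof.
split.
- by rewrite /kle; dfn.
- by move=> x y /kleE [H1 [H2 _]].
- by move=> x Hx; apply/kleE.
- by move=> x y z /kleE [H1 [H2 H3]] /kleE [_ [H4 H5]]; apply/kleE; split=> //; split=> // q /H3 /H5.
- move=> x y /kleE [_ [_ H1]] /kleE [_ [_ H2]]; apply: V_ext => q; split; [exact: H1|exact: H2].
- move=> x y Yx Yy; case: (classic (x ⊆ y)) => H; first by left; apply/kleE.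
  right; apply/kleE; split=> //; split=> // r Hr; apply: NNPP => Nr.
  have RY := proj1 (realE y) (proj1 (in_reals y) Yy).
  have Xr : r ∈ X by apply: (proj1 RY).
  apply: H => q Hq; case: RY => _ [_ [_ [H4 _]]]; apply: H4 Hr _.
  by case: (real_lt Yx Hq Xr Nr).
Qed.

Definition rational_cut (q : V) : V := setV (fun r => r ∈ X /\ slt qle r q).
Instance DefF1_rational_cut : DefF1 rational_cut.
Proof. by rewrite /rational_cut /slt /qle; dfn. Qed.

Lemma in_cut q r : r ∈ rational_cut q <-> slt qle r q.
Proof.
have H : r ∈ rational_cut q <-> r ∈ X /\ slt qle r q.
  apply: in_setV; first by rewrite /slt /qle; dfn.
  by apply: (Bdd_sub (V_bdd X)) => s [].
rewrite H; split=> [[]//|S]; split=> //; by case: S => /(lin_dom QL) [].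
Qed.

Lemma cut_real q : q ∈ X -> rational_cut q ∈ Y.
Proof.
move=> Xq; apply/in_reals/realE; split; [|split; [|split; [|split]]].
- by move=> r /in_cut [/(lin_dom QL) []].
- by have [r Hr] := do_left QD Xq; exists r; apply/in_cut.
- by exists q; split=> // /in_cut [].
- by move=> r s /in_cut Hr Hs; apply/in_cut; exact: (le_slt QL Hs Hr).
- move=> r /in_cut [H1 H2]; have [s [H3 [H4 [H5 H6]]]] := do_dense QD H1 H2.
  by exists s; split; [apply/in_cut|].
Qed.

Lemma cut_lt x q : x ∈ Y -> q ∈ x -> slt kle (rational_cut q) x.
Proof.
move=> Yx Hq; have /realE [H1 [_ [_ [H4 _]]]] := proj1 (in_reals x) Yx.
split; last by move=> E; move: Hq; rewrite -E => /in_cut [].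
apply/kleE; split; first exact: cut_real (H1 _ Hq).
by split=> // r /in_cut [Hr _]; exact: H4 Hq Hr.
Qed.

Lemma le_cut x q : x ∈ Y -> q ∈ X -> ~ q ∈ x -> kle x (rational_cut q).
Proof.
move=> Yx Xq Nq; apply/kleE; split=> //; split; first exact: cut_real.
by move=> r Hr; apply/in_cut; exact: real_lt Hr Xq Nq.
Qed.

Lemma lt_cut x q q' : x ∈ Y -> ~ q ∈ x -> slt qle q q' -> slt kle x (rational_cut q').
Proof.
move=> Yx Nq Hq; have [Xq Xq'] := lin_dom QL (proj1 Hq).
apply: (le_slt real_linear (le_cut Yx Xq Nq)); apply: cut_lt; first exact: cut_real.
exact/in_cut.
Qed.

Lemma cut_between x y : slt kle x y ->
  exists q, q ∈ X /\ slt kle x (rational_cut q) /\ slt kle (rational_cut q) y.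
Proof.
move=> [Hle Ne]; have [Yx [Yy Hsub]] := proj1 (kleE x y) Hle.
have /realE [H1 [_ [_ [_ H5]]]] := proj1 (in_reals y) Yy.
have [q [Hq Nq]] : exists q, q ∈ y /\ ~ q ∈ x.
  apply: NNPP => H; apply: Ne; apply: V_ext => q; split; first exact: Hsub.
  by move=> Hq; apply: NNPP => Nq; apply: H; exists q.
(* The cut of [q] may coincide with [x]; since [y] has no greatest element, a larger [q'] in [y]
   makes both inequalities strict. *)
have [q' [Hq' Hlt]] := H5 q Hq.
exists q'; split; first exact: H1.
by split; [exact: lt_cut Nq Hlt|exact: cut_lt].
Qed.

Lemma real_dense : dense_order Y kle.
Proof.
split; first exact: real_linear.
- by have [q Xq] := do_point QD; exists (rational_cut q); exact: cut_real.
- by move=> x y H1 H2; have [q [_ [[H3 H4] [H5 H6]]]] := cut_between (conj H1 H2); exists (rational_cut q).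
- move=> x Yx; have /realE [_ [[q Hq] _]] := proj1 (in_reals x) Yx.
  by exists (rational_cut q); exact: cut_lt.
- move=> x Yx; have /realE [_ [_ [[q [Xq Nq]] _]]] := proj1 (in_reals x) Yx.
  have [q' Hq'] := do_right QD Xq.
  by exists (rational_cut q'); exact: lt_cut Nq Hq'.
Qed.

Definition real_stage (n : V) : V := setV (fun c => exists q, q ∈ fraction_stage n /\ c = rational_cut q).
Instance DefF1_real_stage : DefF1 real_stage.
Proof. by rewrite /real_stage; dfn. Qed.

Lemma stage_rational n q : is_nat n -> q ∈ fraction_stage n -> q ∈ X.
Proof.
move=> Hn /(in_fraction_stage _ Hn) [a [b [c [_ [_ [_ ->]]]]]].
by apply/(in_rationals HXL); exists a, b, c.
Qed.

Lemma FinP_real_stage n : is_nat n -> FinP (fun c => exists q, q ∈ fraction_stage n /\ c = rational_cut q).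
Proof.
move=> Hn; apply: FinP_ex; try (by dfn); last by move=> q _ c c' -> ->.
apply: FinP_sub (FinP_fraction_stage Hn) _ => q /(in_fraction_stage _ Hn) [a [b [c [H1 [H2 [H3 E]]]]]].
by exists (nval a), (nval b), (nval c).
Qed.

Lemma in_real_stage n c : is_nat n -> c ∈ real_stage n <-> exists q, q ∈ fraction_stage n /\ c = rational_cut q.
Proof. by move=> Hn; apply: in_setV; [dfn|exact: FinP_Bdd (FinP_real_stage Hn)]. Qed.

Lemma cut_stage q : q ∈ X -> exists n, is_nat n /\ rational_cut q ∈ real_stage n.
Proof.
move=> Xq; have [n [Hn Hq]] := fraction_stage_cover (proj1 (proj1 HXL q) Xq).
by exists n; split=> //; apply/(in_real_stage _ Hn); exists q.
Qed.

(* Dedekind completeness: the image of [x] is the union of the images of the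
   points below [x]. *)
Lemma real_fill g x : piso Y kle Y kle g ->
  (forall n x, is_nat n -> x ∈ real_stage n -> (exists e, pr x e ∈ g) /\ (exists d, pr d x ∈ g)) ->
  x ∈ Y -> exists y, y ∈ Y /\ forall d e, pr d e ∈ g -> (kle d x <-> kle e y).
Proof.
move=> Ig Hg Yx.
have Hcut q : q ∈ X -> exists e, pr (rational_cut q) e ∈ g.
  by move=> /cut_stage [n [Hn H]]; case: (Hg n _ Hn H).
have dom d e : pr d e ∈ g -> d ∈ Y /\ e ∈ Y.
  by move=> /(proj1 Ig) [d' [e' [Yd [Ye /pr_inj [-> ->]]]]].
have D : Def1 (fun r => r ∈ X /\ exists d e, pr d e ∈ g /\ kle d x /\ r ∈ e) by rewrite /kle; dfn.
have [|y Hy] := V_mk D; first by apply: (Bdd_sub (V_bdd X)) => r [].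
have Hsub d e : pr d e ∈ g -> kle d x -> e ⊆ y.
  move=> H1 H2 r Hr; apply/Hy; split; last by exists d, e.
  have [_ /in_reals /realE [H _]] := dom _ _ H1; exact: H.
have /realE [Rx1 [[qx Hqx] [[qx' [Xqx' Nqx']] _]]] := proj1 (in_reals x) Yx.
have Yy : y ∈ Y.
  apply/in_reals/realE; split; [by move=> r /Hy []|split; [|split; [|split]]].
  - have [e He] := Hcut qx (Rx1 _ Hqx); have [_ Ye] := dom _ _ He.
    have /realE [_ [[r Hr] _]] := proj1 (in_reals e) Ye.
    by exists r; apply: (Hsub _ _ He) => //; exact: (proj1 (cut_lt Yx Hqx)).
  (* Since [qx'] is not in [x], its cut is above [x]. The image [e] of that cut bounds all the sets
     united in [y], so a rational outside [e] is outside [y]. *)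
  - have [e He] := Hcut qx' Xqx'; have [_ Ye] := dom _ _ He.
    have /realE [_ [_ [[r [Xr Nr]] _]]] := proj1 (in_reals e) Ye.
    exists r; split=> // /Hy [_ [d [e' [H1 [H2 H3]]]]]; apply: Nr.
    have H4 : kle d (rational_cut qx').
      by apply: (lin_trans real_linear H2); exact: le_cut.
    have /kleE [_ [_ H5]] : kle e' e by apply/(proj2 Ig _ _ _ _ H1 He).
    exact: H5.
  - move=> q q' /Hy [_ [d [e [H1 [H2 H3]]]]] Hle; apply: (Hsub _ _ H1 H2).
    have [_ Ye] := dom _ _ H1.
    have /realE [_ [_ [_ [H4 _]]]] := proj1 (in_reals e) Ye; exact: H4 H3 Hle.
  - move=> q /Hy [_ [d [e [H1 [H2 H3]]]]]; have [_ Ye] := dom _ _ H1.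
    have /realE [_ [_ [_ [_ H5]]]] := proj1 (in_reals e) Ye.
    have [q' [Hq' Hlt]] := H5 q H3; exists q'; split=> //; exact: (Hsub _ _ H1 H2).
exists y; split=> // d e Hde; have [Yd Ye] := dom _ _ Hde.
split=> [Hdx|Hey]; first by apply/kleE; split=> //; split=> //; exact: Hsub Hde Hdx.
(* If [x] were below [d], a rational cut strictly between them would have its image [e1] strictly
   below [e]. But [e1] bounds the images of all points below [x], so [y] is below [e1], against [e]
   being below [y]. *)
apply: NNPP => N; have Hlt := not_le real_linear Yx Yd N.
have [q [Xq [H1 H2]]] := cut_between Hlt.
have [e1 He1] := Hcut q Xq; have [_ Ye1] := dom _ _ He1.
have H3 := piso_slt real_dense real_dense Ig He1 Hde H2.
apply: (slt_not real_linear H3); apply: (lin_trans real_linear Hey).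
apply/kleE; split=> //; split=> // r /Hy [_ [d' [e' [H4 [H5 H6]]]]].
have /kleE [_ [_ H7]] : kle e' e1; last exact: H7.
apply/(proj2 Ig _ _ _ _ H4 He1); exact: (lin_trans real_linear H5 (proj1 H1)).
Qed.

Lemma real_separable : separable_order Y kle.
Proof.
split; first exact: real_dense.
exists real_stage; split; first exact: DefF1_real_stage.
split; [|split].
- move=> n Hn; split.
    by apply: FinP_set; apply: FinP_sub (FinP_real_stage Hn) _ => c /(in_real_stage _ Hn).
  by move=> c /(in_real_stage _ Hn) [q [Hq ->]]; apply: cut_real; exact: stage_rational Hn Hq.
- move=> x y /cut_between [q [Xq [H1 H2]]]; have [n [Hn Hq]] := cut_stage Xq.
  by exists n, (rational_cut q).
- by move=> g Ig Hg x Yx; exact: real_fill.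
Qed.

Lemma real_order_dom l : l ∈ K -> exists x y, x ∈ Y /\ y ∈ Y /\ l = pr x y.
Proof.
move=> /(proj2 HYK) [q [q' [Hq [Hq' [_ /is_pairE ->]]]]].
by exists q, q'; split; [apply/in_reals|split=> //; apply/in_reals].
Qed.
End RealOrder.

(** All that is used of the two orders is [separable_order], so any two separable orders have
    equivalent permutation models; the comparison starts from the empty partial isomorphism. *)
Lemma underline_equivalent (X1 L1 X2 L2 : V)
  (P1 : forall l, l ∈ L1 -> exists x y, x ∈ X1 /\ y ∈ X1 /\ l = pr x y)
  (P2 : forall l, l ∈ L2 -> exists x y, x ∈ X2 /\ y ∈ X2 /\ l = pr x y) :
  separable_order X1 (fun x y => pr x y ∈ L1) -> separable_order X2 (fun x y => pr x y ∈ L2) ->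
  exists (u1 : PM X1 L1) (u2 : PM X2 L2),
    is_underline L1 (proj1_sig u1) /\ is_underline L2 (proj1_sig u2) /\
    forall phi : formula unit, sat (fun _ => u1) phi <-> sat (fun _ => u2) phi.
Proof.
move=> O1 O2; pose A1 := Vmodel P1 O1; pose A2 := Vmodel P2 O2.
have H1 : hsym (A := A1) (pr (atoms X1) (atom_order X1 L1)).
  by apply: hsym_pr; [exact: (@hsym_atoms A1 _ (atoms_spec X1))|exact: (@hsym_order A1 _ (atom_order_spec P1))].
have H2 : hsym (A := A2) (pr (atoms X2) (atom_order X2 L2)).
  by apply: hsym_pr; [exact: (@hsym_atoms A2 _ (atoms_spec X2))|exact: (@hsym_order A2 _ (atom_order_spec P2))].
pose (D := fun (X L : V) (x : Vstar X) => exists u G : Vstar X,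
  is_underline L u /\ is_Aut u G /\ in_PM G (F_fin G) x).
exists (exist (@D X1 L1) _ (proj2 (PM_hsym P1 O1 _) H1)), (exist (@D X2 L2) _ (proj2 (PM_hsym P2 O2 _) H2)).
split; first by apply/is_underlineE.
split; first by apply/is_underlineE.
move=> phi; apply: (@sat_sim unit A1 A2 _ _ (PM_hsym P1 O1) (PM_hsym P2 O2) phi _ _ emp).
  exact: PI_emp.
move=> _ /=; apply: sim_underline; [exact: atoms_spec|exact: atoms_spec|
  exact: atom_order_spec|exact: atom_order_spec].
Qed.

End Universe.

Theorem mainTheorem7
  (V : structure) (V_ZFC : ZFC V)
  (Q leQ R leR : V)
  (Q_def : is_rational_order Q leQ) (R_def : is_real_order R leR) :
  exists (uR : PM R leR) (uQ : PM Q leQ),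
    is_underline leR (proj1_sig uR) /\
    is_underline leQ (proj1_sig uQ) /\
    forall phi : formula unit,
      sat (fun _ => uR) phi <-> sat (fun _ => uQ) phi.
Proof.
apply: (@underline_equivalent V V_ZFC R leR Q leQ).
- exact: real_order_dom R_def.
- exact: rational_order_dom Q_def.
- exact: (real_separable V_ZFC Q_def R_def).
- exact: (rational_separable V_ZFC Q_def).
Qed.
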